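(* Let $\mathcal{F}$ be a family of extrapolation pairs on $\mathbb{R}^n$, and let $\Phi$ be a Young function with $1<i_\Phi\le I_\Phi<\infty$ and complementary function $\bar\Phi$. Let $u$ and $v$ be weights on $\mathbb{R}^n$ such that $v\in A_\infty$. Suppose that for some $p_0\in(0,\infty)$ and for every $w\in A_\infty$, $$\|f\|_{L^{p_0}(w)}\le C\,\|g\|_{L^{p_0}(w)},\qquad (f,g)\in\mathcal{F},\tag{H}$$ where $C$ is independent of $(f,g)$ and depends on $w$ only through its $A_\infty$ characteristic. Then for every $p\in(0,\infty)$ there is a constant $C$ such that $$\int_{\mathbb{R}^n}\Phi(f^pu)\,v\,dx\le C\int_{\mathbb{R}^n}\Phi(g^pu)\,v\,dx,\qquad (f,g)\in\mathcal{F},$$ provided that there is a constant $K_0$ with $$\int_{\mathbb{R}^n}\bar\Phi\big((M_vf)\,u^{-1}\big)\,v\,dx\le K_0\int_{\mathbb{R}^n}\bar\Phi\big(|f|\,u^{-1}\big)\,v\,dx\qquad\text{for all measurable } f.\tag{M}$$ Moreover, under hypothesis (M), (H) implies that for every $q\in(0,\infty)$ there is a constant $C$ such that $$\int_{\mathbb{R}^n}\Phi\Big(\Big(\sum_jf_j^q\Big)^{\frac1q}u\Big)v\,dx\le C\int_{\mathbb{R}^n}\Phi\Big(\Big(\sum_jg_j^q\Big)^{\frac1q}u\Big)v\,dx,\qquad \{(f_j,g_j)\}_j\subset\mathcal{F}.$$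
   Context: A weight on $\mathbb{R}^n$ is a measurable $w$ with $0<w<\infty$ a.e.; $w(E)=\int_E w\,dx$; $\|f\|_{L^p(w)}=(\int|f|^p w\,dx)^{1/p}$. The Hardy–Littlewood maximal operator is $Mf(x)=\sup_{Q\ni x}\frac1{|Q|}\int_Q|f|\,dy$ (sup over cubes $Q\ni x$). For $1<p<\infty$, $w\in A_p$ if $[w]_{A_p}=\sup_Q\big(\frac1{|Q|}\int_Q w\big)\big(\frac1{|Q|}\int_Q w^{1-p'}\big)^{p-1}<\infty$, where $1/p+1/p'=1$; $w\in A_1$ if $[w]_{A_1}=\|Mw/w\|_{L^\infty}<\infty$; $A_\infty=\bigcup_{p\ge1}A_p$. A constant depends on $w\in A_\infty$ only through its $A_\infty$ characteristic if, for every $q\in[1,\infty)$ and $K\ge1$, the same constant can be taken for all $w$ with $[w]_{A_q}\le K$. For a weight $v$, $M_vf(x)=\sup_{Q\ni x}\frac1{v(Q)}\int_Q|f|v\,dy$. A family of extrapolation pairs is a collection of pairs $(f,g)$ of nonnegative measurable functions on $\mathbb{R}^n$. A Young function is a continuous, convex, strictly increasing $\Phi:[0,\infty)\to[0,\infty)$ with $\Phi(t)/t\to0$ as $t\to0^+$ and $\Phi(t)/t\to\infty$ as $t\to\infty$; its complementary function is $\bar\Phi(t)=\sup_{s>0}\{st-\Phi(s)\}$. With $h_\Phi(t)=\sup_{s>0}\Phi(st)/\Phi(s)$, its dilation indices are $i_\Phi=\lim_{t\to0^+}\frac{\log h_\Phi(t)}{\log t}$ and $I_\Phi=\lim_{t\to\infty}\frac{\log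 h_\Phi(t)}{\log t}$. *)

(* Defs.v *)
From HB Require Import structures.
From mathcomp Require Import all_boot all_order all_algebra.
From mathcomp Require Import all_classical all_reals all_analysis.
From mathcomp Require Import measurable_realfun.
Set Implicit Arguments.
Unset Strict Implicit.
Unset Printing Implicit Defensive.
Import Order.TTheory GRing.Theory Num.Theory.
Import numFieldNormedType.Exports.
Local Open Scope classical_set_scope.
Local Open Scope ring_scope.
Local Open Scope ereal_scope.

(* Euclidean space of dimension n >= 1 is 'rV[R]_n.+1, so that every parameter
   [n] below is the dimension minus one. The library has Lebesgue measure only
   on the line; on 'rV[R]_n.+1 it is the Caratheodory measure of the outer
   measure given by countable covers by boxes, and "measurable" means
   Lebesgue-measurable (the measure is complete). *)

Definition box (R : realType) (n : nat)
    (ab : 'rV[R]_n.+1 * 'rV[R]_n.+1) : set 'rV[R]_n.+1 :=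
  [set x | forall i, (ab.1 ord0 i < x ord0 i <= ab.2 ord0 i)%R].

Definition box_volume (R : realType) (n : nat)
    (ab : 'rV[R]_n.+1 * 'rV[R]_n.+1) : R :=
  (\prod_(i < n.+1) Num.max 0 (ab.2 ord0 i - ab.1 ord0 i))%R.

Definition lebesgue_outer (R : realType) (n : nat)
    (X : set 'rV[R]_n.+1) : \bar R :=
  ereal_inf [set \sum_(k <oo) (box_volume (B k))%:E
            | B in [set B : nat -> 'rV[R]_n.+1 * 'rV[R]_n.+1
                   | X `<=` \bigcup_k box (B k)]].

Lemma box_volume_ge0 (R : realType) (n : nat)
    (ab : 'rV[R]_n.+1 * 'rV[R]_n.+1) : 0 <= (box_volume ab)%:E.
Proof. by rewrite lee_fin prodr_ge0// => i _; rewrite le_max lexx. Qed.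

Lemma lebesgue_outer_ge0 (R : realType) (n : nat) (X : set 'rV[R]_n.+1) :
  0 <= lebesgue_outer X.
Proof.
apply: le_ereal_inf_tmp => _ [B _ <-].
by apply: nneseries_ge0 => k _ _; exact: box_volume_ge0.
Qed.

Lemma lebesgue_outer0 (R : realType) (n : nat) :
  lebesgue_outer (set0 : set 'rV[R]_n.+1) = 0.
Proof.
apply/eqP; rewrite eq_le lebesgue_outer_ge0 andbT.
apply: ereal_inf_lbound; exists (fun=> (0%R, 0%R)); first exact: sub0set.
apply: eseries0 => k _ _; rewrite /box_volume (bigD1 ord0)//= !mxE.
by rewrite subrr maxxx mul0r.
Qed.

Lemma le_lebesgue_outer (R : realType) (n : nat) :
  {homo @lebesgue_outer R n : A B / A `<=` B >-> A <= B}.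
Proof.
move=> A B AB; apply/ereal_inf_le_tmp => _ [C BC <-].
by exists C => //; exact: subset_trans BC.
Qed.

Lemma lebesgue_outer_sigma_subadditive (R : realType) (n : nat) :
  sigma_subadditive (@lebesgue_outer R n).
Proof.
move=> A; have [[i ioo]|] := pselect (exists i, lebesgue_outer (A i) = +oo).
  rewrite (eseries_pinfty _ _ ioo) ?leey// => k _.
  by rewrite -ltNye (lt_le_trans _ (lebesgue_outer_ge0 _)).
rewrite -forallNE => Aoo.
suff add2e (e : {posnum R}) : lebesgue_outer (\bigcup_n A n) <=
    \sum_(i <oo) lebesgue_outer (A i) + e%:num%:E.
  by apply/lee_addgt0Pr => _/posnumP[].
rewrite (le_trans _ (epsilon_trick _ _ _))//; last first.
  by move=> k; exact: lebesgue_outer_ge0.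
pose P k (B : nat -> 'rV[R]_n.+1 * 'rV[R]_n.+1) :=
  A k `<=` \bigcup_j box (B j) /\
  \sum_(j <oo) (box_volume (B j))%:E <=
  lebesgue_outer (A k) + (e%:num / (2 ^ k.+1)%:R)%:E.
have [G PG] : {G & forall k, P k (G k)}.
  apply: (@choice _ _ P) => k; rewrite /P /lebesgue_outer.
  set S := (X in ereal_inf X); move infS : (ereal_inf S) => iS.
  case: iS infS => [r Sr|Soo|Soo].
  - have en1 : (0 < e%:num / (2 ^ k.+1)%:R)%R by [].
    have /(lb_ereal_inf_adherent en1) : ereal_inf S \is a fin_num by rewrite Sr.
    move=> [x [B AB muBx] xS].
    by exists B; split => //; rewrite muBx -Sr; exact/ltW.
  - by have := Aoo k; rewrite /lebesgue_outer Soo.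
  - suff : lbound S 0 by move/le_ereal_inf_tmp; rewrite Soo.
    move=> /= _ [B AB <-]; apply: nneseries_ge0 => j _ _.
    exact: box_volume_ge0.
pose vol (kj : nat * nat) : \bar R := (box_volume (G kj.1 kj.2))%:E.
have vol0 kj : 0 <= vol kj by exact: box_volume_ge0.
apply: (@le_trans _ _ (\esum_(i in setT) vol i)).
  apply: ereal_inf_lbound => /=.
  have /card_esym/ppcard_eqP[f] := card_nat2.
  exists (uncurry G \o f).
    move=> t [k _ /(PG k).1[j _ tj]].
    by exists (f^-1%FUN (k, j)) => //=; rewrite invK ?inE.
  transitivity (\sum_(k <oo) vol (f k)).
    by apply: eq_eseriesr => k _; rewrite /vol/=; case: (f k).
  rewrite -(esum_pred_image vol f xpredT) ?[fun=> _]set_true//.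
  by rewrite image_eq.
rewrite (_ : esum _ _ = \sum_(i <oo) \sum_(j <oo) vol (i, j)); last first.
  pose J : nat -> set (nat * nat) := fun i => [set (i, j) | j in setT].
  rewrite (_ : setT = \bigcup_k J k); last first.
    by rewrite predeqE => -[a b]; split => // _; exists a => //; exists b.
  rewrite esum_bigcupT //=; last first.
    apply/trivIsetP => i j _ _ ij.
    rewrite predeqE => -[k m] /=; split => //= -[] [_] _ [<-{k} _].
    by move=> [m' _] [] /esym/eqP; rewrite (negbTE ij).
  rewrite -(image_id [set: nat]) -fun_true esum_pred_image//; last first.
    by move=> k _; exact: esum_ge0.
  apply: eq_eseriesr => /= j _.
  rewrite -(esum_pred_image vol (pair j) predT)//=; last first.
    by move=> ? ? _ _; exact: (@can_inj _ _ _ snd).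
  by congr esum; rewrite predeqE => -[a b]; split; move=> [i _ <-]; exists i.
apply: lee_nneseries => [k _ _|k _]; last exact: (PG k).2.
by apply: nneseries_ge0 => j _ _; exact: vol0.
Qed.

HB.instance Definition _ (R : realType) (n : nat) :=
  isOuterMeasure.Build R 'rV[R]_n.+1 (@lebesgue_outer R n)
    (@lebesgue_outer0 R n) (@lebesgue_outer_ge0 R n)
    (@le_lebesgue_outer R n) (@lebesgue_outer_sigma_subadditive R n).

Definition euclidean (R : realType) (n : nat) :=
  caratheodory_type (@lebesgue_outer R n).
HB.instance Definition _ (R : realType) (n : nat) :=
  Measurable.on (euclidean R n).

Definition lebesgue (R : realType) (n : nat) : set (euclidean R n) -> \bar R :=
  @lebesgue_outer R n.
HB.instance Definition _ (R : realType) (n : nat) :=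
  isMeasure.Build _ (euclidean R n) R (@lebesgue R n)
    (@caratheodory_measure0 R 'rV[R]_n.+1 (@lebesgue_outer R n))
    (@caratheodory_measure_ge0 R 'rV[R]_n.+1 (@lebesgue_outer R n))
    (@caratheodory_measure_sigma_additive R 'rV[R]_n.+1
       (@lebesgue_outer R n)).

(* Functions on the space take values in [-oo, +oo]; powers and products of
   extended reals use the library conventions (0 * oo = 0), which matter only
   on null sets where weights are concerned. *)

Definition cube (R : realType) (n : nat) (a : 'rV[R]_n.+1) (l : R)
    : set (euclidean R n) :=
  [set x : 'rV[R]_n.+1 | forall i, (a ord0 i < x ord0 i < a ord0 i + l)%R].

Definition cubes (R : realType) (n : nat) : set (set (euclidean R n)) :=
  [set Q | exists a l, (0 < l)%R /\ Q = cube a l].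

Definition average (R : realType) (n : nat) (f : euclidean R n -> \bar R)
    (Q : set (euclidean R n)) : \bar R :=
  (lebesgue Q)^-1 * \int[@lebesgue R n]_(y in Q) f y.

Definition maximal (R : realType) (n : nat) (f : euclidean R n -> \bar R)
    (x : euclidean R n) : \bar R :=
  ereal_sup [set average (fun y => `|f y|) Q | Q in [set Q | cubes Q /\ Q x]].

Definition weight (R : realType) (n : nat) (w : euclidean R n -> \bar R) :=
  measurable_fun [set: euclidean R n] w /\
  {ae @lebesgue R n, forall x, 0 < w x < +oo}.

Definition weighted_volume (R : realType) (n : nat)
    (w : euclidean R n -> \bar R) (E : set (euclidean R n)) : \bar R :=
  \int[@lebesgue R n]_(x in E) w x.

Definition weighted_maximal (R : realType) (n : nat)
    (v f : euclidean R n -> \bar R) (x : euclidean R n) : \bar R :=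
  ereal_sup [set (weighted_volume v Q)^-1 *
                 \int[@lebesgue R n]_(y in Q) (`|f y| * v y)
            | Q in [set Q | cubes Q /\ Q x]].

Definition weighted_Lnorm (R : realType) (n : nat) (p : R)
    (w f : euclidean R n -> \bar R) : \bar R :=
  (\int[@lebesgue R n]_x (`|f x| `^ p * w x)) `^ p^-1.

(* [w]_{A_p}; the conjugate exponent p' of 1 < p is p / (p - 1). *)
Definition Ap_char (R : realType) (n : nat) (p : R)
    (w : euclidean R n -> \bar R) : \bar R :=
  if p == 1%R then Lnorm (@lebesgue R n) +oo (fun x => maximal w x / w x)
  else ereal_sup
    [set average w Q * average (fun x => w x `^ (1 - p / (p - 1))) Q `^ (p - 1)
    | Q in @cubes R n].

Definition Ap (R : realType) (n : nat) (p : R) (w : euclidean R n -> \bar R) :=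
  weight w /\ Ap_char p w < +oo.

Definition Ainfty (R : realType) (n : nat) (w : euclidean R n -> \bar R) :=
  exists2 p : R, (1 <= p)%R & Ap p w.

(* "For every w in A_infty, [P w C] holds with a constant C that depends on w
   only through its A_infty characteristic". As every w in A_infty satisfies
   [w]_{A_q} <= K for some q and K, this includes the existence of C for each
   such w. *)
Definition Ainfty_uniformly (R : realType) (n : nat)
    (P : (euclidean R n -> \bar R) -> R -> Prop) :=
  forall q K : R, (1 <= q)%R -> (1 <= K)%R ->
  exists2 C : R, (0 < C)%R &
    forall w, weight w -> Ap_char q w <= K%:E -> P w C.

Definition extrapolation_family (R : realType) (n : nat)
    (F : set ((euclidean R n -> \bar R) * (euclidean R n -> \bar R))) :=
  forall f g, F (f, g) ->
    [/\ measurable_fun [set: euclidean R n] f,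
        measurable_fun [set: euclidean R n] g,
        forall x, 0 <= f x & forall x, 0 <= g x].

(* Only the values of Phi on [0, +oo[ matter. *)
Definition young_function (R : realType) (Phi : R -> R) :=
  [/\ (forall t, 0 <= t -> 0 <= Phi t)%R,
      {within `[0%R, +oo[, continuous Phi},
      @convex_function R R^o `[0%R, +oo[ Phi,
      {in `[0%R, +oo[ &, {homo Phi : s t / (s < t)%R}} &
      (Phi t / t)%R @[t --> 0^'+] --> 0%R /\
      (Phi t / t)%R @[t --> +oo%R] --> +oo%R].

(* The extension by Phi(+oo) = +oo. *)
Definition young_ext (R : realType) (Phi : R -> R) (t : \bar R) : \bar R :=
  if t is r%:E then (Phi r)%:E else +oo.

Definition young_compl (R : realType) (Phi : R -> R) (t : \bar R) : \bar R :=
  ereal_sup [set s%:E * t - (Phi s)%:E | s in [set s : R | (0 < s)%R]].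

Definition young_dilation (R : realType) (Phi : R -> R) (t : R) : \bar R :=
  ereal_sup [set (Phi (s * t) / Phi s)%:E | s in [set s : R | (0 < s)%R]].

Definition lower_index (R : realType) (Phi : R -> R) : \bar R :=
  lim ((lne (young_dilation Phi t) / (ln t)%:E) @[t --> (0%R : R)^'+]).

Definition upper_index (R : realType) (Phi : R -> R) : \bar R :=
  lim ((lne (young_dilation Phi t) / (ln t)%:E) @[t --> (+oo%R : set_system R)]).

(* Main.v *)
Require Import Defs.
From mathcomp Require Import all_boot all_order all_algebra.
From mathcomp Require Import all_classical all_reals all_analysis.
From mathcomp Require Import measurable_realfun.
From mathcomp Require Import ess_sup_inf ring lra.
Set Implicit Arguments.
Unset Strict Implicit.
Unset Printing Implicit Defensive.
Import Order.TTheory GRing.Theory Num.Theory.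
Import numFieldNormedType.Exports.
Local Open Scope classical_set_scope.
Local Open Scope ring_scope.
Local Open Scope ereal_scope.

(** The conclusion is a duality argument driven by the Rubio de Francia
    algorithm, run with the maximal operator [M_v] itself.

    Fix a pair and put [a = f^p u], [h = u Phi(a) / a], so that
    [int Phi(a) v = int f^p h v] and, by convexity,
    [int Phibar(h / u) v <= int Phi(a) v].  The series
    [H = sum_k 2^(-k-1) K^(-k) M_v^k h] majorizes [h / 2], satisfies
    [M_v H <= 2 K H], and by convexity of [Phibar] and assumption (M) has
    [int Phibar(H / u) v <= int Phibar(h / u) v] ([rubio_de_francia]).  The
    bound [M_v H <= 2 K H] says that [H] is at least a constant times its
    [v]-average on every cube, whence [H v] lies in the same class [A_q] as
    [v], with a constant independent of [h] ([relative_A1_mul]).  So (H) applies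
    to the weight [H v], and the pointwise Young inequality
    [4 C g^p H <= Phi(4 C g^p u) + Phibar(H / u)] gives
    [2 int Phi(a) v <= int Phi(4 C g^p u) v + int Phi(a) v]; the last term is
    absorbed once [f] has been truncated to make it finite
    ([modular_absorption], [modular_truncation]), and the doubling property of
    [Phi] removes the factor [4 C].

    This uses (H) with the exponent [p] in place of [p0], for all weights of
    each class [A_q], [q > 1].  The same modular argument with
    [Phi(s) = s^2], [u = 1] and the weight [w] itself in place of [v] turns the
    exponent [p] into [2 p] ([extrapolate_double]).  To pass to an exponent
    [r < p], one takes [G] from the algorithm applied to [g^(r/2)]; then
    [G^(-s) w] is a Muckenhoupt weight ([relative_A1_powN]), (H) is applied to
    it, and Hoelder's inequality restores [w] ([extrapolate_down]).  Both steps
    only need that [M_w] is bounded on [L^2(w)]: Muckenhoupt weights are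
    doubling, so the Vitali covering argument gives a weak type bound, and
    summation over dyadic levels a strong one ([strong_type_maximal]).

    Once every exponent is available, the vector-valued statement is the scalar
    one for the pairs of [l^q] norms: at the exponent [q] the assumption for
    these pairs follows by summing over [j] ([extrapolate_vector]).

    Weights are only positive and finite almost everywhere; they are replaced
    throughout by everywhere positive real-valued representatives, for which
    the [A_q] condition is a statement about real numbers ([muckenhoupt]). *)

(** * Volume of cubes *)

Section Geometry.
Context (R : realType) (n : nat).
Local Notation V := 'rV[R]_n.+1.
Local Notation X := (euclidean R n).
Local Notation mu := (@lebesgue R n).

Definition set_coord (x : V) (j : 'I_n.+1) (t : R) : V :=
  \row_i (if i == j then t else x ord0 i).

(** The indicator of the cube is bounded by the sum of the indicators of the
    boxes; integrating this inequality in one coordinate after the other against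
    Lebesgue measure on the line replaces the indicators by side lengths.  At
    stage [m] of the induction the first [m] coordinates are integrated. *)
Lemma cube_cover_volume (a : V) (l : R) (B : nat -> V * V) : (0 < l)%R ->
  cube a l `<=` \bigcup_k box (B k) ->
  (l ^+ n.+1)%:E <= \sum_(k <oo) (box_volume (B k))%:E.
Proof.
move=> l0 aB.
pose side k (i : 'I_n.+1) : R :=
  Num.max 0%R ((B k).2 ord0 i - (B k).1 ord0 i)%R.
pose ivl k (i : 'I_n.+1) : set R :=
  [set` `](B k).1 ord0 i, (B k).2 ord0 i]%R].
have side0 k i : (0 <= side k i)%R by rewrite le_max lexx.
pose co m (x : V) k := ((\prod_(i < n.+1 | (i < m)%N) side k i) *
   \prod_(i < n.+1 | (m <= i)%N) (\1_(ivl k i) (x ord0 i)))%R.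
have co0 m x k : 0 <= (co m x k)%:E.
  by rewrite lee_fin mulr_ge0// prodr_ge0.
suff H m x : (m <= n.+1)%N -> cube a l x ->
    (\prod_(i < n.+1 | (i < m)%N) l)%:E <= \sum_(k <oo) (co m x k)%:E.
  pose c : V := \row_i (a ord0 i + l / 2)%R.
  have /(H n.+1 c (leqnn _)) : cube a l c.
    by move=> i; rewrite /c mxE; apply/andP; split; lra.
  rewrite (eq_bigl xpredT); last by move=> i; rewrite ltn_ord.
  rewrite prodr_const card_ord => /le_trans; apply.
  apply: lee_nneseries => // k _.
  rewrite lee_fin /co [X in (_ * X)%R]big_pred0 ?mulr1; last first.
    by move=> i; rewrite leqNgt ltn_ord.
  rewrite /box_volume /side le_eqVlt; apply/orP; left; apply/eqP.
  by apply: eq_bigl => i; rewrite ltn_ord.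
elim: m x => [|m IH] x mn cx.
  rewrite big_pred0//; have [k _ Bk] := aB x cx.
  apply: (@le_trans _ _ (co 0%N x k)%:E).
    rewrite lee_fin /co big_pred0// mul1r big1// => i _.
    by rewrite indicE mem_set// /ivl/= in_itv/=; exact: Bk.
  rewrite (@nneseriesD1 _ _ k xpredT)// leeDl//.
  exact: nneseries_ge0.
pose j := Ordinal mn.
have lt_mS (i : 'I_n.+1) : (i < m.+1)%N = (i == j) || (i < m)%N.
  by rewrite ltnS leq_eqVlt.
have split_lt (F : 'I_n.+1 -> R) : (\prod_(i < n.+1 | (i < m.+1)%N) F i =
    F j * \prod_(i < n.+1 | (i < m)%N) F i)%R.
  rewrite (bigD1 j)//=; congr (_ * _)%R; apply: eq_bigl => i.
  rewrite lt_mS -val_eqE/=; case: eqP => [->|_] /=; first by rewrite ltnn.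
  by rewrite andbT.
have split_ge (F : 'I_n.+1 -> R) : (\prod_(i < n.+1 | (m <= i)%N) F i =
    F j * \prod_(i < n.+1 | (m.+1 <= i)%N) F i)%R.
  rewrite (bigD1 j)//=; congr (_ * _)%R; apply: eq_bigl => i.
  by rewrite ltn_neqAle andbC eq_sym -val_eqE.
pose D := [set` `]a ord0 j, a ord0 j + l[%R] : set R.
have mD : measurable D by exact: measurable_itv.
have lD : lebesgue_measure D = l%:E.
  by rewrite lebesgue_measure_itv/= lte_fin ifT ?ltrDl// -EFinB addrAC subrr add0r.
pose c k := ((\prod_(i < n.+1 | (i < m)%N) side k i) *
   \prod_(i < n.+1 | (m.+1 <= i)%N) (\1_(ivl k i) (x ord0 i)))%R.
have c0 k : (0 <= c k)%R by rewrite mulr_ge0// prodr_ge0.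
have coE k t : co m (set_coord x j t) k = (c k * \1_(ivl k j) t)%R.
  rewrite /co /c split_ge mxE eqxx mulrCA mulrC; congr (_ * _ * _)%R.
  by apply: eq_bigr => i mi; rewrite mxE -val_eqE/= gtn_eqF.
have coE' k : co m.+1 x k = (c k * side k j)%R.
  by rewrite /co /c split_lt -mulrA mulrC.
rewrite split_lt; set q := (X in (l * X)%R).
have -> : (l * q)%:E = \int[lebesgue_measure]_(t in D) (cst q%:E) t.
  rewrite integral_cst//; transitivity (q%:E * l%:E); first by rewrite -EFinM mulrC.
  by congr (_ * _); exact/esym/lD.
apply: (@le_trans _ _ (\int[lebesgue_measure]_(t in D)
    \sum_(k <oo) (c k * \1_(ivl k j) t)%:E)).
  apply: ge0_le_integral => //.
  - by move=> t _; rewrite lee_fin prodr_ge0// => ? _; exact: ltW.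
  - apply: ge0_emeasurable_sum => //.
      by move=> k t _ _; rewrite lee_fin mulr_ge0.
    move=> k _; apply/measurable_EFinP; apply: measurable_funM => //.
    by apply: measurable_indic; exact: measurable_itv.
  - move=> t Dt; have := IH (set_coord x j t) (ltnW mn).
    under [in X in _ -> X]eq_eseriesr do rewrite -coE.
    apply => i; rewrite mxE; case: eqP => [->|_]; last exact: cx.
    by move: Dt; rewrite /D/= in_itv.
rewrite integral_nneseries//.
- apply: lee_nneseries => [k _ _|k _].
    by apply: integral_ge0 => t _; rewrite lee_fin mulr_ge0.
  rewrite coE' EFinM; under eq_integral do rewrite EFinM.
  rewrite ge0_integralZl//; last 2 first.
  - by apply/measurable_EFinP; apply: measurable_indic; exact: measurable_itv.
  - by rewrite lee_fin.
  rewrite integral_indic//; last exact: measurable_itv.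
  apply: lee_wpmul2l; first by rewrite lee_fin.
  apply: (@le_trans _ _ (lebesgue_measure (ivl k j))).
    apply: le_measure; rewrite ?inE//; first by apply: measurableI => //; exact: measurable_itv.
    exact: measurable_itv.
  rewrite /ivl lebesgue_measure_itv/= lte_fin /side.
  case: ifP => h; first by rewrite -EFinB lee_fin le_max lexx orbT.
  by rewrite lee_fin le_max lexx.
- move=> k; apply/measurable_EFinP; apply: measurable_funM => //.
  by apply: measurable_indic; exact: measurable_itv.
- by move=> k t _; rewrite lee_fin mulr_ge0.
Qed.

Lemma lebesgue_outer_cube (a : V) (l : R) : (0 < l)%R ->
  lebesgue_outer (cube a l) = (l ^+ n.+1)%:E.
Proof.
move=> l0; apply/eqP; rewrite eq_le; apply/andP; split; last first.
  by apply: le_ereal_inf_tmp => _ [B aB <-]; apply: cube_cover_volume l0 aB.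
apply: ereal_inf_lbound => /=.
pose b : V := \row_i (a ord0 i + l)%R.
exists (fun k : nat => if k == 0%N then (a, b) else (0%R, 0%R)).
  move=> x ax; exists 0%N => // i.
  by have /andP[? ?] := ax i; rewrite mxE; apply/andP; split => //; exact: ltW.
rewrite (@nneseriesD1 _ _ 0%N xpredT)//=.
  rewrite eseries0 ?adde0//.
    rewrite /box_volume/= (eq_bigr (fun=> l)).
      by rewrite prodr_const card_ord.
    move=> i _; rewrite mxE addrAC subrr add0r; apply/max_idPr; exact: ltW.
  case=> // k _ _; rewrite /box_volume (bigD1 ord0)//= !mxE.
  by rewrite subrr maxxx mul0r.
by move=> k _; exact: box_volume_ge0.
Qed.

Lemma box_volume_split (ab : V * V) (i : 'I_n.+1) (c : R) :
  box_volume ab =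
  (box_volume (ab.1, set_coord ab.2 i (Num.min (ab.2 ord0 i) c)) +
   box_volume (set_coord ab.1 i (Num.max (ab.1 ord0 i) c), ab.2))%R.
Proof.
have volE (cd : V * V) : box_volume cd =
    (Num.max 0 (cd.2 ord0 i - cd.1 ord0 i) *
     \prod_(j < n.+1 | j != i) Num.max 0 (cd.2 ord0 j - cd.1 ord0 j))%R.
  by rewrite /box_volume (bigD1 i).
rewrite !volE /= !mxE eqxx.
have -> : (\prod_(j < n.+1 | j != i) Num.max 0
    (set_coord ab.2 i (Num.min (ab.2 ord0 i) c) ord0 j - ab.1 ord0 j) =
  \prod_(j < n.+1 | j != i) Num.max 0 (ab.2 ord0 j - ab.1 ord0 j))%R.
  by apply: eq_bigr => j /negbTE ji; rewrite mxE ji.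
have -> : (\prod_(j < n.+1 | j != i) Num.max 0
    (ab.2 ord0 j - set_coord ab.1 i (Num.max (ab.1 ord0 i) c) ord0 j) =
  \prod_(j < n.+1 | j != i) Num.max 0 (ab.2 ord0 j - ab.1 ord0 j))%R.
  by apply: eq_bigr => j /negbTE ji; rewrite mxE ji.
rewrite -mulrDl; congr (_ * _)%R.
have maxE (x : R) : Num.max 0%R x = if (0 < x)%R then x else 0%R by [].
rewrite !maxE !(minElt, maxElt).
by do ![case: ifPn => //]; rewrite -?leNgt; lra.
Qed.

(** A half-space splits every box of a cover into two boxes whose volumes add
    up, which is the Caratheodory criterion. *)
Lemma measurable_halfspace (i : 'I_n.+1) (c : R) :
  measurable ([set x : V | (x ord0 i <= c)%R] : set X).
Proof.
apply: le_caratheodory_measurable => Y /=.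
apply: le_ereal_inf_tmp => _ [B YB <-].
rewrite (eq_eseriesr (fun k _ => congr1 EFin (box_volume_split (B k) i c))).
under eq_eseriesr do rewrite EFinD.
rewrite nneseriesD//; [|by move=> *; exact: box_volume_ge0..].
apply: leeD; apply: ereal_inf_lbound => /=.
- exists (fun k => ((B k).1, set_coord (B k).2 i (Num.min ((B k).2 ord0 i) c))) => //.
  move=> x [/YB[k _ xk] xc]; exists k => // j /=; rewrite mxE.
  by case: eqP => [->|_]; [rewrite le_min xc andbT|]; exact: xk.
- exists (fun k => (set_coord (B k).1 i (Num.max ((B k).1 ord0 i) c), (B k).2)) => //.
  move=> x [/YB[k _ xk] /negP]; rewrite -ltNge => xc; exists k => // j /=.
  rewrite mxE; case: eqP => [->|_]; last exact: xk.
  by rewrite gt_max xc andbT; exact: xk.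
Qed.

(** Open boxes with independent sides: those with rational corners form the
    countable base behind [cubes_lindelof]. *)
Definition obox (p : 'rV[R]_n.+1 * 'rV[R]_n.+1) : set X :=
  [set x : V | forall i, (p.1 ord0 i < x ord0 i < p.2 ord0 i)%R].

Lemma measurable_obox p : measurable (obox p).
Proof.
have -> : obox p = \bigcap_i
    (~` [set x : V | (x ord0 i <= p.1 ord0 i)%R] `&`
     \bigcup_k [set x : V | (x ord0 i <= p.2 ord0 i - k.+1%:R^-1)%R]).
  apply/seteqP; split => [x xp i _|x xp i].
  - have /andP[h1 h2] := xp i; split; first by apply/negP; rewrite -ltNge.
    have /ltr_add_invr[k] := h2.
    by rewrite -ltrBrDr => /ltW hk; exists k.
  - have [/negP h1 [k _ /= h2]] := xp i I; apply/andP; split.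
      by rewrite ltNge.
    by apply: le_lt_trans h2 _; rewrite ltrBlDr ltrDl invr_gt0.
apply: fin_bigcap_measurable => // i _.
apply: measurableI; first by apply: measurableC; exact: measurable_halfspace.
by apply: bigcup_measurable => k _; exact: measurable_halfspace.
Qed.

Lemma cubeE a l : cube a l = obox (a, \row_i (a ord0 i + l)%R).
Proof.
by apply/seteqP; split => x xa i; have := xa i; rewrite /= ?mxE.
Qed.

Lemma measurable_cube a l : measurable (cube a l : set X).
Proof. by rewrite cubeE; exact: measurable_obox. Qed.

Lemma measurable_cubes Q : cubes Q -> measurable (Q : set X).
Proof. by move=> [a [l [_ ->]]]; exact: measurable_cube. Qed.

Lemma lebesgue_cube (a : V) (l : R) : (0 < l)%R ->
  mu (cube a l) = (l ^+ n.+1)%:E.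
Proof. exact: lebesgue_outer_cube. Qed.

Lemma obox_rat a l (x : X) : cube a l x ->
  exists2 pq : 'rV[rat]_n.+1 * 'rV[rat]_n.+1,
    obox (map_mx ratr pq.1, map_mx ratr pq.2) x &
    obox (map_mx ratr pq.1, map_mx ratr pq.2) `<=` cube a l.
Proof.
move=> xa.
have /choice[p pP] i : exists q : rat, (a ord0 i < ratr q < x ord0 i)%R.
  have /andP[h _] := xa i; have [q] := rat_in_itvoo h.
  by rewrite in_itv; exists q.
have /choice[q qP] i : exists q : rat, (x ord0 i < ratr q < a ord0 i + l)%R.
  have /andP[_ h] := xa i; have [q] := rat_in_itvoo h.
  by rewrite in_itv; exists q.
exists (\row_i p i, \row_i q i).
  move=> i; rewrite /= !mxE.
  by have /andP[_ ->] := pP i; have /andP[-> _] := qP i.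
move=> y yp i; have := yp i; rewrite /= !mxE => /andP[h1 h2].
have /andP[h3 _] := pP i; have /andP[_ h4] := qP i.
by rewrite (lt_trans h3 h1) (lt_trans h2 h4).
Qed.

(** Each rational box contained in a member of [S] selects one such member;
    as every point of a member lies in such a box, the selected ones suffice. *)
Lemma cubes_lindelof (S : set (set X)) : S `<=` @cubes R n -> S !=set0 ->
  exists Q : nat -> set X, (forall k, S (Q k)) /\
    \bigcup_(C in S) C = \bigcup_k Q k.
Proof.
move=> Scubes [C0 SC0].
(* the box selecting the [k]-th cube is the one encoded by [k] *)
pose rb (pq : 'rV[rat]_n.+1 * 'rV[rat]_n.+1) :=
  obox (map_mx ratr pq.1, map_mx ratr pq.2).
have /choice[Q QP] k : exists C, S C /\
    forall pq, unpickle k = Some pq -> (exists2 C', S C' & rb pq `<=` C') ->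
      rb pq `<=` C.
  case: (unpickle k) => [pq|]; last by exists C0.
  have [[C SC pqC]|nC] := pselect (exists2 C', S C' & rb pq `<=` C').
    by exists C; split => // _ [<-].
  by exists C0; split => // _ [<-] /nC.
exists Q; split; first by move=> k; have [] := QP k.
apply/seteqP; split => [x [C SC Cx]|x [k _ Qx]].
  have [a [l [_ Ca]]] := Scubes _ SC; move: Cx; rewrite Ca => xa.
  have [pq pqx pqa] := obox_rat xa.
  exists (pickle pq) => //; have [_ /(_ pq)] := QP (pickle pq).
  by apply => //; [rewrite pickleK|exists C => //; rewrite Ca].
by have [SQ _] := QP k; exists (Q k).
Qed.

End Geometry.

(** * Level sets of the weighted maximal operator *)

Section Maximal.
Context (R : realType) (n : nat).
Local Notation V := 'rV[R]_n.+1.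
Local Notation X := (euclidean R n).
Local Notation mu := (@lebesgue R n).
Implicit Types (w f g : X -> \bar R) (Q : set X).

Lemma weighted_maximal_level w f (t : \bar R) :
  [set x | t < weighted_maximal w f x] =
  \bigcup_(Q in [set Q | cubes Q /\
     t < (weighted_volume w Q)^-1 * \int[mu]_(y in Q) (`|f y| * w y)]) Q.
Proof.
apply/seteqP; split => [x /= /ereal_sup_gt[_ [Q [cQ Qx] <-] tQ]|x [Q [cQ tQ] Qx]].
  by exists Q.
by apply: lt_le_trans tQ _; apply: ereal_sup_ubound; exists Q.
Qed.

Lemma measurable_level_weighted_maximal w f (t : \bar R) :
  measurable [set x | t < weighted_maximal w f x].
Proof.
rewrite weighted_maximal_level; set S := [set Q | _ /\ _].
have [[C SC]|/set0P/negP] := pselect (S !=set0); last first.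
  by rewrite negbK => /eqP ->; rewrite bigcup_set0.
have [|Q [SQ ->]] := @cubes_lindelof R n S _ (ex_intro _ _ SC).
  by move=> Q [].
by apply: bigcup_measurable => k _; apply: measurable_cubes; case: (SQ k).
Qed.

Lemma measurable_weighted_maximal w f :
  measurable_fun [set: X] (weighted_maximal w f).
Proof.
apply: (measurability _ (ErealGenOInfty.measurableE R)) => _ [_ [a ->] <-].
rewrite setTI.
have -> : weighted_maximal w f @^-1` `]a%:E, +oo[ =
    [set x | a%:E < weighted_maximal w f x].
  by apply/seteqP; split=> x /=; rewrite in_itv/= andbT.
exact: measurable_level_weighted_maximal.
Qed.

Lemma cube_sub_triple (a b : V) (l m : R) : (m <= l)%R ->
  cube a l `&` cube b m !=set0 ->
  cube b m `<=` cube (a - const_mx l)%R (3 * l).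
Proof.
move=> ml [x [xa xb]] y yb i; have := xa i; have := xb i; have := yb i.
by rewrite !mxE => /andP[? ?] /andP[? ?] /andP[? ?]; apply/andP; split; lra.
Qed.

(** The properties of a weight behind the covering argument for the maximal
    operator: positive finite mass on cubes, and doubling under the threefold
    dilation. *)
Definition doubling_weight (D : R) w :=
  [/\ measurable_fun [set: X] w, forall x, 0 <= w x,
    forall Q, cubes Q -> 0 < weighted_volume w Q < +oo &
    forall (a : V) (l : R), (0 < l)%R ->
      weighted_volume w (cube (a - const_mx l)%R (3 * l)) <=
      D%:E * weighted_volume w (cube a l)].

Lemma weighted_volumeU_le w (A B : set X) :
  measurable_fun [set: X] w -> (forall x, 0 <= w x) ->
  measurable A -> measurable B ->
  weighted_volume w (A `|` B) <= weighted_volume w A + weighted_volume w B.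
Proof.
move=> mw w0 mA mB; have mBA : measurable (B `\` A) by exact: measurableD.
have mwE (E : set X) : measurable_fun E w by exact: measurable_funTS.
have -> : A `|` B = A `|` (B `\` A).
  apply/seteqP; split=> [x [Ax|Bx]|x [Ax|[Bx _]]]; [by left| |by left|by right].
  by have [Ax|Ax] := pselect (A x); [left|right].
rewrite /weighted_volume ge0_integral_setU//.
  by apply: leeD => //; apply: ge0_subset_integral => // x [].
by apply/disj_setPS => x [Ax []].
Qed.

(** Vitali's covering argument without an explicit disjoint subfamily: split
    off a largest cube; the cubes meeting it lie in its threefold dilate, and the
    induction applies to the cubes disjoint from it. *)
Lemma vitali_weighted_volume w g (D : R) (s : seq (V * R)) :
  (0 <= D)%R -> doubling_weight D w ->
  measurable_fun [set: X] g -> (forall x, 0 <= g x) ->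
  (forall p, p \in s -> (0 < p.2)%R /\
     weighted_volume w (cube p.1 p.2) <= \int[mu]_(x in cube p.1 p.2) g x) ->
  weighted_volume w (\bigcup_(p in [set` s]) cube p.1 p.2) <=
  D%:E * \int[mu]_(x in \bigcup_(p in [set` s]) cube p.1 p.2) g x.
Proof.
move=> D0 [mw w0 _ wD] mg g0.
have mU (t : seq (V * R)) :
    measurable (\bigcup_(p in [set` t]) cube p.1 p.2 : set X).
  by apply: fin_bigcup_measurable => // p _; exact: measurable_cube.
have mwE (E : set X) : measurable_fun E w by exact: measurable_funTS.
have mgE (E : set X) : measurable_fun E g by exact: measurable_funTS.
have [m] := ubnP (size s); elim: m s => // m IH s sm sP.
have [->|s0] := eqVneq s [::].
  by rewrite set_nil bigcup_set0 /weighted_volume !integral_set0 mule0.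
have [c cs cmax] : exists2 c, c \in s & forall p, p \in s -> (p.2 <= c.2)%R.
  elim: s s0 {sm sP} => // p [|q s] IHs _.
    by exists p; rewrite ?mem_head// => q; rewrite inE => /eqP ->.
  have [c cqs cmax] := IHs isT.
  have [cp|pc] := leP c.2 p.2.
    exists p; rewrite ?mem_head// => r; rewrite inE => /predU1P[->//|/cmax].
    by move/le_trans; exact.
  exists c; first by rewrite inE cqs orbT.
  by move=> r; rewrite inE => /predU1P[->|/cmax//]; exact: ltW.
have [c0 cP] := sP _ cs.
pose C : set X := cube c.1 c.2.
pose far (p : V * R) := `[< C `&` cube p.1 p.2 = set0 >].
pose s' := [seq p <- s | far p].
have Uss' : \bigcup_(p in [set` s']) cube p.1 p.2 `<=`
    \bigcup_(p in [set` s]) cube p.1 p.2.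
  by move=> x [p /=]; rewrite mem_filter => /andP[_ ps] px; exists p.
have CUs : C `<=` \bigcup_(p in [set` s]) cube p.1 p.2 by move=> x; exists c.
have CUs' : [disjoint C & \bigcup_(p in [set` s']) cube p.1 p.2].
  apply/disj_setPS => x [Cx [p /=]]; rewrite mem_filter => /andP[/asboolP Cp _] px.
  by have : (C `&` cube p.1 p.2) x by []; rewrite Cp.
have Us : \bigcup_(p in [set` s]) cube p.1 p.2 `<=`
    cube (c.1 - const_mx c.2)%R (3 * c.2) `|`
    \bigcup_(p in [set` s']) cube p.1 p.2.
  move=> x [p /= ps px]; have [pf|/asboolPn/eqP/set0P pn] := boolP (far p).
    by right; exists p => //=; rewrite mem_filter pf.
  by left; apply: (cube_sub_triple _ pn) => //; exact: cmax.
have IH' : weighted_volume w (\bigcup_(p in [set` s']) cube p.1 p.2) <=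
    D%:E * \int[mu]_(x in \bigcup_(p in [set` s']) cube p.1 p.2) g x.
  apply: IH => [|p]; last by rewrite mem_filter => /andP[_]; exact: sP.
  rewrite size_filter -ltnS; apply: leq_trans sm; rewrite ltnS.
  rewrite -(count_predC far s) -addn1 leq_add2l -has_count; apply/hasP.
  exists c => //=; apply/asboolPn; rewrite /C setIid => C0.
  have : cube c.1 c.2 (c.1 + const_mx (c.2 / 2))%R.
    by move=> i; rewrite !mxE; apply/andP; split; lra.
  by rewrite C0.
have mC : measurable C by exact: measurable_cube.
have mC3 : measurable (cube (c.1 - const_mx c.2)%R (3 * c.2) : set X).
  exact: measurable_cube.
apply: (@le_trans _ _ (weighted_volume w (cube (c.1 - const_mx c.2)%R (3 * c.2)) +
    weighted_volume w (\bigcup_(p in [set` s']) cube p.1 p.2))).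
  apply: le_trans (weighted_volumeU_le mw w0 mC3 (mU _)).
  by apply: ge0_subset_integral => //; exact: measurableU.
rewrite (@le_trans _ _ (D%:E * \int[mu]_(x in C `|`
    \bigcup_(p in [set` s']) cube p.1 p.2) g x))//.
  rewrite ge0_integral_setU// muleDr//; last first.
    by apply: ge0_adde_def; rewrite inE; apply: integral_ge0.
  apply: leeD => //; apply: le_trans (wD _ _ c0) _.
  by apply: lee_wpmul2l; rewrite ?lee_fin.
apply: lee_wpmul2l; rewrite ?lee_fin//.
apply: ge0_subset_integral => //; first exact: measurableU.
by move=> x [/CUs|/Uss'].
Qed.
End Maximal.

Section WeakType.
Context (R : realType) (n : nat).
Local Notation V := 'rV[R]_n.+1.
Local Notation X := (euclidean R n).
Local Notation mu := (@lebesgue R n).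
Implicit Types (w f g : X -> \bar R) (Q : set X).

(** By Lindelof the level set is an increasing union of finite unions of
    cubes whose mean exceeds [t]. *)
Lemma weak_type_maximal w f (D t : R) :
  (0 <= D)%R -> (0 < t)%R -> doubling_weight D w ->
  measurable_fun [set: X] f ->
  weighted_volume w [set x | t%:E < weighted_maximal w f x] <=
  (D / t)%:E * \int[mu]_x (`|f x| * w x).
Proof.
move=> D0 t0 dw mf; have [mw w0 wQ _] := dw.
pose g x := `|f x| * w x; rewrite -[X in _ <= _ * X]/(\int[mu]_x g x).
have mg : measurable_fun [set: X] g.
  exact: emeasurable_funM (measurableT_comp (@abse_measurable R _) mf) mw.
have g0 x : 0 <= g x by rewrite mule_ge0.
have mtg : measurable_fun [set: X] (fun x => (t^-1)%:E * g x).
  exact: measurable_funeM.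
have tg0 x : 0 <= (t^-1)%:E * g x.
  by rewrite mule_ge0// lee_fin invr_ge0 ltW.
rewrite weighted_maximal_level; set S := [set Q | _ /\ _].
have [[C SC]|/set0P/negP] := pselect (S !=set0); last first.
  rewrite negbK => /eqP ->; rewrite bigcup_set0 /weighted_volume integral_set0.
  by rewrite mule_ge0 ?integral_ge0// lee_fin divr_ge0// ltW.
have [|Q [SQ ->]] := @cubes_lindelof R n S _ (ex_intro _ _ SC).
  by move=> Q [].
have /choice[p pP] k : exists p : V * R, (0 < p.2)%R /\ Q k = cube p.1 p.2.
  by have [[a [l [l0 ->]]] _] := SQ k; exists (a, l).
pose s k := [seq p i | i <- iota 0 k].
pose U k : set X := \bigcup_(q in [set` s k]) cube q.1 q.2.
have UE : \bigcup_k Q k = \bigcup_k U k.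
  apply/seteqP; split => [x [k _ Qx]|x [k _ [q /= /mapP[i _ ->] qx]]].
    exists k.+1 => //; exists (p k) => /=.
      by rewrite map_f// mem_iota add0n ltnS leqnn.
    by have [_ <-] := pP k.
  by exists i => //; have [_ ->] := pP i.
have mU k : measurable (U k).
  by apply: fin_bigcup_measurable => // q _; exact: measurable_cube.
rewrite UE /weighted_volume.
have cvgU : \int[mu]_(x in U k) w x @[k --> \oo] --> \int[mu]_(x in \bigcup_k U k) w x.
  apply: ge0_nondecreasing_set_cvg_integral => //.
  - move=> k m km; apply/subsetPset => x [q /= /mapP[i]].
    rewrite mem_iota add0n => /andP[_ ik] -> qx; exists (p i) => //=.
    by rewrite map_f// mem_iota add0n (leq_trans ik).
  - by move=> k; exact: measurable_funTS.
rewrite -(cvg_lim _ cvgU)//; apply: lime_le; first by apply/cvg_ex; eexists; exact: cvgU.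
apply: nearW => k.
apply: (@le_trans _ _ (D%:E * \int[mu]_(x in U k) ((t^-1)%:E * g x))).
  apply: vitali_weighted_volume => // q /mapP[i _ ->].
  have [pi0 Qi] := pP i; split => //; rewrite -Qi.
  have [cQ tQ] := SQ i; have /andP[W0 Woo] := wQ _ cQ.
  rewrite ge0_integralZl//; last 3 first.
  - exact: measurable_cubes.
  - exact: measurable_funTS.
  - by rewrite lee_fin invr_ge0 ltW.
  move: W0 Woo tQ; case: (weighted_volume w (Q i)) => [r| |]// r0 _.
  rewrite lte_fin in r0.
  rewrite inver gt_eqF// => /ltW rQ.
  rewrite lee_pdivlMl//; rewrite lee_pdivlMl// in rQ.
  by rewrite -EFinM mulrC EFinM.
apply: (@le_trans _ _ (D%:E * \int[mu]_x ((t^-1)%:E * g x))).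
  apply: lee_wpmul2l; rewrite ?lee_fin//.
  by apply: ge0_subset_integral.
rewrite ge0_integralZl//; last by rewrite lee_fin invr_ge0 ltW.
by rewrite muleA -EFinM.
Qed.

(** The part of [f] where [|f| <= t] contributes at most [t] to every mean. *)
Lemma weighted_maximal_truncation w f (D t : R) (x : X) :
  doubling_weight D w -> measurable_fun [set: X] f -> (0 <= t)%R ->
  weighted_maximal w f x <=
  weighted_maximal w (f \_ [set y | t%:E < `|f y|]) x + t%:E.
Proof.
move=> [mw w0 wQ _] mf t0; apply: ge_ereal_sup => _ [Q [cQ Qx] <-].
set f' := f \_ _.
have mQ : measurable Q by exact: measurable_cubes.
have maf : measurable_fun [set: X] (fun y => `|f y|) by exact: measurableT_comp.
have mf' : measurable_fun [set: X] f'.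
  have mA : measurable [set y | t%:E < `|f y|].
    by rewrite -[X in measurable X]setTI; apply: emeasurable_fun_o_infty.
  by apply: (measurable_restrictT f mA).1; exact: measurable_funTS.
have maf' : measurable_fun [set: X] (fun y => `|f' y|) by exact: measurableT_comp.
have mfw : measurable_fun Q (fun y => `|f' y| * w y).
  by apply: measurable_funTS; exact: emeasurable_funM.
have mtw : measurable_fun Q (fun y => t%:E * w y).
  by apply: measurable_funTS; exact: measurable_funeM.
have H : \int[mu]_(y in Q) (`|f y| * w y) <=
    \int[mu]_(y in Q) (`|f' y| * w y) + t%:E * weighted_volume w Q.
  rewrite /weighted_volume -ge0_integralZl//; last exact: measurable_funTS.
  rewrite -ge0_integralD//; last 2 first.
  - by move=> y _; rewrite mule_ge0.
  - by move=> y _; rewrite mule_ge0// lee_fin.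
  apply: ge0_le_integral; first exact: mQ.
  - by move=> y _; rewrite mule_ge0.
  - exact: measurable_funTS (emeasurable_funM maf mw).
  - exact: emeasurable_funD mfw mtw.
  - move=> y _; rewrite -ge0_muleDl// ?lee_fin//; apply: lee_wpmul2r => //.
    rewrite /f' patchE; case: ifPn => [_|]; first by rewrite leeDl.
    by rewrite notin_setE/= => /negP; rewrite -leNgt normr0 add0e.
have /andP[W0 Woo] := wQ _ cQ.
apply: (@le_trans _ _ ((weighted_volume w Q)^-1 *
    \int[mu]_(y in Q) (`|f' y| * w y) + t%:E)%E); last first.
  by rewrite leeD2r//; apply: ereal_sup_ubound; exists Q.
move: W0 Woo H; case: (weighted_volume w Q) => [r| |]// r0 _ H.
rewrite lte_fin in r0.
rewrite inver gt_eqF//; apply: le_trans (lee_wpmul2l _ H) _.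
  by rewrite lee_fin invr_ge0 ltW.
rewrite muleDr//; last by apply: fin_num_adde_defl.
by rewrite -EFinM mulrC mulfK// gt_eqF.
Qed.

End WeakType.

(** * From weak type to the square-integral bound *)

Section SeriesAndDyadic.
Context (R : realType).

Lemma ge0_nneseriesZr (a : nat -> \bar R) (x : \bar R) :
  (forall k, 0 <= a k) -> 0 <= x ->
  \sum_(k <oo) (a k * x) = (\sum_(k <oo) a k) * x.
Proof.
move=> a0 x0; rewrite -!ge0_integral_count//; last first.
  by move=> k; rewrite mule_ge0.
by rewrite muleC -ge0_integralZl//; apply: eq_integral => k _; rewrite muleC.
Qed.

Lemma dyadic_square_le (T : R) (y : \bar R) : (0 < T)%R -> T%:E < y ->
  y * y <= \sum_(k <oo) (4 * (2 ^+ k * T) ^+ 2)%:E *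
                        (\1_[set y : \bar R | ((2 ^+ k * T)%:E < y)%E] y)%:E.
Proof.
move=> T0; set S := (X in _ -> _ <= X).
have S0 k : 0 <= (4 * (2 ^+ k * T) ^+ 2)%:E *
    (\1_[set y : \bar R | ((2 ^+ k * T)%:E < y)%E] y)%:E.
  by rewrite -EFinM lee_fin mulr_ge0// mulr_ge0// exprn_even_ge0.
have H (r : R) : (T < r)%R -> r%:E <= y -> (r ^+ 2)%:E <= S.
  move=> Tr ry; have ex : exists k, (r <= 2 ^+ k * T)%R.
    pose k := (Num.bound (r / T)); exists k.
    rewrite -ler_pdivrMr//; apply: le_trans (_ : k%:R <= _)%R.
      apply/ltW/(le_lt_trans (ler_norm _)).
      by rewrite ger0_norm ?archi_boundP// divr_ge0// ltW// (lt_trans T0).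
    by rewrite -natrX ler_nat ltnW// ltn_expl.
  case: (ex_minnP ex) => -[|k] rk kmin; first by move: rk; rewrite mul1r leNgt Tr.
  have kr : (2 ^+ k * T < r)%R.
    by rewrite ltNge; apply/negP => /kmin; rewrite ltnn.
  rewrite /S (@nneseriesD1 _ _ k xpredT)//; apply: le_trans (leeDl _ _); last first.
    exact: nneseries_ge0.
  rewrite indicE mem_set/=; last by apply: lt_le_trans ry; rewrite lte_fin.
  rewrite mule1 lee_fin -[4%R]/((2 * 2)%:R) natrM -expr2 -exprMn.
  rewrite mulrA -exprS ler_sqr// nnegrE ltW//; first exact: lt_trans T0 Tr.
  by rewrite mulr_gt0// exprn_gt0.
case: y S S0 H => [r| |]// S S0 H; first by rewrite -EFinM -expr2 => Tr; apply: H.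
move=> _; rewrite mulyy leye_eq; apply/eqP/eq_infty => r.
pose s := (`|r| + T + 1)%R; have rs : (r <= s ^+ 2)%R.
  have := ler_norm r; have := normr_ge0 r; rewrite /s; nra.
apply: (@le_trans _ _ (s ^+ 2)%:E); first by rewrite lee_fin.
by apply: H; rewrite ?leey// /s; have := normr_ge0 r; lra.
Qed.

Lemma dyadic_sum_le (T : R) (y : \bar R) : (0 < T)%R -> 0 <= y ->
  \sum_(k <oo) (2 ^+ k * T)%:E * (\1_[set y : \bar R | ((2 ^+ k * T)%:E < 2%:E * y)%E] y)%:E <=
  4%:E * y.
Proof.
move=> T0; case: y => [r| |]// r0; last first.
  by rewrite gt0_muley ?leey// lte_fin.
have term0 k : 0 <= (2 ^+ k * T)%:E *
    (\1_[set y : \bar R | ((2 ^+ k * T)%:E < 2%:E * y)%E] r%:E)%:E.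
  by rewrite -EFinM lee_fin mulr_ge0// mulr_ge0// ltW.
apply: lime_le; first by apply: is_cvg_nneseries => k _ _; exact: term0.
apply: nearW => N; rewrite -EFinM.
under eq_bigr do rewrite -EFinM; rewrite sumEFin lee_fin.
suff : ((\sum_(0 <= k < N) 2 ^+ k * T *
    \1_[set y : \bar R | (((2 ^+ k * T)%:E < 2%:E * y)%E)%E] r%:E <= 4 * r)
  /\ (\sum_(0 <= k < N) 2 ^+ k * T *
    \1_[set y : \bar R | (((2 ^+ k * T)%:E < 2%:E * y)%E)%E] r%:E <= 2 ^+ N * T))%R by case.
rewrite lee_fin in r0.
elim: N => [|N [IH1 IH2]].
  by rewrite big_nil !mulr_ge0// ltW.
rewrite big_nat_recr//= indicE; have [|] := boolP (r%:E \in _).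
  rewrite inE /= -EFinM lte_fin => h; rewrite mulr1 exprS; split; lra.
move=> _; rewrite mulr0 addr0; split => //; apply: le_trans IH2 _.
by rewrite ler_pM2r// exprS ler_peMl ?exprn_ge0// ler1n.
Qed.

End SeriesAndDyadic.

Section Marcinkiewicz.
Context d (T : measurableType d) (R : realType).
Variable mu : {measure set T -> \bar R}.
Implicit Types (f w M : T -> \bar R).

Lemma measurable_superlevel f (t : \bar R) :
  measurable_fun [set: T] f -> measurable [set x | t < f x].
Proof.
by move=> mf; rewrite -[X in measurable X]setTI; apply: emeasurable_fun_o_infty.
Qed.

(** Layer-cake decomposition along the levels [2^k t0].  The threshold [t0]
    keeps the levels indexed by [nat]; the constant does not depend on it. *)
Lemma marcinkiewicz_square_above M f w (K t0 : R) :
  measurable_fun [set: T] M -> measurable_fun [set: T] f ->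
  measurable_fun [set: T] w ->
  (forall x, 0 <= M x) -> (forall x, 0 <= f x) -> (forall x, 0 <= w x) ->
  (0 <= K)%R -> (0 < t0)%R ->
  (forall t : R, (0 < t)%R -> \int[mu]_(x in [set x | t%:E < M x]) w x <=
     (K / t)%:E * \int[mu]_(x in [set x | t%:E < 2%:E * f x]) (f x * w x)) ->
  \int[mu]_(x in [set x | t0%:E < M x]) (M x * M x * w x) <=
  (16 * K)%:E * \int[mu]_x (f x * f x * w x).
Proof.
move=> mM mf mw M0 f0 w0 K0 t00 weak.
pose t k : R := (2 ^+ k * t0)%R.
have tgt0 k : (0 < t k)%R by rewrite mulr_gt0// exprn_gt0.
have tge0 k : 0 <= (t k)%:E by rewrite lee_fin ltW.
have sq0 k : 0 <= (4 * t k ^+ 2)%:E.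
  by rewrite lee_fin mulr_ge0// exprn_even_ge0.
pose A k := [set x | (t k)%:E < M x].
pose B k := [set x | (t k)%:E < 2%:E * f x].
have mA k : measurable (A k) by exact: measurable_superlevel.
have mB k : measurable (B k).
  by apply: measurable_superlevel; exact: measurable_funeM.
have m1A k : measurable_fun [set: T] (fun x => (\1_(A k) x)%:E : \bar R).
  by apply/measurable_EFinP; exact: measurable_indic.
have m1B k : measurable_fun [set: T] (fun x => (\1_(B k) x)%:E : \bar R).
  by apply/measurable_EFinP; exact: measurable_indic.
have mfw : measurable_fun [set: T] (fun x => f x * w x).
  exact: emeasurable_funM.
have mffw : measurable_fun [set: T] (fun x => f x * f x * w x).
  by apply: emeasurable_funM => //; exact: emeasurable_funM.
have mterm k : measurable_fun [set: T]
    (fun x => (4 * t k ^+ 2)%:E * (\1_(A k) x)%:E).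
  exact: measurable_funeM.
have term0 k x : 0 <= (4 * t k ^+ 2)%:E * (\1_(A k) x)%:E.
  by rewrite mule_ge0.
have termB0 k x : 0 <= (t k)%:E * (\1_(B k) x)%:E by rewrite mule_ge0.
have mS : measurable_fun [set: T]
    (fun x => \sum_(k <oo) (4 * t k ^+ 2)%:E * (\1_(A k) x)%:E).
  by apply: ge0_emeasurable_sum.
have mSB : measurable_fun [set: T]
    (fun x => \sum_(k <oo) (t k)%:E * (\1_(B k) x)%:E).
  by apply: ge0_emeasurable_sum => // k _; exact: measurable_funeM.
apply: (@le_trans _ _ (\int[mu]_x
    ((\sum_(k <oo) (4 * t k ^+ 2)%:E * (\1_(A k) x)%:E) * w x))).
  apply: (@le_trans _ _ (\int[mu]_(x in [set x | t0%:E < M x])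
      ((\sum_(k <oo) (4 * t k ^+ 2)%:E * (\1_(A k) x)%:E) * w x))).
    apply: ge0_le_integral.
    - exact: measurable_superlevel.
    - by move=> x _; rewrite !mule_ge0.
    - apply: measurable_funTS; apply: emeasurable_funM => //.
      exact: emeasurable_funM.
    - by apply: measurable_funTS; exact: emeasurable_funM.
    - by move=> x Tx; apply: lee_wpmul2r => //; exact: dyadic_square_le.
  apply: ge0_subset_integral => //; first exact: measurable_superlevel.
    exact: emeasurable_funM.
  by move=> x _; rewrite mule_ge0// nneseries_ge0.
under eq_integral do rewrite -ge0_nneseriesZr//.
rewrite integral_nneseries//; last 2 first.
- by move=> k; exact: emeasurable_funM.
- by move=> k x _; rewrite mule_ge0.
have step k : \int[mu]_x ((4 * t k ^+ 2)%:E * (\1_(A k) x)%:E * w x) <=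
    (4 * K)%:E * \int[mu]_x ((t k)%:E * (\1_(B k) x)%:E * (f x * w x)).
  have intE (E : set T) (g : T -> \bar R) (r : R) : measurable E -> (0 <= r)%R ->
      measurable_fun [set: T] g -> (forall x, 0 <= g x) ->
      \int[mu]_x (r%:E * (\1_E x)%:E * g x) = r%:E * \int[mu]_(x in E) g x.
    move=> mE r0 mg g0; under eq_integral do rewrite -muleA.
    rewrite ge0_integralZl//; last 2 first.
    - apply: emeasurable_funM => //.
      by apply/measurable_EFinP; exact: measurable_indic.
    - by move=> x _; rewrite mule_ge0.
    rewrite [in RHS]integral_mkcond; congr (_ * _); apply: eq_integral => x _.
    by rewrite patchE indicE; case: (x \in E); rewrite ?mul1e ?mul0e.
  have fw0 x : 0 <= f x * w x by rewrite mule_ge0.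
  rewrite !intE//; [|by rewrite mulr_ge0// exprn_even_ge0|exact: ltW].
  apply: le_trans (lee_wpmul2l (sq0 k) (weak _ (tgt0 k))) _.
  rewrite !muleA -!EFinM le_eqVlt; apply/orP; left; apply/eqP.
  by congr (_%:E * _); field; rewrite gt_eqF.
apply: le_trans (lee_nneseries _ (fun k _ => step k)) _.
  by move=> k _ _; apply: integral_ge0 => x _; rewrite mule_ge0.
rewrite nneseriesZl; last first.
  by move=> k _; apply: integral_ge0 => x _; rewrite !mule_ge0.
rewrite -integral_nneseries//; last 2 first.
- move=> k; apply: emeasurable_funM; last exact: emeasurable_funM.
  exact: measurable_funeM.
- by move=> k x _; rewrite !mule_ge0.
have -> : (16 * K = 4 * K * 4)%R by ring.
rewrite [(4 * K * 4)%:E]EFinM -muleA; apply: lee_wpmul2l; first by rewrite lee_fin mulr_ge0.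
rewrite -ge0_integralZl//; last by move=> x _; rewrite !mule_ge0.
under eq_integral do rewrite ge0_nneseriesZr ?mule_ge0//.
apply: ge0_le_integral => //.
- by move=> x _; rewrite mule_ge0 ?mule_ge0 ?nneseries_ge0.
- exact: emeasurable_funM.
- exact: measurable_funeM.
move=> x _; rewrite -[f x * f x * _]muleA [leRHS]muleA; apply: lee_wpmul2r.
  by rewrite mule_ge0.
exact: dyadic_sum_le.
Qed.

(** Marcinkiewicz interpolation between a weak type bound and the trivial
    sup bound, in the case of squares.  The assumption is the truncated form of
    the weak bound, in which only the part of [f] above [t / 2] counts. *)
Lemma marcinkiewicz_square M f w (K : R) :
  measurable_fun [set: T] M -> measurable_fun [set: T] f ->
  measurable_fun [set: T] w ->
  (forall x, 0 <= M x) -> (forall x, 0 <= f x) -> (forall x, 0 <= w x) ->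
  (0 <= K)%R ->
  (forall t : R, (0 < t)%R -> \int[mu]_(x in [set x | t%:E < M x]) w x <=
     (K / t)%:E * \int[mu]_(x in [set x | t%:E < 2%:E * f x]) (f x * w x)) ->
  \int[mu]_x (M x * M x * w x) <= (16 * K)%:E * \int[mu]_x (f x * f x * w x).
Proof.
move=> mM mf mw M0 f0 w0 K0 weak.
pose A k := [set x | (k.+1%:R^-1)%:E < M x].
have mA k : measurable (A k) by exact: measurable_superlevel.
have mMMw : measurable_fun [set: T] (fun x => M x * M x * w x).
  by apply: emeasurable_funM => //; exact: emeasurable_funM.
have UA : \bigcup_k A k = [set x | 0 < M x].
  apply/seteqP; split => [x [k _ /=]|x /=]; first by apply: le_lt_trans; rewrite lee_fin.
  move Mx : (M x) => y; case: y Mx => [r| |]// Mx.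
    rewrite lte_fin => r0; have [k] := ltr_add_invr r0; rewrite add0r => kr.
    by exists k => //; rewrite /A/= Mx lte_fin.
  by move=> _; exists 0%N => //; rewrite /A/= Mx ltry.
have -> : \int[mu]_x (M x * M x * w x) = \int[mu]_(x in \bigcup_k A k) (M x * M x * w x).
  rewrite UA [RHS]integral_mkcond; apply: eq_integral => x _; rewrite patchE.
  case: ifPn => //; rewrite notin_setE/= => /negP; rewrite -leNgt => Mx0.
  by have -> : M x = 0 by [apply/eqP; rewrite eq_le Mx0 M0]; rewrite !mul0e.
have cvgA : \int[mu]_(x in A k) (M x * M x * w x) @[k --> \oo] -->
    \int[mu]_(x in \bigcup_k A k) (M x * M x * w x).
  apply: ge0_nondecreasing_set_cvg_integral => //.
  - move=> k m km; apply/subsetPset => x; apply: le_lt_trans.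
    by rewrite lee_fin lef_pV2 ?posrE// ler_nat.
  - by move=> k; exact: measurable_funTS.
  - by move=> k x _; rewrite !mule_ge0.
rewrite -(cvg_lim _ cvgA)//; apply: lime_le; first by apply/cvg_ex; eexists; exact: cvgA.
by apply: nearW => k; exact: marcinkiewicz_square_above.
Qed.

End Marcinkiewicz.

Section StrongType.
Context (R : realType) (n : nat).
Local Notation X := (euclidean R n).
Local Notation mu := (@lebesgue R n).
Implicit Types (w f g : X -> \bar R) (Q : set X).

Lemma weighted_maximal_ge0 w f x : (forall y, 0 <= w y) ->
  0 <= weighted_maximal w f x.
Proof.
move=> w0; pose Q : set X := cube ((x : 'rV[R]_n.+1) - const_mx 1)%R 2.
apply: (@le_trans _ _ ((weighted_volume w Q)^-1 *
    \int[mu]_(y in Q) (`|f y| * w y))); last first.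
  apply: ereal_sup_ubound; exists Q => //; split; first by exists (x - const_mx 1)%R, 2%R.
  by move=> i; rewrite !mxE; apply/andP; split; lra.
apply: mule_ge0; first by rewrite inve_ge0; exact: integral_ge0.
by apply: integral_ge0 => y _; rewrite mule_ge0.
Qed.


(** The [L^2] bound is the only one that the extrapolation steps call on,
    since exponents are changed by doubling and by taking powers. *)
Lemma strong_type_maximal w f (D : R) :
  (0 <= D)%R -> doubling_weight D w ->
  measurable_fun [set: X] f -> (forall x, 0 <= f x) ->
  \int[mu]_x (weighted_maximal w f x * weighted_maximal w f x * w x) <=
  (32 * D)%:E * \int[mu]_x (f x * f x * w x).
Proof.
move=> D0 dw mf f0; have [mw w0 _ _] := dw.
have -> : (32 * D = 16 * (2 * D))%R by ring.
apply: (marcinkiewicz_square (measurable_weighted_maximal w f) mf mw) => //.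
- by move=> x; exact: weighted_maximal_ge0.
- by rewrite mulr_ge0.
move=> t t0.
have t20 : (0 < t / 2)%R by rewrite divr_gt0.
pose A : set X := [set y | (t / 2)%:E < `|f y|].
have mA : measurable A.
  exact: measurable_superlevel (measurableT_comp (@abse_measurable R _) mf).
have mfA : measurable_fun [set: X] (f \_ A).
  by apply: (measurable_restrictT f mA).1; exact: measurable_funTS.
have sub : [set x | t%:E < weighted_maximal w f x] `<=`
    [set x | (t / 2)%:E < weighted_maximal w (f \_ A) x].
  move=> x /= tM; have := weighted_maximal_truncation x dw mf (ltW t20).
  move=> /(lt_le_trans tM); rewrite -/A.
  have -> : t%:E = (t / 2)%:E + (t / 2)%:E by rewrite -EFinD; congr _%:E; field.
  by rewrite lteD2rE.
have := weak_type_maximal D0 t20 dw mfA.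
move=> /(le_trans (ge0_subset_integral mu
  (measurable_level_weighted_maximal w f t%:E)
  (measurable_level_weighted_maximal w (f \_ A) (t / 2)%:E)
  (measurable_funTS mw) (fun x _ => w0 x) sub)) /le_trans; apply.
have -> : (D / (t / 2) = 2 * D / t)%R by field; rewrite gt_eqF.
rewrite le_eqVlt; apply/orP; left; apply/eqP; congr (_ * _).
rewrite [RHS]integral_mkcond; apply: eq_integral => x _; rewrite !patchE.
have -> : (x \in A) = (x \in [set x | t%:E < 2%:E * f x]).
  apply/idP/idP; rewrite !inE /A/= gee0_abs// EFinM lte_pdivrMr//.
    by rewrite muleC.
  by rewrite muleC.
by case: ifPn => _; [rewrite gee0_abs|rewrite (_ : point = 0)// abse0 mul0e].
Qed.

End StrongType.

(** * Integral inequalities *)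

Section Integrals.
Context d (T : measurableType d) (R : realType).
Variable mu : {measure set T -> \bar R}.

Lemma integral_gt0 (D : set T) (f : T -> \bar R) :
  measurable D -> 0 < mu D -> measurable_fun D f ->
  (forall x, D x -> 0 < f x) -> 0 < \int[mu]_(x in D) f x.
Proof.
move=> mD D0 mf f0; rewrite lt0e integral_ge0 ?andbT; last first.
  by move=> x /f0 /ltW.
apply/eqP => I0; have : \int[mu]_(x in D) `|f x| = 0.
  rewrite -[RHS]I0; apply: eq_integral => x; rewrite inE => Dx.
  by rewrite gee0_abs// ltW// f0.
move=> /(ae_eq_integral_abs mu mD mf)[N [mN N0 DN]].
suff : D `<=` N.
  by move=> /(le_measure mu) /=; rewrite !inE => /(_ mD mN); rewrite N0 leNgt D0.
move=> x Dx; apply: DN => /= /(_ Dx) fx0.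
by have := f0 x Dx; rewrite fx0 ltxx.
Qed.

Lemma integral_eq0_ae (D : set T) (f : T -> \bar R) :
  measurable D -> measurable_fun D f -> (forall x, D x -> 0 <= f x) ->
  \int[mu]_(x in D) f x = 0 -> ae_eq mu D f (cst 0).
Proof.
move=> mD mf f0 I0; apply/(ae_eq_integral_abs mu mD mf); rewrite -[RHS]I0.
by apply: eq_integral => x; rewrite inE => Dx; rewrite gee0_abs ?f0.
Qed.

Lemma ae_eq0_integral (D : set T) (f : T -> \bar R) :
  measurable D -> measurable_fun D f -> ae_eq mu D f (cst 0) ->
  \int[mu]_(x in D) f x = 0.
Proof.
move=> mD mf f0; by rewrite (@ae_eq_integral _ _ _ mu D (cst 0) f)// integral0.
Qed.

Lemma weighted_young (t x y : R) : (0 < t < 1)%R -> (0 <= x)%R -> (0 <= y)%R ->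
  (x `^ t * y `^ (1 - t) <= t * x + (1 - t) * y)%R.
Proof.
move=> /andP[t0 t1] x0 y0; have t10 : (0 < 1 - t)%R by lra.
have := @conjugate_powR R (x `^ t)%R (y `^ (1 - t))%R t^-1%R (1 - t)^-1%R
  (powR_ge0 _ _) (powR_ge0 _ _).
rewrite -!powRrM !mulfV ?gt_eqF// !powRr1// !invrK !invr_gt0.
rewrite [(x * t)%R]mulrC [(y * _)%R]mulrC; apply => //; lra.
Qed.

Lemma poweR_pos_y (t : R) : (0 < t)%R -> (+oo : \bar R) `^ t = +oo.
Proof. by move=> t0; rewrite poweRyr// gt_eqF. Qed.

Lemma weighted_young_ereal (t a b : R) (x y : \bar R) : (0 < t < 1)%R ->
  (0 < a)%R -> (0 < b)%R -> 0 <= x -> 0 <= y ->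
  x `^ t * y `^ (1 - t) <= (a `^ t * b `^ (1 - t))%:E *
    ((t / a)%:E * x + ((1 - t) / b)%:E * y).
Proof.
move=> /andP[t0 t1] a0 b0.
have ab : (0 < a `^ t * b `^ (1 - t))%R by rewrite mulr_gt0// powR_gt0.
have ta : (0 < t / a)%R by rewrite divr_gt0.
have tb : (0 < (1 - t) / b)%R by rewrite divr_gt0// subr_gt0.
case: x => [x| |]// x0; case: y => [y| |]// y0.
- rewrite !poweR_EFin -!EFinM lee_fin.
  rewrite !lee_fin in x0 y0.
  have := @weighted_young t (x / a)%R (y / b)%R.
  rewrite t0 t1 !divr_ge0 ?(ltW a0) ?(ltW b0)// => /(_ isT isT isT) h.
  have -> : (x `^ t * y `^ (1 - t) = a `^ t * b `^ (1 - t) *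
      ((x / a) `^ t * (y / b) `^ (1 - t)))%R.
    have scale (r c z : R) : (0 < c)%R -> (0 <= z)%R ->
        (z `^ r = c `^ r * (z / c) `^ r)%R.
      move=> c0 z0; rewrite -powRM ?divr_ge0 ?(ltW c0)//.
      by congr (_ `^ _)%R; field; rewrite gt_eqF.
    by rewrite (scale t a x)// (scale (1 - t)%R b y)//; ring.
  apply: ler_wpM2l; first exact: ltW.
  by move: h; rewrite !mulrA ![(_ * _ / _)%R]mulrAC.
- by rewrite gt0_muley// addeC gt0_muley ?leey// ltNye.
- by rewrite gt0_muley// gt0_muley ?leey// ltNye.
- by rewrite !gt0_muley ?leey// ltNye.
Qed.

(** Normalized by the integrals of [f] and [g], it is the integral of the
    weighted arithmetic-geometric mean inequality.  In this symmetric form all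
    functions and integrals may be infinite. *)
Lemma integral_holder (D : set T) (f g : T -> \bar R) (t : R) :
  measurable D -> measurable_fun D f -> measurable_fun D g ->
  (forall x, D x -> 0 <= f x) -> (forall x, D x -> 0 <= g x) ->
  (0 < t < 1)%R ->
  \int[mu]_(x in D) (f x `^ t * g x `^ (1 - t)) <=
  (\int[mu]_(x in D) f x) `^ t * (\int[mu]_(x in D) g x) `^ (1 - t).
Proof.
move=> mD mf mg f0 g0 t01; have /andP[t0 t1] := t01.
have t10 : (0 < 1 - t)%R by rewrite subr_gt0.
have mft : measurable_fun D (fun x => f x `^ t).
  exact: measurableT_comp (measurable_poweR _) mf.
have mgt : measurable_fun D (fun x => g x `^ (1 - t)).
  exact: measurableT_comp (measurable_poweR _) mg.
have mfg : measurable_fun D (fun x => f x `^ t * g x `^ (1 - t)).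
  exact: emeasurable_funM.
have If0 : 0 <= \int[mu]_(x in D) f x by exact: integral_ge0.
have Ig0 : 0 <= \int[mu]_(x in D) g x by exact: integral_ge0.
have [/(integral_eq0_ae mD mf f0) fz|fnz] := eqVneq (\int[mu]_(x in D) f x) 0.
  rewrite ae_eq0_integral// ?mule_ge0 ?poweR_ge0//.
  apply: filterS fz => x /[apply] ->; rewrite poweR_EFin powR0 ?mul0e//.
  by rewrite gt_eqF.
have [/(integral_eq0_ae mD mg g0) gz|gnz] := eqVneq (\int[mu]_(x in D) g x) 0.
  rewrite ae_eq0_integral// ?mule_ge0 ?poweR_ge0//.
  apply: filterS gz => x /[apply] ->; rewrite poweR_EFin powR0 ?mule0//.
  by rewrite gt_eqF.
have {fnz}f_gt0 : 0 < \int[mu]_(x in D) f x by rewrite lt0e fnz.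
have {gnz}g_gt0 : 0 < \int[mu]_(x in D) g x by rewrite lt0e gnz.
move Ifa : (\int[mu]_(x in D) f x) => a; move Igb : (\int[mu]_(x in D) g x) => b.
rewrite Ifa in f_gt0 If0; rewrite Igb in g_gt0 Ig0.
case: a f_gt0 Ifa If0 => [a| |]// a0 Ifa _; last first.
  by rewrite poweR_pos_y// gt0_mulye ?leey// poweR_gt0.
case: b g_gt0 Igb Ig0 => [b| |]// b0 Igb _; last first.
  by rewrite poweR_pos_y// gt0_muley ?leey// poweR_gt0.
rewrite lte_fin in a0; rewrite lte_fin in b0.
have ta : (0 <= t / a)%R by rewrite divr_ge0// ltW.
have tb : (0 <= (1 - t) / b)%R by rewrite divr_ge0// ltW.
have ab : (0 <= a `^ t * b `^ (1 - t))%R by rewrite mulr_ge0// powR_ge0.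
have maf : measurable_fun D (fun x => (t / a)%:E * f x) by exact: measurable_funeM.
have mbg : measurable_fun D (fun x => ((1 - t) / b)%:E * g x) by exact: measurable_funeM.
have af0 x : D x -> 0 <= (t / a)%:E * f x by move=> Dx; rewrite mule_ge0 ?f0.
have bg0 x : D x -> 0 <= ((1 - t) / b)%:E * g x by move=> Dx; rewrite mule_ge0 ?g0.
have msum : measurable_fun D (fun x => (t / a)%:E * f x + ((1 - t) / b)%:E * g x).
  exact: emeasurable_funD.
apply: (@le_trans _ _ (\int[mu]_(x in D) ((a `^ t * b `^ (1 - t))%:E *
    ((t / a)%:E * f x + ((1 - t) / b)%:E * g x)))).
  apply: ge0_le_integral => //.
  - by move=> x _; rewrite mule_ge0 ?poweR_ge0.
  - exact: measurable_funeM.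
  - by move=> x Dx; apply: weighted_young_ereal => //; [exact: f0|exact: g0].
rewrite ge0_integralZl//; last by move=> x Dx; rewrite adde_ge0 ?af0 ?bg0.
rewrite ge0_integralD// !ge0_integralZl// Ifa Igb !poweR_EFin -!EFinM lee_fin.
have -> : (t / a * a + (1 - t) / b * b = 1)%R by field; rewrite !gt_eqF.
by rewrite mulr1.
Qed.

End Integrals.

(** * Muckenhoupt weights *)

Section Muckenhoupt.
Context (R : realType) (n : nat).
Local Notation V := 'rV[R]_n.+1.
Local Notation X := (euclidean R n).
Local Notation mu := (@lebesgue R n).
Implicit Types (q K : R) (w v G : X -> R).

Lemma lebesgue_cube_gt0 (a : V) (l : R) : (0 < l)%R -> 0 < mu (cube a l).
Proof. by move=> l0; rewrite lebesgue_cube// lte_fin exprn_gt0. Qed.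

(** Turns identities between products of powers of positive numbers into
    linear identities between exponents. *)
Lemma gt0_expR (x : R) : (0 < x)%R -> exists y : R, x = expR y.
Proof. by move=> x0; exists (ln x); rewrite lnK. Qed.

Lemma muckenhoupt_average (q K W S L : R) : (0 < W)%R -> (0 < S)%R ->
  (0 < L)%R ->
  (L^-1 * W * (L^-1 * S) `^ (q - 1) <= K)%R = (W * S `^ (q - 1) <= K * L `^ q)%R.
Proof.
move=> W0 S0 L0; rewrite -ler_pdivrMr ?powR_gt0//; congr (_ <= _)%R.
have [x ->] := gt0_expR W0; have [y ->] := gt0_expR S0.
have [z ->] := gt0_expR L0.
by rewrite -!expRN -!expRD -!expRM -!expRN -!expRD; congr expR; ring.
Qed.

(** The condition [A_q], [q > 1], with its means multiplied out: [W] and [S]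
    are the integrals over the cube of [w] and of its dual weight.  Finiteness
    and positivity of both integrals are part of the definition. *)
Definition muckenhoupt q K w :=
  [/\ measurable_fun [set: X] w, (forall x, 0 < w x)%R &
    forall (a : V) (l : R), (0 < l)%R -> exists W S : R,
    [/\ (0 < W)%R, (0 < S)%R,
      \int[mu]_(x in cube a l) (w x)%:E = W%:E,
      \int[mu]_(x in cube a l) (w x `^ (- (q - 1)^-1))%:E = S%:E &
      (W * S `^ (q - 1) <= K * (l ^+ n.+1) `^ q)%R]].

Lemma measurable_powRw w (e : R) : measurable_fun [set: X] w ->
  measurable_fun [set: X] (fun x => ((w x) `^ e)%:E).
Proof.
move=> mw; apply/measurable_EFinP.
exact: measurableT_comp (measurable_powR e) mw.
Qed.

Lemma measurable_invr_pos w : measurable_fun [set: X] w ->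
  (forall x, 0 <= w x)%R -> measurable_fun [set: X] (fun x => (w x)^-1)%R.
Proof.
move=> mw w0; rewrite (_ : (fun x => _) = (fun x => w x `^ (-1))%R).
  exact: measurableT_comp (measurable_powR _) mw.
by apply/funext => x; rewrite powR_inv1.
Qed.

Lemma dual_exponent q : (1 < q)%R -> (1 - q / (q - 1) = - (q - 1)^-1)%R.
Proof. by move=> q1; field; rewrite gt_eqF// subr_gt0. Qed.

Lemma muckenhoupt_weight q K w : muckenhoupt q K w -> weight (EFin \o w).
Proof.
move=> [mw w0 _]; split; first exact/measurable_EFinP.
by apply: aeW => x; rewrite lte_fin w0 ltry.
Qed.

Lemma average_cube (f : X -> \bar R) (a : V) (l : R) : (0 < l)%R ->
  average f (cube a l) =
  ((l ^+ n.+1)^-1)%:E * \int[mu]_(x in cube a l) f x.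
Proof.
move=> l0; rewrite /average lebesgue_cube// inver gt_eqF//.
by rewrite exprn_gt0.
Qed.

Lemma muckenhoupt_Ap_char q K w : (1 < q)%R -> muckenhoupt q K w ->
  Ap_char q (EFin \o w) <= K%:E.
Proof.
move=> q1 [mw w0 wQ]; rewrite /Ap_char gt_eqF//.
apply: ge_ereal_sup => _ [_ [a [l [l0 ->]] <-]].
have [W [S [W0 S0 WE SE WS]]] := wQ a l l0.
have L0 : (0 < l ^+ n.+1)%R by rewrite exprn_gt0.
rewrite !average_cube//= dual_exponent//.
have -> : (fun x : X => (w x)%:E `^ (- (q - 1)^-1)) =
    (fun x => (w x `^ (- (q - 1)^-1))%:E) by apply/funext => x; rewrite poweR_EFin.
rewrite WE SE -!EFinM lee_fin.
by rewrite muckenhoupt_average.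
Qed.

(** A bounded product of two positive factors forces both to be finite. *)
Lemma Ap_char_muckenhoupt q K w : (1 < q)%R ->
  measurable_fun [set: X] w -> (forall x, 0 < w x)%R ->
  Ap_char q (EFin \o w) <= K%:E -> muckenhoupt q K w.
Proof.
move=> q1 mw w0; rewrite /Ap_char gt_eqF// => wK; split => // a l l0.
have L0 : (0 < l ^+ n.+1)%R by rewrite exprn_gt0.
have := le_trans (ereal_sup_ubound _) wK.
move=> /(_ _ (ex_intro2 _ _ (cube a l) (ex_intro _ a (ex_intro _ l (conj l0 erefl))) erefl)).
rewrite !average_cube//= dual_exponent//.
have -> : (fun x : X => (w x)%:E `^ (- (q - 1)^-1)) =
    (fun x => (w x `^ (- (q - 1)^-1))%:E) by apply/funext => x; rewrite poweR_EFin.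
have mC : measurable (cube a l : set X) := measurable_cube a l.
have : 0 < \int[mu]_(x in cube a l) (w x)%:E.
  apply: (integral_gt0 mC (lebesgue_cube_gt0 a l0)).
    by apply: measurable_funTS; exact/measurable_EFinP.
  by move=> x _; rewrite lte_fin.
have : 0 < \int[mu]_(x in cube a l) (w x `^ (- (q - 1)^-1))%:E.
  apply: (integral_gt0 mC (lebesgue_cube_gt0 a l0)).
    by apply: measurable_funTS; exact: measurable_powRw.
  by move=> x _; rewrite lte_fin powR_gt0.
move WE : (\int[mu]_(x in cube a l) (w x)%:E) => W.
move SE : (\int[mu]_(x in cube a l) (w x `^ (- (q - 1)^-1))%:E) => S.
move=> S0 W0.
have Li0 : 0 < ((l ^+ n.+1)^-1)%:E by rewrite lte_fin invr_gt0.
case: W W0 WE => [W| |]// W0 WE; last first.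
  rewrite gt0_muley// gt0_mulye ?leye_eq//.
  by apply: poweR_gt0; rewrite mule_gt0.
case: S S0 SE => [S| |]// S0 SE; last first.
  rewrite gt0_muley// poweR_pos_y ?subr_gt0// gt0_muley ?leye_eq//.
  by rewrite mule_gt0.
rewrite !lte_fin in W0 S0.
rewrite -!EFinM lee_fin => WS.
by exists W, S; split => //; rewrite -muckenhoupt_average.
Qed.

(** Hoelder's inequality for the product of [w^(1/q)] and [w^(-1/q)].  The
    bound [S] on the dual mass may come from a larger cube, which is how
    [muckenhoupt_doubling] uses it. *)
Lemma muckenhoupt_lower q w (a : V) (l W S : R) : (1 < q)%R ->
  measurable_fun [set: X] w -> (forall x, 0 < w x)%R -> (0 < l)%R ->
  (0 < W)%R -> (0 < S)%R ->
  \int[mu]_(x in cube a l) (w x)%:E = W%:E ->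
  \int[mu]_(x in cube a l) (w x `^ (- (q - 1)^-1))%:E <= S%:E ->
  ((l ^+ n.+1) `^ q <= W * S `^ (q - 1))%R.
Proof.
move=> q1 mw w0 l0 W0 S0 WE SE.
have q0 : (0 < q)%R by exact: lt_trans q1.
have q10 : (0 < q - 1)%R by rewrite subr_gt0.
have mC : measurable (cube a l : set X) := measurable_cube a l.
have t01 : (0 < q^-1 < 1)%R by rewrite invr_gt0 q0 invf_lt1.
have mwE : measurable_fun (cube a l : set X) (EFin \o w).
  by apply: measurable_funTS; exact/measurable_EFinP.
have mwp : measurable_fun (cube a l : set X) (fun x => (w x `^ (- (q - 1)^-1))%:E).
  by apply: measurable_funTS; exact: measurable_powRw.
have := @integral_holder _ _ _ mu _ _ _ _ mC mwE mwp _ _ t01.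
have -> : \int[mu]_(x in cube a l) ((EFin \o w) x `^ q^-1 *
    (w x `^ (- (q - 1)^-1))%:E `^ (1 - q^-1)) = (l ^+ n.+1)%:E.
  transitivity (\int[mu]_(x in cube a l) (cst 1 x) : \bar R).
    apply: eq_integral => x _; rewrite /= -EFinM.
    have [y ->] := gt0_expR (w0 x).
    transitivity (expR (0 : R))%:E; last by rewrite expR0.
    rewrite -!expRM -expRD; congr (expR _)%:E.
    by field; rewrite !gt_eqF.
  by rewrite integral_cst// mul1e; exact: lebesgue_cube.
rewrite /= WE; move=> /(_ _ _)/le_trans H.
have : (l ^+ n.+1)%:E <= (W `^ q^-1 * S `^ (1 - q^-1))%:E.
  rewrite EFinM -!poweR_EFin; apply: H.
  - by move=> x _; rewrite lee_fin ltW.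
  - by move=> x _; rewrite lee_fin powR_ge0.
  apply: lee_wpmul2l; first exact: poweR_ge0.
  apply: gt0_ler_poweR => //.
  - by rewrite subr_ge0 ltW//; case/andP: t01.
  - rewrite in_itv/= leey andbT.
    by apply: integral_ge0 => x _; rewrite lee_fin powR_ge0.
  - by rewrite in_itv/= leey andbT lee_fin ltW.
rewrite lee_fin => /(ge0_ler_powR (ltW q0)); rewrite !nnegrE => /(_ _ _)/le_trans.
apply.
- by rewrite exprn_ge0// ltW.
- by rewrite mulr_ge0 ?powR_ge0.
- have [y ->] := gt0_expR W0; have [z ->] := gt0_expR S0.
  rewrite -!expRM -!expRD -expRM le_eqVlt; apply/orP; left; apply/eqP.
  by congr expR; field; rewrite gt_eqF.
Qed.
End Muckenhoupt.

(** * A_1 functions relative to a Muckenhoupt weight *)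

Lemma ae_exists d (T : measurableType d) (R : realType)
    (mu : {measure set T -> \bar R}) (D : set T) (P : T -> Prop) :
  measurable D -> 0 < mu D -> {ae mu, forall x, P x} -> exists2 x, D x & P x.
Proof.
move=> mD D0 [N [mN N0 PN]].
have [//|nP] := pselect (exists2 x, D x & P x).
suff : D `<=` N.
  by move=> /(le_measure mu) /=; rewrite !inE => /(_ mD mN); rewrite N0 leNgt D0.
by move=> x Dx; apply: PN => Px; apply: nP; exists x.
Qed.

Section RelativeA1.
Context (R : realType) (n : nat).
Local Notation V := 'rV[R]_n.+1.
Local Notation X := (euclidean R n).
Local Notation mu := (@lebesgue R n).
Implicit Types (q K : R) (w v G : X -> R).

Lemma muckenhoupt_doubling q K w : (1 < q)%R -> muckenhoupt q K w ->
  doubling_weight (K * (3 ^+ n.+1) `^ q) (EFin \o w).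
Proof.
move=> q1 [mw w0 wQ]; split; first exact/measurable_EFinP.
- by move=> x; rewrite lee_fin ltW.
- move=> _ [a [l [l0 ->]]]; have [W [S [W0 _ WE _ _]]] := wQ a l l0.
  by rewrite /weighted_volume WE ltry lte_fin W0.
- move=> a l l0; rewrite /weighted_volume.
  have [W [S [W0 _ WE _ _]]] := wQ a l l0.
  have l30 : (0 < 3 * l)%R by rewrite mulr_gt0.
  have [W3 [S3 [W30 S30 -> S3E WS3]]] := wQ (a - const_mx l)%R (3 * l)%R l30.
  have L3 : (0 < ((3 * l) ^+ n.+1) `^ q)%R by rewrite powR_gt0// exprn_gt0.
  have K0 : (0 < K)%R.
    rewrite -(pmulr_lgt0 _ L3).
    by apply: lt_le_trans WS3; rewrite mulr_gt0// powR_gt0.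
  rewrite WE lee_fin -(@ler_pM2r _ (S3 `^ (q - 1))%R) ?powR_gt0//.
  apply: le_trans WS3 _; rewrite exprMn powRM ?exprn_ge0 ?(ltW l0)// mulrA.
  rewrite -[leRHS]mulrA; apply: ler_wpM2l.
    by rewrite mulr_ge0 ?powR_ge0// ltW.
  apply: (muckenhoupt_lower q1 mw w0 l0 W0 S30 WE).
  rewrite -S3E; apply: ge0_subset_integral.
  - exact: measurable_cube.
  - exact: measurable_cube.
  - by apply: measurable_funTS; exact: measurable_powRw.
  - by move=> x _; rewrite lee_fin powR_ge0.
  - by move=> x ax i; have /andP[? ?] := ax i; rewrite !mxE; apply/andP; split; lra.
Qed.

(** The condition [A_1] relative to the measure [v dx]. *)
Definition relative_A1 K v G :=
  [/\ measurable_fun [set: X] G, (forall x, 0 < G x)%R &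
    {ae mu, forall x, weighted_maximal (EFin \o v) (EFin \o G) x <=
                      K%:E * (G x)%:E}].

(** On a cube the mean of [G] with respect to [v] is a positive finite number
    [c], and [G >= c / K] almost everywhere there.  This lower bound is the only
    form in which the [A_1] condition enters. *)
Lemma relative_A1_cube K v G (a : V) (l W : R) :
  (0 < K)%R -> measurable_fun [set: X] v -> (forall x, 0 < v x)%R ->
  relative_A1 K v G -> (0 < l)%R -> (0 < W)%R ->
  \int[mu]_(x in cube a l) (v x)%:E = W%:E ->
  exists c : R, [/\ (0 < c)%R,
    \int[mu]_(x in cube a l) (G x * v x)%:E = (c * W)%:E &
    {ae mu, forall x, cube a l x -> (c / K <= G x)%R}].
Proof.
move=> K0 mv v0 [mG G0 GA1] l0 W0 WE.
have mC : measurable (cube a l : set X) := measurable_cube a l.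
have avgG : {ae mu, forall x, cube a l x ->
    (W^-1)%:E * \int[mu]_(x in cube a l) (G x * v x)%:E <= K%:E * (G x)%:E}.
  apply: filterS GA1 => x /(le_trans _)H ax; apply: H.
  apply: ereal_sup_ubound; exists (cube a l); first by split => //; exists a, l.
  rewrite /weighted_volume WE inver gt_eqF//; congr (_ * _).
  by apply: eq_integral => y _; rewrite /= gtr0_norm.
have : 0 < \int[mu]_(x in cube a l) (G x * v x)%:E.
  apply: (integral_gt0 mC (lebesgue_cube_gt0 a l0)).
    by apply: measurable_funTS; apply/measurable_EFinP; exact: measurable_funM.
  by move=> x _; rewrite lte_fin mulr_gt0.
move IE : (\int[mu]_(x in cube a l) (G x * v x)%:E) => I.
rewrite IE in avgG.
case: I IE avgG => [I| |]// IE avgG I0; last first.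
  have [x ax] := ae_exists mC (lebesgue_cube_gt0 a l0) avgG.
  by move=> /(_ ax); rewrite gt0_muley ?lte_fin ?invr_gt0.
rewrite lte_fin in I0; exists (I / W)%R; split.
- by rewrite divr_gt0.
- by rewrite mulfVK// gt_eqF.
- apply: filterS avgG => x /[apply]; rewrite -!EFinM lee_fin => h.
  by rewrite ler_pdivrMr// mulrC [leRHS]mulrC.
Qed.

(** With [c] the mean of [G] on a cube, [G >= c / K1] gives
    [int (G v)^(1-q') <= (c / K1)^(1-q') int v^(1-q')], while
    [int G v = c int v]; the powers of [c] cancel. *)
Lemma relative_A1_mul q K1 K v G : (1 < q)%R -> (0 < K1)%R ->
  muckenhoupt q K v -> relative_A1 K1 v G ->
  muckenhoupt q (K1 * K) (fun x => G x * v x)%R.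
Proof.
move=> q1 K10 [mv v0 vQ] GA1; have [mG G0 _] := GA1.
have q10 : (0 < q - 1)%R by rewrite subr_gt0.
have mGv : measurable_fun [set: X] (fun x => G x * v x)%R by exact: measurable_funM.
have Gv0 x : (0 < G x * v x)%R by rewrite mulr_gt0.
split => // a l l0.
have [W [S [W0 S0 WE SE WS]]] := vQ a l l0.
have [c [c0 cE cG]] := relative_A1_cube K10 mv v0 GA1 l0 W0 WE.
have mC : measurable (cube a l : set X) := measurable_cube a l.
have SGle : \int[mu]_(x in cube a l) ((G x * v x) `^ (- (q - 1)^-1))%:E <=
    ((c / K1) `^ (- (q - 1)^-1) * S)%:E.
  rewrite EFinM -SE -ge0_integralZl//; last 3 first.
  - by apply: measurable_funTS; exact: measurable_powRw.
  - by move=> x _; rewrite lee_fin powR_ge0.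
  - by rewrite lee_fin powR_ge0.
  apply: (ae_ge0_le_integral mC).
  - by move=> x _; rewrite lee_fin powR_ge0.
  - by apply: measurable_funTS; exact: measurable_powRw.
  - by move=> x _; rewrite -EFinM lee_fin mulr_ge0// powR_ge0.
  - apply: measurable_funeM.
    by apply: measurable_funTS; exact: measurable_powRw.
  - apply: filterS cG => x /[apply] cGx; rewrite -EFinM lee_fin.
    rewrite powRM ?(ltW (G0 x))// ?(ltW (v0 x))//.
    apply: ler_wpM2r; first exact: powR_ge0.
    have [y yE] := gt0_expR (G0 x).
    have [z zE] := gt0_expR (divr_gt0 c0 K10).
    move: cGx; rewrite yE zE -!expRM !ler_expR => zy.
    by rewrite !mulrN lerN2 ler_wpM2r// invr_ge0 ltW.
have : 0 < \int[mu]_(x in cube a l) ((G x * v x) `^ (- (q - 1)^-1))%:E.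
  apply: (integral_gt0 mC (lebesgue_cube_gt0 a l0)).
    by apply: measurable_funTS; exact: measurable_powRw.
  by move=> x _; rewrite lte_fin powR_gt0.
move: SGle; move SGE : (\int[mu]_(x in _) _) => SG.
case: SG SGE => [SG| |]// SGE; rewrite lee_fin lte_fin => SGle SG0.
exists (c * W)%R, SG; split => //; first by rewrite mulr_gt0.
apply: (@le_trans _ _ (K1 * (W * S `^ (q - 1)))%R); last first.
  by rewrite -mulrA ler_wpM2l// ltW.
apply: (@le_trans _ _ (c * W * ((c / K1) `^ (- (q - 1)^-1) * S) `^ (q - 1))%R).
  apply: ler_wpM2l; first by rewrite mulr_ge0 ?ltW.
  apply: ge0_ler_powR; rewrite ?nnegrE ?(ltW q10) ?(ltW SG0)//.
  exact: le_trans (ltW SG0) SGle.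
have [x ->] := gt0_expR c0; have [y ->] := gt0_expR K10.
have [z ->] := gt0_expR W0; have [t ->] := gt0_expR S0.
rewrite -!expRN -!expRD -!expRM -!expRD -!expRM -!expRD le_eqVlt.
by apply/orP; left; apply/eqP; congr expR; field; rewrite gt_eqF.
Qed.

(** The lower bound for [G] controls [int G^(-s) v]; in the dual integral
    the positive power of [G] is handled by Hoelder's inequality between [G v]
    and [v^(1-q')].  The index [(1 + s) q] is the one for which the exponents of
    [v] match. *)
Lemma relative_A1_powN q K1 K s v G : (1 < q)%R -> (0 < K1)%R -> (0 < s)%R ->
  muckenhoupt q K v -> relative_A1 K1 v G ->
  muckenhoupt ((1 + s) * q) (K1 `^ s * K `^ (1 + s))
    (fun x => G x `^ (- s) * v x)%R.
Proof.
move=> q1 K10 s0 [mv v0 vQ] GA1; have [mG G0 _] := GA1.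
have q10 : (0 < q - 1)%R by rewrite subr_gt0.
pose r := ((1 + s) * q)%R; rewrite -/r.
have r10 : (0 < r - 1)%R by rewrite /r; nra.
have sr1 : (r - 1 - s = (1 + s) * (q - 1))%R by rewrite /r; ring.
have mGs : measurable_fun [set: X] (fun x => G x `^ (- s))%R.
  exact: measurableT_comp (measurable_powR _) mG.
have mGv : measurable_fun [set: X] (fun x => G x `^ (- s) * v x)%R.
  exact: measurable_funM.
have Gv0 x : (0 < G x `^ (- s) * v x)%R by rewrite mulr_gt0// powR_gt0.
split => // a l l0.
have [W [S [W0 S0 WE SE WS]]] := vQ a l l0.
have [c [c0 cE cG]] := relative_A1_cube K10 mv v0 GA1 l0 W0 WE.
have mC : measurable (cube a l : set X) := measurable_cube a l.
have WGle : \int[mu]_(x in cube a l) (G x `^ (- s) * v x)%:E <=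
    ((c / K1) `^ (- s) * W)%:E.
  have mve : measurable_fun (cube a l : set X) (EFin \o v).
    by apply: measurable_funTS; exact/measurable_EFinP.
  rewrite EFinM -WE -ge0_integralZl//; last 2 first.
  - by move=> x _; rewrite lee_fin ltW.
  - by rewrite lee_fin powR_ge0.
  apply: (ae_ge0_le_integral mC).
  - by move=> x _; rewrite lee_fin ltW.
  - by apply: measurable_funTS; exact/measurable_EFinP.
  - by move=> x _; rewrite -EFinM lee_fin mulr_ge0// ?powR_ge0// ltW.
  - exact: measurable_funeM.
  - apply: filterS cG => x /[apply] cGx; rewrite -EFinM lee_fin.
    apply: ler_wpM2r; first exact: ltW.
    have [y yE] := gt0_expR (G0 x).
    have [z zE] := gt0_expR (divr_gt0 c0 K10).
    move: cGx; rewrite yE zE -!expRM !ler_expR => zy.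
    by rewrite !mulrN lerN2 ler_wpM2r// ltW.
have t01 : (0 < s / (r - 1) < 1)%R.
  by rewrite divr_gt0//= ltr_pdivrMr// mul1r -subr_gt0 sr1 mulr_gt0// addr_gt0.
have SGle : \int[mu]_(x in cube a l) ((G x `^ (- s) * v x) `^ (- (r - 1)^-1))%:E <=
    ((c * W) `^ (s / (r - 1)) * S `^ (1 - s / (r - 1)))%:E.
  have mf1 : measurable_fun (cube a l : set X) (fun x => (G x * v x)%:E).
    by apply: measurable_funTS; apply/measurable_EFinP; exact: measurable_funM.
  have mf2 : measurable_fun (cube a l : set X) (fun x => (v x `^ (- (q - 1)^-1))%:E).
    by apply: measurable_funTS; exact: measurable_powRw.
  have := @integral_holder _ _ _ mu _ _ _ _ mC mf1 mf2 _ _ t01.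
  rewrite cE SE => H; rewrite EFinM -!poweR_EFin.
  apply: le_trans (H _ _).
  - rewrite le_eqVlt; apply/orP; left; apply/eqP; apply: eq_integral => x _.
    have [y ->] := gt0_expR (G0 x); have [z ->] := gt0_expR (v0 x).
    rewrite !poweR_EFin -EFinM; congr (_%:E).
    rewrite -!expRM -!expRD -!expRM -!expRD; congr expR.
    rewrite /r; field.
    by rewrite gt_eqF//= gt_eqF.
  - by move=> x _; rewrite lee_fin mulr_ge0 ?ltW.
  - by move=> x _; rewrite lee_fin powR_ge0.
have : 0 < \int[mu]_(x in cube a l) (G x `^ (- s) * v x)%:E.
  apply: (integral_gt0 mC (lebesgue_cube_gt0 a l0)).
    by apply: measurable_funTS; exact/measurable_EFinP.
  by move=> x _; rewrite lte_fin.
have : 0 < \int[mu]_(x in cube a l) ((G x `^ (- s) * v x) `^ (- (r - 1)^-1))%:E.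
  apply: (integral_gt0 mC (lebesgue_cube_gt0 a l0)).
    by apply: measurable_funTS; exact: measurable_powRw.
  by move=> x _; rewrite lte_fin powR_gt0.
move: SGle; move SGE : (\int[mu]_(x in _) _) => SG.
case: SG SGE => [SG| |]// SGE; rewrite lee_fin lte_fin => SGle SG0.
move: WGle; move WGE : (\int[mu]_(x in _) _) => WG.
case: WG WGE => [WG| |]// WGE; rewrite lee_fin lte_fin => WGle WG0.
exists WG, SG; split => //.
have L0 : (0 < l ^+ n.+1)%R by rewrite exprn_gt0.
have K0 : (0 < K)%R.
  rewrite -(@pmulr_lgt0 _ ((l ^+ n.+1) `^ q)%R) ?powR_gt0//.
  by apply: lt_le_trans WS; rewrite mulr_gt0// powR_gt0.
apply: (@le_trans _ _ (((c / K1) `^ (- s) * W) *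
    ((c * W) `^ (s / (r - 1)) * S `^ (1 - s / (r - 1))) `^ (r - 1))%R).
  apply: ler_pM; rewrite ?(ltW WG0) ?powR_ge0//.
  apply: ge0_ler_powR; rewrite ?nnegrE ?(ltW r10) ?(ltW SG0)//.
  exact: le_trans (ltW SG0) SGle.
move: WS.
have [x ->] := gt0_expR c0; have [y ->] := gt0_expR K10.
have [z ->] := gt0_expR W0; have [t ->] := gt0_expR S0.
have [k ->] := gt0_expR K0; have [L ->] := gt0_expR L0.
rewrite -!expRN -!expRD -!expRM -!expRD -!expRM -!expRD !ler_expR => WS.
have -> : ((x - y) * - s + z + ((x + z) * (s / (r - 1)) +
    t * (1 - s / (r - 1))) * (r - 1) = y * s + (1 + s) * (z + t * (q - 1)))%R.
  by rewrite /r; field; rewrite gt_eqF.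
have -> : (y * s + k * (1 + s) + L * r = y * s + (1 + s) * (k + L * q))%R.
  by rewrite /r; ring.
by rewrite lerD2l ler_pM2l// addr_gt0.
Qed.
End RelativeA1.

(** * Representatives of weights *)

Section Regularize.
Context d (T : measurableType d) (R : realType).
Variable mu : {measure set T -> \bar R}.

Lemma positive_representative (w : T -> \bar R) :
  measurable_fun [set: T] w -> {ae mu, forall x, 0 < w x < +oo} ->
  exists w' : T -> R, [/\ measurable_fun [set: T] w', (forall x, 0 < w' x)%R &
    {ae mu, forall x, w x = (w' x)%:E}].
Proof.
move=> mw w0.
pose phi (t : R) : R := if (0 < t)%R then t else 1%R.
have mphi : measurable_fun [set: R] phi.
  by apply: measurable_fun_ifT => //; apply: measurable_fun_ltr.
exists (fun x => phi (fine (w x))); split.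
- apply: (measurableT_comp mphi); exact: measurableT_comp (fine_measurable measurableT) mw.
- by move=> x; rewrite /phi; case: ifP.
- apply: filterS w0 => x; case: (w x) => [r| |]//; last by rewrite ltxx andbF.
  by rewrite /phi lte_fin => /andP[-> _].
Qed.
End Regularize.

Section WeightRepresentatives.
Context (R : realType) (n : nat).
Local Notation V := 'rV[R]_n.+1.
Local Notation X := (euclidean R n).
Local Notation mu := (@lebesgue R n).

Lemma Ap_char_ae_eq q (w : X -> \bar R) (w' : X -> R) : (1 < q)%R ->
  measurable_fun [set: X] w -> measurable_fun [set: X] w' ->
  {ae mu, forall x, w x = (w' x)%:E} ->
  Ap_char q w = Ap_char q (EFin \o w').
Proof.
move=> q1 mw mw' ww'; rewrite /Ap_char (gt_eqF q1); congr ereal_sup.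
apply: eq_imagel => _ [a [l [l0 ->]]]; rewrite /average.
have mC : measurable (cube a l : set X) := measurable_cube a l.
have -> : \int[mu]_(x in cube a l) w x = \int[mu]_(x in cube a l) (EFin \o w') x.
  apply: (@ae_eq_integral _ _ _ mu _ _ _ mC).
  - exact: measurable_funTS.
  - by apply: measurable_funTS; exact/measurable_EFinP.
  - by apply: filterS ww'.
have -> // : \int[mu]_(x in cube a l) (w x `^ (1 - q / (q - 1))) =
   \int[mu]_(x in cube a l) ((EFin \o w') x `^ (1 - q / (q - 1))).
apply: (@ae_eq_integral _ _ _ mu _ _ _ mC).
- by apply: measurable_funTS; exact: measurableT_comp (measurable_poweR _) mw.
- apply: measurable_funTS; apply: measurableT_comp (measurable_poweR _) _.
  exact/measurable_EFinP.
- by apply: filterS ww' => x ->.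
Qed.

Lemma muckenhoupt_cst1 : muckenhoupt 2 1 ((fun=> 1%R) : X -> R).
Proof.
split => // a l l0; have L0 : (0 < l ^+ n.+1)%R by rewrite exprn_gt0.
have I1 : \int[mu]_(x in cube a l) 1%:E = (l ^+ n.+1)%:E.
  by rewrite integral_cst ?mul1e; [exact: lebesgue_cube|exact: measurable_cube].
exists (l ^+ n.+1)%R, (l ^+ n.+1)%R; split => //.
  by under eq_integral do rewrite powR1.
by rewrite mul1r (_ : 2 - 1 = 1)%R ?powRr1 ?(ltW L0)// ?powR_mulrn ?(ltW L0)// ?expr2//; ring.
Qed.

(** An [A_1] weight is an [A_1] function relative to the constant weight, so
    that the inclusion of [A_1] in [A_2] is a case of [relative_A1_mul]. *)
Lemma A1_muckenhoupt (v : X -> \bar R) (v' : X -> R) :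
  measurable_fun [set: X] v -> measurable_fun [set: X] v' ->
  (forall x, 0 < v' x)%R -> {ae mu, forall x, v x = (v' x)%:E} ->
  Ap_char 1 v < +oo -> exists K, muckenhoupt 2 K v'.
Proof.
move=> mv mv' v'0 vv'; rewrite /Ap_char eqxx => A1.
have [K [K0 AK]] : exists K : R, (0 < K)%R /\
    {ae mu, forall x, `|maximal v x / v x| <= K%:E}.
  move: A1; rewrite unlock ifT; last first.
    apply: lt_le_trans (lebesgue_cube_gt0 (0 : V) ltr01) _.
    by apply: le_measure; rewrite ?inE//; exact: measurable_cube.
  set e := ess_sup _ _ => eoo.
  have fe : {ae mu, forall x, `|maximal v x / v x| <= e} by exact: ess_sup_ge.
  exists (Num.max 1 (fine e))%R; split; first by rewrite lt_max ltr01.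
  apply: filterS fe => x /le_trans; apply.
  move: eoo; case: e => [r| |]// _; rewrite ?leNye//.
  by rewrite lee_fin le_max lexx orbT.
exists (K * 1)%R.
rewrite (_ : v' = (fun x => v' x * 1)%R); last by apply/funext => x; rewrite mulr1.
apply: (relative_A1_mul _ K0 muckenhoupt_cst1); first by rewrite ltr1n.
split => //.
apply: (filterS2 _ _ AK vv') => x AKx vx.
rewrite (_ : weighted_maximal _ _ x = maximal v x); last first.
  congr ereal_sup; apply: eq_imagel => _ [[a [l [l0 ->]]] _].
  rewrite /average /weighted_volume; congr (_^-1 * _).
    by rewrite /= integral_cst ?mul1e//; exact: measurable_cube.
  apply: (@ae_eq_integral _ _ _ mu _ _ _ (measurable_cube a l)).
  - apply: measurable_funTS; apply/measurable_EFinP.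
    by under eq_fun do rewrite mulr1; exact: measurableT_comp mv'.
  - by apply: measurable_funTS; exact: measurableT_comp mv.
  - by apply: filterS vv' => y -> _; rewrite /= mule1.
move: AKx; rewrite vx.
have M0 : 0 <= maximal v x.
  apply: (@le_trans _ _ (average (fun y => `|v y|) (cube ((x : V) - const_mx 1)%R 2))).
    rewrite /average mule_ge0 ?inve_ge0 ?integral_ge0//.
  apply: ereal_sup_ubound; exists (cube ((x : V) - const_mx 1)%R 2) => //; split.
    by exists (x - const_mx 1)%R, 2%R.
  by move=> i; rewrite !mxE; apply/andP; split; lra.
rewrite inver gt_eqF// gee0_abs; last by rewrite mule_ge0// lee_fin invr_ge0 ltW.
by rewrite lee_pdivrMr.
Qed.

End WeightRepresentatives.

(** * Complementary functions and the Rubio de Francia algorithm *)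

Section YoungComplement.
Context (R : realType).
Implicit Types (Phi : R -> R).

(** Upper level sets are upward closed, hence rays with or without their
    endpoint. *)
Lemma nondecreasing_emeasurable (F : \bar R -> \bar R) :
  {homo F : x y / x <= y} -> measurable_fun [set: \bar R] F.
Proof.
move=> ndF; apply: (measurability _ (ErealGenOInfty.measurableE R)) => _ [_ [a ->] <-].
rewrite setTI; set S := F @^-1` _.
have up x y : x <= y -> S x -> S y.
  by rewrite /S /= !in_itv/= !andbT => xy /lt_le_trans; apply; exact: ndF.
pose i := ereal_inf S; have [Si|nSi] := pselect (S i).
  rewrite (_ : S = [set` `[i, +oo[]); first exact: emeasurable_itv.
  apply/seteqP; split => x /=; rewrite in_itv/= andbT; last by move/up; apply.
  by move=> Sx; exact: ereal_inf_lbound.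
rewrite (_ : S = [set` `]i, +oo[]); first exact: emeasurable_itv.
apply/seteqP; split => x /=; rewrite in_itv/= andbT.
  move=> Sx; rewrite lt_neqAle ereal_inf_lbound// andbT.
  by apply/eqP => ix; apply: nSi; rewrite /i -/i ix.
by move=> /ereal_inf_lt[y Sy yx]; exact: up (ltW yx) Sy.
Qed.

Lemma young_compl_le Phi : {homo young_compl Phi : x y / x <= y}.
Proof.
move=> x y xy; apply: ge_ereal_sup => _ [s s0 <-].
apply: (@le_trans _ _ (s%:E * y - (Phi s)%:E)); last first.
  by apply: ereal_sup_ubound; exists s.
by apply: leeD2r; apply: lee_wpmul2l => //; rewrite lee_fin ltW.
Qed.

Lemma measurable_young_compl Phi : measurable_fun [set: \bar R] (young_compl Phi).
Proof. exact: nondecreasing_emeasurable (@young_compl_le Phi). Qed.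

Lemma young_inequality Phi (s : R) (t : \bar R) : (0 < s)%R ->
  s%:E * t <= (Phi s)%:E + young_compl Phi t.
Proof.
move=> s0; rewrite addeC -leeBlDr//.
by apply: ereal_sup_ubound; exists s.
Qed.

Lemma young_compl_pinfty Phi : young_compl Phi +oo = +oo.
Proof.
apply/eqP; rewrite -leye_eq; apply: ereal_sup_ubound; exists 1%R => //=.
by rewrite mul1e.
Qed.

Lemma young_compl_ge0 Phi (t : \bar R) :
  (forall e : R, 0 < e -> exists2 s : R, 0 < s & Phi s <= e)%R ->
  0 <= t -> 0 <= young_compl Phi t.
Proof.
move=> small t0; apply/lee_addgt0Pr => e e0; have [s s0 se] := small e e0.
apply: (@le_trans _ _ (s%:E * t)); first by rewrite mule_ge0// lee_fin ltW.
by apply: le_trans (young_inequality Phi t s0) _; rewrite addeC leeD2l// lee_fin.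
Qed.

(** Countable convexity of a supremum of affine functions; the weights [c]
    may sum to less than one because the complementary function is
    nonnegative. *)
Lemma young_compl_series Phi (c : nat -> R) (a : nat -> \bar R) :
  (forall e : R, 0 < e -> exists2 s : R, 0 < s & Phi s <= e)%R ->
  (forall s : R, 0 < s -> 0 <= Phi s)%R ->
  (forall k, 0 <= c k)%R -> (forall k, 0 <= a k) ->
  \sum_(k <oo) (c k)%:E <= 1 ->
  young_compl Phi (\sum_(k <oo) (c k)%:E * a k) <=
  \sum_(k <oo) (c k)%:E * young_compl Phi (a k).
Proof.
move=> small Phi0 c0 a0 c1; apply: ge_ereal_sup => _ [s s0 <-].
have ck0 k : 0 <= (c k)%:E by rewrite lee_fin.
have ya0 k : 0 <= young_compl Phi (a k) by exact: young_compl_ge0.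
rewrite leeBlDr// -nneseriesZl; last by move=> k _; rewrite mule_ge0.
apply: (@le_trans _ _ (\sum_(k <oo) ((c k)%:E * young_compl Phi (a k) +
    (c k)%:E * (Phi s)%:E))).
  apply: lee_nneseries => [k _ _|k _].
    by rewrite !mule_ge0// lee_fin ltW.
  rewrite muleCA -ge0_muleDr ?lee_fin ?Phi0//; apply: lee_wpmul2l => //.
  by rewrite addeC; exact: young_inequality.
rewrite nneseriesD//; last 2 first.
- by move=> k _ _; rewrite mule_ge0.
- by move=> k _ _; rewrite mule_ge0// lee_fin Phi0.
apply: leeD => //; rewrite ge0_nneseriesZr ?lee_fin ?Phi0//.
by rewrite -[leRHS]mul1e; apply: lee_wpmul2r => //; rewrite lee_fin Phi0.
Qed.

Lemma sum_half_pow (N : nat) :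
  (\sum_(0 <= k < N) (2 ^+ k.+1)^-1 = 1 - (2 ^+ N)^-1 :> R)%R.
Proof.
elim: N => [|N IH]; first by rewrite big_nil expr0 invr1 subrr.
rewrite big_nat_recr//= IH exprS; field.
by rewrite expf_neq0.
Qed.

Lemma series_half_pow_le1 : \sum_(k <oo) ((2 ^+ k.+1)^-1 : R)%:E <= 1.
Proof.
apply: lime_le; first by apply: is_cvg_nneseries => k _ _; rewrite lee_fin invr_ge0.
apply: nearW => N; rewrite sumEFin sum_half_pow lee_fin gerBl.
by rewrite invr_ge0.
Qed.

End YoungComplement.

Section RubioDeFrancia.
Context (R : realType) (n : nat).
Local Notation V := 'rV[R]_n.+1.
Local Notation X := (euclidean R n).
Local Notation mu := (@lebesgue R n).
Implicit Types (f : X -> \bar R).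

Lemma weighted_maximal_series (v : X -> \bar R) (c : nat -> R)
    (g : nat -> X -> \bar R) x :
  measurable_fun [set: X] v -> (forall x, 0 <= v x) ->
  (forall Q, cubes Q -> 0 < weighted_volume v Q < +oo) ->
  (forall k, 0 <= c k)%R ->
  (forall k, measurable_fun [set: X] (g k)) -> (forall k x, 0 <= g k x) ->
  weighted_maximal v (fun x => \sum_(k <oo) (c k)%:E * g k x) x <=
  \sum_(k <oo) (c k)%:E * weighted_maximal v (g k) x.
Proof.
move=> mv v0 vQ c0 mg g0; apply: ge_ereal_sup => _ [Q [cQ Qx] <-].
have ck0 k : 0 <= (c k)%:E by rewrite lee_fin.
have mQ := measurable_cubes cQ.
have cg0 k y : 0 <= (c k)%:E * (g k y * v y) by rewrite !mule_ge0.
have gv0 k y : 0 <= g k y * v y by rewrite mule_ge0.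
have mgv k : measurable_fun Q (fun y => g k y * v y).
  by apply: measurable_funTS; exact: emeasurable_funM.
have /andP[] := vQ _ cQ; move WE : (weighted_volume v Q) => W.
case: W WE => [W| |]// WE W0 _; rewrite lte_fin in W0.
rewrite inver gt_eqF//.
have -> : \int[mu]_(y in Q) (`|\sum_(k <oo) (c k)%:E * g k y| * v y) =
    \sum_(k <oo) (c k)%:E * \int[mu]_(y in Q) (`|g k y| * v y).
  transitivity (\int[mu]_(y in Q) \sum_(k <oo) (c k)%:E * (g k y * v y)).
    apply: eq_integral => y _; rewrite gee0_abs; last first.
      by apply: nneseries_ge0 => k _ _; rewrite mule_ge0.
    rewrite -ge0_nneseriesZr//; last by move=> k; rewrite mule_ge0.
    by apply: eq_eseriesr => k _; rewrite muleA.
  rewrite (integral_nneseries mu mQ (fun k => measurable_funeM _ (mgv k))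
    (fun k y _ => cg0 k y)).
  apply: eq_eseriesr => k _.
  rewrite (ge0_integralZl mu mQ (mgv k) (fun y _ => gv0 k y) (ck0 k)).
  by congr (_ * _); apply: eq_integral => y _; rewrite gee0_abs.
rewrite -nneseriesZl; last first.
  move=> k _; rewrite mule_ge0//; apply: integral_ge0 => y _.
  by rewrite mule_ge0.
apply: lee_nneseries => [k _ _|k _].
  rewrite !mule_ge0// ?lee_fin ?invr_ge0 ?(ltW W0)//; apply: integral_ge0 => y _.
  by rewrite mule_ge0.
rewrite muleCA; apply: lee_wpmul2l => //.
apply: ereal_sup_ubound; exists Q => //.
by rewrite WE inver gt_eqF.
Qed.

(** The weights [2^(-k-1) K^(-k)] make [H] almost invariant under the maximal
    operator, their geometric decay compensates the factor [K^k] lost in [k]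
    applications of the modular bound, and their sum is at most one, as convexity
    requires. *)
Lemma rubio_de_francia (Phi : R -> R) (u v : X -> R) (K : R) f :
  (forall e : R, 0 < e -> exists2 s : R, 0 < s & Phi s <= e)%R ->
  (forall s : R, 0 < s -> 0 <= Phi s)%R ->
  measurable_fun [set: X] u -> (forall x, 0 < u x)%R ->
  measurable_fun [set: X] v -> (forall x, 0 < v x)%R ->
  (forall Q, cubes Q -> 0 < weighted_volume (EFin \o v) Q < +oo) ->
  (1 <= K)%R ->
  (forall g : X -> \bar R, measurable_fun [set: X] g -> (forall x, 0 <= g x) ->
    \int[mu]_x (young_compl Phi
      (weighted_maximal (EFin \o v) g x * ((u x)^-1)%:E) * (v x)%:E) <=
    K%:E * \int[mu]_x (young_compl Phi (g x * ((u x)^-1)%:E) * (v x)%:E)) ->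
  measurable_fun [set: X] f -> (forall x, 0 <= f x) ->
  exists H : X -> \bar R, [/\ measurable_fun [set: X] H,
    (forall x, f x <= 2%:E * H x),
    (forall x, 0 <= H x),
    (forall x, weighted_maximal (EFin \o v) H x <= (2 * K)%:E * H x) &
    \int[mu]_x (young_compl Phi (H x * ((u x)^-1)%:E) * (v x)%:E) <=
    \int[mu]_x (young_compl Phi (f x * ((u x)^-1)%:E) * (v x)%:E)].
Proof.
move=> small Phi0 mu_ u0 mv v0 vQ K1 MK mf f0.
have K0 : (0 < K)%R by exact: lt_le_trans K1.
have mve : measurable_fun [set: X] (EFin \o v) by exact/measurable_EFinP.
have ve0 x : 0 <= (EFin \o v) x by rewrite lee_fin ltW.
pose M k : X -> \bar R := iter k (weighted_maximal (EFin \o v)) f.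
have mM k : measurable_fun [set: X] (M k).
  by case: k => [//|k]; exact: measurable_weighted_maximal.
have M0 k x : 0 <= M k x.
  by case: k => [|k]; [exact: f0|exact: weighted_maximal_ge0].
pose c k : R := ((2 ^+ k.+1)^-1 * (K ^+ k)^-1)%R.
have c0 k : (0 <= c k)%R by rewrite mulr_ge0// invr_ge0 exprn_ge0// ltW.
have ck0 k : 0 <= (c k)%:E by rewrite lee_fin.
have cK k : (c k = 2 * K * c k.+1)%R.
  rewrite /c [(2 ^+ k.+2)%R]exprS [(K ^+ k.+1)%R]exprS; field.
  by apply/and3P; split; rewrite ?expf_neq0// gt_eqF.
have c_half k : (c k <= (2 ^+ k.+1)^-1)%R.
  by rewrite ler_piMr ?invr_ge0// invf_le1 ?exprn_gt0// exprn_ege1.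
have cM0 k x : 0 <= (c k)%:E * M k x by rewrite mule_ge0.
have mcM k : measurable_fun [set: X] (fun x => (c k)%:E * M k x).
  exact: measurable_funeM.
exists (fun x => \sum_(k <oo) (c k)%:E * M k x); split.
- exact: ge0_emeasurable_sum (fun k x _ _ => cM0 k x) (fun k _ => mcM k).
- move=> x; rewrite (@nneseriesD1 _ _ 0%N xpredT)//=.
  apply: (@le_trans _ _ (2%:E * ((c 0%N)%:E * M 0%N x))).
    rewrite muleA -EFinM /c expr0 invr1 mulr1 expr1 divff// mul1e; exact: lexx.
  by apply: lee_wpmul2l; rewrite ?lee_fin// leeDl// nneseries_ge0.
- by move=> x; exact: nneseries_ge0.
- move=> x; apply: le_trans (weighted_maximal_series x mve ve0 vQ c0 mM M0) _.
  rewrite -nneseriesZl//.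
  apply: (@le_trans _ _ (\sum_(k <oo) (2 * K)%:E * ((c k.+1)%:E * M k.+1 x))).
    apply: lee_nneseries => [k _ _|k _]; first by rewrite mule_ge0// (M0 k.+1).
    by rewrite muleA -EFinM -cK.
  have K20 : 0 <= (2 * K)%:E by rewrite lee_fin mulr_ge0// ltW.
  pose b k := (2 * K)%:E * ((c k)%:E * M k x).
  have b0 k : 0 <= b k by rewrite mule_ge0.
  rewrite -[leLHS]/(\sum_(k <oo) b k.+1) -[leRHS]/(\sum_(k <oo) b k).
  have -> : \sum_(k <oo) b k.+1 = \sum_(1 <= k <oo) b k.
    by rewrite -(nneseries_addn 1%N b0); apply: eq_eseriesr => k _; rewrite addn1.
  by rewrite [leRHS](@nneseries_split _ b 0%N 1%N)// add0n big_nat1 leeDr.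
- have yM0 k x : 0 <= young_compl Phi (M k x * ((u x)^-1)%:E).
    by apply: young_compl_ge0 => //; rewrite mule_ge0// lee_fin invr_ge0 ltW.
  have mui : measurable_fun [set: X] (fun x => ((u x)^-1)%:E).
    apply/measurable_EFinP; apply: (measurable_invr_pos mu_) => x.
    exact: ltW.
  have myM k : measurable_fun [set: X]
      (fun x => young_compl Phi (M k x * ((u x)^-1)%:E)).
    apply: measurableT_comp (@measurable_young_compl R Phi) _.
    exact: emeasurable_funM.
  have IM k : \int[mu]_x (young_compl Phi (M k x * ((u x)^-1)%:E) * (v x)%:E) <=
      (K ^+ k)%:E * \int[mu]_x (young_compl Phi (f x * ((u x)^-1)%:E) * (v x)%:E).
    elim: k => [|k IH]; first by rewrite mul1e.
    apply: le_trans (MK _ (mM k) (M0 k)) _; rewrite exprS EFinM -muleA.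
    by apply: lee_wpmul2l; rewrite ?lee_fin ?(ltW K0).
  move: IM; set I := \int[mu]_x (young_compl Phi (f x * _) * _) => IM.
  have I0 : 0 <= I.
    by apply: integral_ge0 => x _; rewrite mule_ge0//; [exact: (yM0 0%N)|exact: ve0].
  pose g k x := young_compl Phi (M k x * ((u x)^-1)%:E) * (v x)%:E.
  have mg k : measurable_fun [set: X] (g k) by exact: emeasurable_funM (myM k) mve.
  have g0 k x : 0 <= g k x by rewrite mule_ge0//; exact: ve0.
  have mcg k : measurable_fun [set: X] (fun x => (c k)%:E * g k x).
    exact: measurable_funeM (mg k).
  have cg0 k x : 0 <= (c k)%:E * g k x by rewrite mule_ge0.
  have ui0 x : 0 <= ((u x)^-1)%:E by rewrite lee_fin invr_ge0 ltW.
  have c1 : \sum_(k <oo) (c k)%:E <= 1.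
    apply: le_trans (@series_half_pow_le1 R).
    by apply: lee_nneseries => // k _; rewrite lee_fin.
  apply: (@le_trans _ _ (\int[mu]_x \sum_(k <oo) ((c k)%:E * g k x))).
    apply: ge0_le_integral; first exact: measurableT.
    - move=> x _; rewrite mule_ge0//; last exact: ve0.
      by apply: young_compl_ge0 => //; rewrite mule_ge0// nneseries_ge0.
    - apply: emeasurable_funM mve.
      apply: measurableT_comp (@measurable_young_compl R Phi) _.
      apply: emeasurable_funM mui.
      exact: ge0_emeasurable_sum (fun k x _ _ => cM0 k x) (fun k _ => mcM k).
    - exact: ge0_emeasurable_sum (fun k x _ _ => cg0 k x) (fun k _ => mcg k).
    - move=> x _; rewrite -ge0_nneseriesZr//.
      have -> : \sum_(k <oo) (c k)%:E * M k x * ((u x)^-1)%:E =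
          \sum_(k <oo) (c k)%:E * (M k x * ((u x)^-1)%:E).
        by apply: eq_eseriesr => k _; rewrite muleA.
      have Mu0 k : 0 <= M k x * ((u x)^-1)%:E by rewrite mule_ge0.
      apply: le_trans (lee_wpmul2r (ve0 x) (young_compl_series small Phi0 c0 Mu0 c1)) _.
      rewrite -ge0_nneseriesZr//; last by move=> k; rewrite mule_ge0.
      rewrite le_eqVlt; apply/orP; left; apply/eqP.
      by apply: eq_eseriesr => k _; rewrite muleA.
  rewrite (integral_nneseries mu measurableT mcg (fun k x _ => cg0 k x)).
  apply: (@le_trans _ _ (\sum_(k <oo) ((2 ^+ k.+1)^-1)%:E * I)).
    apply: lee_nneseries => [k _ _|k _]; first exact: integral_ge0.
    rewrite (ge0_integralZl mu measurableT (mg k) (fun x _ => g0 k x) (ck0 k)).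
    apply: le_trans (lee_wpmul2l (ck0 k) (IM k)) _.
    rewrite muleA -EFinM; apply: lee_wpmul2r => //; rewrite lee_fin /c mulfVK//.
    by rewrite expf_neq0// gt_eqF.
  rewrite ge0_nneseriesZr//.
  by rewrite -[leRHS]mul1e; apply: lee_wpmul2r => //; exact: series_half_pow_le1.
Qed.

End RubioDeFrancia.

(** * Young functions with the doubling property *)

Section DoublingYoung.
Context (R : realType).
Implicit Types (Phi : R -> R).

(** What modular extrapolation uses of a Young function of finite upper
    index.  Convexity enters through the monotonicity of [Phi(s) / s]. *)
Definition doubling_young Phi (D : R) :=
  [/\ Phi 0%R = 0%R, (forall s : R, 0 < s -> 0 < Phi s)%R,
    (forall s t : R, 0 < s -> s <= t -> Phi s / s <= Phi t / t)%R &
    (forall t : R, 0 < t -> Phi (2 * t) <= D * Phi t)%R].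

Section Facts.
Variables (Phi : R -> R) (D : R).
Hypothesis PhiD : doubling_young Phi D.

Lemma doubling_young_ge0 (s : R) : (0 <= s)%R -> (0 <= Phi s)%R.
Proof.
have [P0 Pgt0 _ _] := PhiD; rewrite le_eqVlt => /predU1P[<-|/Pgt0/ltW//].
by rewrite P0.
Qed.

Lemma doubling_young_slope (s t : R) : (0 < s)%R -> (s <= t)%R ->
  (Phi s * t <= Phi t * s)%R.
Proof.
have [_ _ Psl _] := PhiD => s0 st; have t0 := lt_le_trans s0 st.
by have := Psl _ _ s0 st; rewrite ler_pdivrMr// mulrAC ler_pdivlMr.
Qed.

Lemma doubling_young_le (s t : R) : (0 <= s)%R -> (s <= t)%R -> (Phi s <= Phi t)%R.
Proof.
rewrite le_eqVlt => /predU1P[<- t0|s0 st].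
  by have [-> _ _ _] := PhiD; exact: doubling_young_ge0.
have t0 := lt_le_trans s0 st.
rewrite -(ler_pM2r t0); apply: le_trans (doubling_young_slope s0 st) _.
by apply: ler_wpM2l => //; apply: doubling_young_ge0; exact: ltW.
Qed.

Lemma doubling_young_small (e : R) : (0 < e)%R -> exists2 s : R, (0 < s)%R & (Phi s <= e)%R.
Proof.
move=> e0; have [_ Pgt0 _ _] := PhiD.
have P1 : (0 < Phi 1)%R by exact: Pgt0.
pose s : R := Num.min 1%R (e / Phi 1)%R.
have s0 : (0 < s)%R by rewrite lt_min ltr01 divr_gt0.
exists s => //; have s1 : (s <= 1)%R by rewrite ge_min lexx.
have := doubling_young_slope s0 s1; rewrite mulr1 => /le_trans; apply.
by rewrite mulrC -ler_pdivlMr// ge_min lexx orbT.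
Qed.

(** The maximum of [s Phi(a) / a - Phi(s)] over [s > 0] is nonpositive for
    [s >= a] and at most [Phi(a)] for [s <= a], by monotonicity of slopes. *)
Lemma young_compl_dual_slope (a : R) : (0 <= a)%R ->
  young_compl Phi (Phi a / a)%:E <= (Phi a)%:E.
Proof.
have [P0 _ _ _] := PhiD; move=> a0; apply: ge_ereal_sup => _ [s s0 <-].
rewrite /= in s0; rewrite -EFinM -EFinB lee_fin.
have Ps0 := doubling_young_ge0 (ltW s0).
move: a0; rewrite le_eqVlt => /predU1P[<-|a0].
  by rewrite invr0 mulr0 mulr0 P0 sub0r oppr_le0.
have Pa0 := doubling_young_ge0 (ltW a0).
have [sa|/ltW as_] := leP s a.
  apply: (@le_trans _ _ (s * (Phi a / a))%R); first by rewrite gerBl.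
  by rewrite mulrA ler_pdivrMr// mulrC ler_wpM2l.
apply: (@le_trans _ _ 0%R) => //; rewrite subr_le0 mulrA ler_pdivrMr//.
by rewrite mulrC; exact: doubling_young_slope.
Qed.

Lemma young_ext_ge0 (t : \bar R) : 0 <= t -> 0 <= young_ext Phi t.
Proof.
by case: t => [r| |]//=; rewrite lee_fin => r0; rewrite lee_fin doubling_young_ge0.
Qed.

Lemma young_ext_le (s t : \bar R) : 0 <= s -> s <= t ->
  young_ext Phi s <= young_ext Phi t.
Proof.
case: s t => [s| |] [t| |]//=; rewrite ?leey// !lee_fin.
exact: doubling_young_le.
Qed.

(** [young_ext] is monotone on the nonnegative half-line only, hence the
    truncation at zero. *)
Lemma measurable_young_ext d (T : measurableType d) (f : T -> \bar R) :
  measurable_fun [set: T] f -> (forall x, 0 <= f x) ->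
  measurable_fun [set: T] (fun x => young_ext Phi (f x)).
Proof.
move=> mf f0; pose F t := young_ext Phi (maxe 0 t).
rewrite (_ : (fun x => _) = F \o f); last first.
  by apply/funext => x; rewrite /F /= max_r.
apply: measurableT_comp => //; apply: nondecreasing_emeasurable => x y xy.
apply: young_ext_le; first by rewrite le_max lexx.
by rewrite ge_max le_max lexx/= le_max xy orbT.
Qed.

Lemma young_ext_inequality (s t : \bar R) : 0 <= s -> 0 <= t ->
  s * t <= young_ext Phi s + young_compl Phi t.
Proof.
move=> s0 t0; have y0 := young_compl_ge0 doubling_young_small t0.
case: s s0 => [s| |]// s0; last by rewrite /= addye ?leey// gt_eqF// (lt_le_trans _ y0)// ltNye.
move: (s0); rewrite lee_fin le_eqVlt => /predU1P[<-|sgt0]; last exact: young_inequality.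
by rewrite mul0e adde_ge0//; exact: young_ext_ge0.
Qed.

Lemma doubling_young_iter m (t : R) : (0 < t)%R -> (Phi (2 ^+ m * t) <= D ^+ m * Phi t)%R.
Proof.
have [_ Pgt0 _ Pdbl] := PhiD; move=> t0.
have D0 : (0 < D)%R.
  rewrite -(pmulr_lgt0 _ (Pgt0 _ t0)); apply: lt_le_trans (Pdbl _ t0).
  by apply: Pgt0; rewrite mulr_gt0.
elim: m => [|m IH]; first by rewrite !mul1r.
rewrite !exprS -!mulrA; apply: le_trans (Pdbl _ _) _.
  by rewrite mulr_gt0// exprn_gt0.
by rewrite ler_pM2l.
Qed.

Lemma young_ext_scale (c : R) : (0 < c)%R -> exists2 C : R, (0 < C)%R &
  forall t, 0 <= t -> young_ext Phi (c%:E * t) <= C%:E * young_ext Phi t.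
Proof.
have [P0 Pgt0 _ Pdbl] := PhiD; move=> c0.
have D0 : (0 < D)%R.
  rewrite -(pmulr_lgt0 _ (Pgt0 1%R ltr01)); apply: lt_le_trans (Pdbl _ ltr01).
  by apply: Pgt0; rewrite mulr_gt0.
pose m := Num.bound c.
have cm : (c <= 2 ^+ m)%R.
  apply: (@le_trans _ _ m%:R).
    by apply/ltW/(le_lt_trans (ler_norm _)); rewrite ger0_norm ?archi_boundP// ltW.
  by rewrite -natrX ler_nat ltnW// ltn_expl.
exists (D ^+ m)%R; first by rewrite exprn_gt0.
case=> [t| |]// t0; last by rewrite /= !gt0_muley ?lte_fin// exprn_gt0.
rewrite /= lee_fin; move: t0; rewrite lee_fin le_eqVlt => /predU1P[<-|t0].
  by rewrite mulr0 P0 mulr0.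
apply: le_trans (doubling_young_iter m t0); apply: doubling_young_le.
  by rewrite mulr_ge0 ?ltW.
by rewrite ler_pM2r.
Qed.

Lemma doubling_young_unbounded (A : R) :
  exists t0 : R, forall t : R, (t0 <= t)%R -> (A <= Phi t)%R.
Proof.
have [_ Pgt0 _ _] := PhiD.
have P1 : (0 < Phi 1)%R by exact: Pgt0.
exists (Num.max 1%R (A / Phi 1)%R) => t; rewrite ge_max => /andP[t1 At].
have := doubling_young_slope ltr01 t1; rewrite mulr1; apply: le_trans.
by rewrite mulrC -ler_pdivrMr.
Qed.

End Facts.
End DoublingYoung.

Section YoungFunctions.
Context (R : realType).
Variable Phi : R -> R.
Hypothesis PhiY : young_function Phi.

Lemma young_function_lt (s t : R) : (0 <= s)%R -> (s < t)%R -> (Phi s < Phi t)%R.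
Proof.
have [_ _ _ Pincr _] := PhiY => s0 st; apply: Pincr => //; rewrite in_itv/= andbT//.
exact: le_trans (ltW st).
Qed.

Lemma young_function0 : Phi 0%R = 0%R.
Proof.
have [Pge0 _ _ _ [P0 _]] := PhiY.
apply/eqP; rewrite eq_le Pge0// andbT; apply/ler_addgt0Pr => e e0; rewrite add0r.
have : \forall t \near (0 : R)^'+, (Phi t / t < 1)%R.
  by apply: (cvgr_lt 0%R P0); exact: ltr01.
move=> near1.
have : \forall t \near (0 : R)^'+, (0 < t)%R /\ (t < e)%R /\ (Phi t / t < 1)%R.
  near=> t; split; first by near: t; exact: nbhs_right_gt.
  split; last by near: t.
  by near: t; exact: nbhs_right_lt.
move=> /filter_ex[t [t0 [te Pt1]]].
apply: le_trans (ltW (young_function_lt (lexx _) t0)) _.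
by apply: le_trans (ltW te); move: Pt1; rewrite ltr_pdivrMr// mul1r => /ltW.
Unshelve. all: by end_near. Qed.

(** Convexity between [0] and [t], together with [Phi(0) = 0]. *)
Lemma young_function_slope (s t : R) : (0 < s)%R -> (s <= t)%R ->
  (Phi s / s <= Phi t / t)%R.
Proof.
move=> s0 st; have t0 := lt_le_trans s0 st.
have [_ _ Pcvx _ _] := PhiY.
have st0 : (0 <= s / t)%R by rewrite divr_ge0 ?ltW.
have st1 : (s / t <= 1)%R by rewrite ler_pdivrMr// mul1r.
have := Pcvx (Itv01 st0 st1) t 0%R.
rewrite !inE/= !in_itv/= !andbT (ltW t0) lexx => /(_ isT isT).
move=> h; have {h} : (Phi (s / t * t + (1 - s / t) * 0) <=
    s / t * Phi t + (1 - s / t) * Phi 0)%R by exact: h.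
rewrite young_function0 !mulr0 !addr0 mulfVK ?gt_eqF// => h.
by rewrite ler_pdivrMr// mulrAC -mulrA mulrC.
Qed.

(** The limit defining the upper index exists: otherwise [lim] would return
    the default value [0], against
    [1 < lower_index Phi <= upper_index Phi].  Being finite, it makes the
    dilation function finite at some [t >= 2]. *)
Lemma young_function_doubling :
  1 < lower_index Phi -> lower_index Phi <= upper_index Phi ->
  upper_index Phi < +oo -> exists D : R, doubling_young Phi D.
Proof.
move=> i1 iI Ioo.
have cvgI : cvg ((lne (young_dilation Phi t) / (ln t)%:E) @[t --> (+oo%R : set_system R)]).
  apply: contrapT => /dvgP Ipt.
  have := lt_le_trans i1 iI; rewrite /upper_index Ipt.
  by rewrite ltNge lee_fin ler01.
pose L := upper_index Phi.
have L1 : 1 < L by exact: lt_le_trans i1 iI.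
have nearL : \forall t \near +oo%R, lne (young_dilation Phi t) / (ln t)%:E < +oo.
  apply: (cvgI [set x | x < +oo]).
  exact: (open_ereal_lt' Ioo).
have : \forall t \near (+oo%R : set_system R), (2 <= t)%R /\ lne (young_dilation Phi t) / (ln t)%:E < +oo.
  near=> t; split; last by near: t.
  by near: t; exact: nbhs_pinfty_ge.
move=> /filter_ex[t [t2 ht]].
have t1 : (1 < t)%R by apply: lt_le_trans t2; rewrite ltr1n.
have lt0 : (0 < ln t)%R by exact: ln_gt0.
have hoo : young_dilation Phi t < +oo.
  rewrite ltey; apply/eqP => hE; move: ht; rewrite hE /= inver gt_eqF//.
  by rewrite gt0_mulye ?lte_fin ?invr_gt0.
exists (fine (young_dilation Phi t)); split.
- exact: young_function0.
- move=> s s0; rewrite -young_function0; exact: young_function_lt.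
- exact: young_function_slope.
- move=> s s0; have Ps0 : (0 < Phi s)%R.
    by rewrite -young_function0; exact: young_function_lt.
  apply: (@le_trans _ _ (Phi (s * t))%R).
    have : (2 * s <= s * t)%R by rewrite mulrC ler_pM2l.
    rewrite le_eqVlt => /predU1P[->//|]; move=> /(@young_function_lt _ _ _)/ltW; apply.
    by rewrite mulr_ge0// ltW.
  rewrite -ler_pdivrMr//.
  have : (Phi (s * t) / Phi s)%:E <= young_dilation Phi t.
    by apply: ereal_sup_ubound; exists s.
  by case: (young_dilation Phi t) hoo => [r| |].
Unshelve. all: by end_near. Qed.

End YoungFunctions.

(** * Modular extrapolation for one pair *)

Section MaximalRelativeA1.
Context (R : realType) (n : nat).
Local Notation V := 'rV[R]_n.+1.
Local Notation X := (euclidean R n).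
Local Notation mu := (@lebesgue R n).

Definition centered_cube (x : V) (k : nat) : set X :=
  cube (x - const_mx k.+1%:R)%R (2 * k.+1%:R).

Lemma cubes_centered x k : cubes (centered_cube x k).
Proof. by exists (x - const_mx k.+1%:R)%R, (2 * k.+1%:R)%R; rewrite mulr_gt0. Qed.

Lemma centered_cube_le (x : V) k m : (k <= m)%N ->
  centered_cube x k `<=` centered_cube x m.
Proof.
move=> km y yk i; have := yk i; rewrite !mxE => /andP[? ?].
have : (k.+1%:R <= m.+1%:R :> R)%R by rewrite ler_nat.
by move=> ?; apply/andP; split; lra.
Qed.

Lemma bigcup_centered_cube (x : V) : \bigcup_k centered_cube x k = [set: X].
Proof.
apply/seteqP; split => // y _.
pose r : R := (\sum_i `|((y : V) - x) ord0 i|)%R.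
exists (Num.bound r) => // i; rewrite !mxE.
have ri : (`|(y : V) ord0 i - x ord0 i| <= r)%R.
  by rewrite /r (bigD1 i)//= !mxE lerDl sumr_ge0.
have : (r < (Num.bound r).+1%:R)%R.
  apply: (@lt_trans _ _ (Num.bound r)%:R); last by rewrite ltr_nat.
  by rewrite archi_boundP// sumr_ge0.
move: ri; rewrite ler_norml => /andP[? ?] ?; apply/andP; split; lra.
Qed.

(** If [H v] has positive integral then some cube around any given point
    already carries mass, so [H] is positive everywhere; being finite almost
    everywhere it has a positive real-valued representative. *)
Lemma maximal_relative_A1 (v : X -> R) (K : R) (H : X -> \bar R) :
  (0 < K)%R -> measurable_fun [set: X] v -> (forall x, 0 < v x)%R ->
  (forall Q, cubes Q -> 0 < weighted_volume (EFin \o v) Q < +oo) ->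
  measurable_fun [set: X] H -> (forall x, 0 <= H x) ->
  (forall x, weighted_maximal (EFin \o v) H x <= K%:E * H x) ->
  0 < \int[mu]_x (H x * (v x)%:E) ->
  {ae mu, forall x, H x < +oo} ->
  exists2 G, relative_A1 K v G & {ae mu, forall x, H x = (G x)%:E}.
Proof.
move=> K0 mv v0 vQ mH H0 HM HI Hoo.
have mve : measurable_fun [set: X] (EFin \o v) by exact/measurable_EFinP.
have mHv : measurable_fun [set: X] (fun x => H x * (v x)%:E).
  exact: emeasurable_funM mH mve.
have Hv0 x : 0 <= H x * (v x)%:E by rewrite mule_ge0// lee_fin ltW.
have Hpos (x : X) : 0 < H x.
  have [k Ik] : exists k, 0 < \int[mu]_(y in centered_cube x k) (H y * (v y)%:E).
    apply: contrapT => nk.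
    have cvgI : \int[mu]_(y in centered_cube x k) (H y * (v y)%:E) @[k --> \oo] -->
        \int[mu]_(y in \bigcup_k centered_cube x k) (H y * (v y)%:E).
      apply: ge0_nondecreasing_set_cvg_integral.
      - by move=> k m km; apply/subsetPset; exact: centered_cube_le.
      - by move=> k; exact: measurable_cube.
      - by move=> k; exact: measurable_funTS mHv.
      - by move=> k y _; exact: Hv0.
    have I0 k : \int[mu]_(y in centered_cube x k) (H y * (v y)%:E) = 0.
      apply/eqP; rewrite eq_le integral_ge0// andbT leNgt.
      by apply/negP => h; apply: nk; exists k.
    move: HI; rewrite -(bigcup_centered_cube x) -(cvg_lim _ cvgI)//.
    by under eq_fun do rewrite I0; rewrite lim_cst// ltxx.
  have /andP[] := vQ _ (cubes_centered x k).
  move WE : (weighted_volume _ _) => W; case: W WE => [W| |]// WE W0 _.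
  rewrite lte_fin in W0.
  have : 0 < K%:E * H x; last by rewrite pmule_rgt0.
  apply: lt_le_trans (HM x).
  apply: (@lt_le_trans _ _ ((W^-1)%:E *
      \int[mu]_(y in centered_cube x k) (H y * (v y)%:E))).
    by rewrite mule_gt0// lte_fin invr_gt0.
  apply: ereal_sup_ubound; exists (centered_cube x k).
    split; first exact: cubes_centered.
    move=> i; rewrite !mxE; have k0 : (0 < k.+1%:R :> R)%R by rewrite ltr0n.
    by apply/andP; split; lra.
  rewrite WE inver gt_eqF//; congr (_ * _).
  by apply: eq_integral => y _; rewrite gee0_abs.
have Hfin : {ae mu, forall x, 0 < H x < +oo} by apply: filterS Hoo => x ->; rewrite Hpos.
have [G [mG G0 HG]] := positive_representative mH Hfin.
exists G => //; split => //; apply: (filterS _ HG) => x Hx; rewrite -Hx.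
rewrite (_ : weighted_maximal _ (EFin \o G) x = weighted_maximal (EFin \o v) H x)//.
congr ereal_sup; apply: eq_imagel => _ [[a [l [l0 ->]]] _]; congr (_ * _).
apply: (@ae_eq_integral _ _ _ mu _ _ _ (measurable_cube a l)).
- apply: measurable_funTS; apply: emeasurable_funM mve.
  have mGe : measurable_fun [set: X] (EFin \o G) by exact/measurable_EFinP.
  exact: measurableT_comp (@abse_measurable R _) mGe.
- apply: measurable_funTS; apply: emeasurable_funM mve.
  exact: measurableT_comp (@abse_measurable R _) mH.
- by apply: filterS HG => y ->.
Qed.
End MaximalRelativeA1.

Section ModularExtrapolation.
Context (R : realType) (n : nat).
Local Notation X := (euclidean R n).
Local Notation mu := (@lebesgue R n).

(** Assumption (M) for real-valued weights and nonnegative functions. *)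
Definition modular_maximal_bound (Phi : R -> R) (u v : X -> R) (K : R) :=
  forall g : X -> \bar R, measurable_fun [set: X] g -> (forall x, 0 <= g x) ->
    \int[mu]_x (young_compl Phi
      (weighted_maximal (EFin \o v) g x * ((u x)^-1)%:E) * (v x)%:E) <=
    K%:E * \int[mu]_x (young_compl Phi (g x * ((u x)^-1)%:E) * (v x)%:E).

(** The main estimate, for a finite minorant [phi] of [f] whose modular is
    finite and can thus be absorbed. *)
Lemma modular_absorption (Phi : R -> R) (D : R) (u v : X -> R) (p q K Kv C : R)
    (phi : X -> R) (f g : X -> \bar R) :
  doubling_young Phi D ->
  measurable_fun [set: X] u -> (forall x, 0 < u x)%R ->
  (1 < q)%R -> muckenhoupt q Kv v -> (1 <= K)%R ->
  modular_maximal_bound Phi u v K ->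
  measurable_fun [set: X] f -> (forall x, 0 <= f x) ->
  measurable_fun [set: X] g -> (forall x, 0 <= g x) ->
  (0 < p)%R -> (0 < C)%R ->
  (forall w, muckenhoupt q (2 * K * Kv) w ->
    \int[mu]_x (f x `^ p * (w x)%:E) <= C%:E * \int[mu]_x (g x `^ p * (w x)%:E)) ->
  measurable_fun [set: X] phi -> (forall x, 0 <= phi x)%R ->
  (forall x, (phi x)%:E <= f x) ->
  \int[mu]_x (Phi (phi x `^ p * u x) * v x)%:E < +oo ->
  \int[mu]_x (Phi (phi x `^ p * u x) * v x)%:E <=
  \int[mu]_x (young_ext Phi ((4 * C)%:E * (g x `^ p * (u x)%:E)) * (v x)%:E).
Proof.
move=> PhiD mu_ u0 q1 Mv K1 MK mf f0 mg g0 p0 C0 fg mphi phi0 phif.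
have [mv v0 vQ] := Mv; have [_ _ vvol _] := muckenhoupt_doubling q1 Mv.
have K0 : (0 < K)%R by exact: lt_le_trans K1.
have mve : measurable_fun [set: X] (EFin \o v) by exact/measurable_EFinP.
have mue : measurable_fun [set: X] (EFin \o u) by exact/measurable_EFinP.
have ve0 x : 0 <= (v x)%:E by rewrite lee_fin ltW.
have ue0 x : 0 <= (u x)%:E by rewrite lee_fin ltW.
pose a x := (phi x `^ p * u x)%R.
have a0 x : (0 <= a x)%R by rewrite mulr_ge0 ?powR_ge0// ltW.
have mphip : measurable_fun [set: X] (fun x => phi x `^ p)%R.
  exact: measurableT_comp (measurable_powR p) mphi.
have ma : measurable_fun [set: X] a by exact: measurable_funM.
have Pa0 x : (0 <= Phi (a x))%R by exact: (doubling_young_ge0 PhiD (a0 x)).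
have mPa : measurable_fun [set: X] (fun x => Phi (a x)).
  apply/measurable_EFinP.
  have mae : measurable_fun [set: X] (EFin \o a) by exact/measurable_EFinP.
  have ae0 x : 0 <= (EFin \o a) x by rewrite lee_fin.
  exact: (measurable_young_ext PhiD mae ae0).
(* where [a] vanishes the quotient is 0, the value that duality requires *)
pose h x := (u x * (Phi (a x) / a x))%R.
have h0 x : (0 <= h x)%R by rewrite mulr_ge0 ?divr_ge0// ltW.
have mh : measurable_fun [set: X] h.
  exact: (measurable_funM mu_ (measurable_funM mPa (measurable_invr_pos ma a0))).
have phih x : (phi x `^ p * h x = Phi (a x))%R.
  rewrite /h mulrA -/(a x) mulrCA; have [->|an0] := eqVneq (a x) 0%R.
    by rewrite mul0r mulr0; have [-> _ _ _] := PhiD.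
  by rewrite divff// mulr1.
set I := \int[mu]_x (Phi (a x) * v x)%:E.
have mPav : measurable_fun [set: X] (fun x => (Phi (a x) * v x)%:E).
  by apply/measurable_EFinP; exact: measurable_funM.
have Pav0 x : 0 <= (Phi (a x) * v x)%:E by rewrite lee_fin mulr_ge0// ltW.
have J0 : 0 <= \int[mu]_x (young_ext Phi ((4 * C)%:E * (g x `^ p * (u x)%:E)) * (v x)%:E).
  apply: integral_ge0 => x _; rewrite mule_ge0//; apply: (young_ext_ge0 PhiD).
  by rewrite mule_ge0 ?mule_ge0 ?poweR_ge0// lee_fin mulr_ge0// ltW.
have [->//|In0] := eqVneq I 0.
have I0 : 0 < I by rewrite lt0e In0 integral_ge0.
move=> Ioo.
have mhe : measurable_fun [set: X] (EFin \o h) by exact/measurable_EFinP.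
have he0 x : 0 <= (EFin \o h) x by rewrite lee_fin.
have [H [mH hH H0 HM HI]] := rubio_de_francia (doubling_young_small PhiD)
  (fun s s0 => doubling_young_ge0 PhiD (ltW s0)) mu_ u0 mv v0 vvol K1 MK mhe he0.
have mui : measurable_fun [set: X] (fun x => ((u x)^-1)%:E).
  apply/measurable_EFinP; apply: (measurable_invr_pos mu_) => x.
  exact: ltW.
have ui0 x : 0 <= ((u x)^-1)%:E by rewrite lee_fin invr_ge0 ltW.
have mHu : measurable_fun [set: X] (fun x => H x * ((u x)^-1)%:E).
  exact: emeasurable_funM mH mui.
have Hu0 x : 0 <= H x * ((u x)^-1)%:E by rewrite mule_ge0.
have myH : measurable_fun [set: X] (fun x => young_compl Phi (H x * ((u x)^-1)%:E)).
  exact: measurableT_comp (@measurable_young_compl R Phi) mHu.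
have yH0 x : 0 <= young_compl Phi (H x * ((u x)^-1)%:E).
  exact: (young_compl_ge0 (doubling_young_small PhiD) (Hu0 x)).
have myHv : measurable_fun [set: X]
    (fun x => young_compl Phi (H x * ((u x)^-1)%:E) * (v x)%:E).
  exact: emeasurable_funM myH mve.
have yHv0 x : 0 <= young_compl Phi (H x * ((u x)^-1)%:E) * (v x)%:E.
  by rewrite mule_ge0.
have {}HI : \int[mu]_x (young_compl Phi (H x * ((u x)^-1)%:E) * (v x)%:E) <= I.
  apply: le_trans HI _; apply: ge0_le_integral; first exact: measurableT.
  - move=> x _; rewrite mule_ge0//; apply: young_compl_ge0.
      exact: doubling_young_small PhiD.
    by rewrite mule_ge0.
  - apply: emeasurable_funM mve.
    apply: measurableT_comp (@measurable_young_compl R Phi) _.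
    exact: emeasurable_funM mhe mui.
  - exact: mPav.
  - move=> x _; rewrite EFinM; apply: lee_wpmul2r => //.
    rewrite -EFinM /h mulrAC divff ?gt_eqF// mul1r.
    exact: (young_compl_dual_slope PhiD (a0 x)).
have Hoo : {ae mu, forall x, H x < +oo}.
  have iy : mu.-integrable [set: X]
      (fun x => young_compl Phi (H x * ((u x)^-1)%:E) * (v x)%:E).
    apply/integrableP; split=> //; under eq_integral do rewrite gee0_abs//.
    exact: le_lt_trans HI Ioo.
  apply: filterS (integrable_ae measurableT iy) => x /(_ Logic.I).
  rewrite ltey; apply: contraTN => /eqP ->.
  rewrite gt0_mulye ?lte_fin ?invr_gt0// young_compl_pinfty.
  by rewrite gt0_mulye ?lte_fin.
have mHv : measurable_fun [set: X] (fun x => H x * (v x)%:E).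
  exact: emeasurable_funM mH mve.
have Hv0 x : 0 <= H x * (v x)%:E by rewrite mule_ge0.
have HvI : 0 < \int[mu]_x (H x * (v x)%:E).
  rewrite lt0e integral_ge0// andbT; apply/eqP => HI0.
  have := integral_eq0_ae measurableT mHv (fun x _ => Hv0 x) HI0.
  move=> Hz; move/eqP: In0; apply; apply: ae_eq0_integral => //.
  apply: filterS Hz => x /[apply] /eqP; rewrite mule_eq0 eqe (gt_eqF (v0 x)) orbF.
  move=> /eqP Hx; have := hH x; rewrite Hx mule0 lee_fin => hx.
  have hx0 : h x = 0%R by apply/eqP; rewrite eq_le hx h0.
  by rewrite -phih hx0 mulr0 mul0r.
have K20 : (0 < 2 * K)%R by rewrite mulr_gt0.
have [G GA1 HG] := maximal_relative_A1 K20 mv v0 vvol mH H0 HM HvI Hoo.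
have [mG G0 _] := GA1.
have := fg _ (relative_A1_mul q1 K20 Mv GA1).
have intG (k : X -> \bar R) : measurable_fun [set: X] k ->
  \int[mu]_x (k x `^ p * (G x * v x)%:E) = \int[mu]_x (k x `^ p * (H x * (v x)%:E)).
  move=> mk; have mkp : measurable_fun [set: X] (fun x => k x `^ p).
    exact: measurableT_comp (measurable_poweR _) mk.
  apply: (@ae_eq_integral _ _ _ mu _ _ _ measurableT).
  - apply: emeasurable_funM mkp _; apply/measurable_EFinP.
    exact: measurable_funM.
  - exact: emeasurable_funM mkp mHv.
  - by apply: filterS HG => x -> _; rewrite EFinM.
rewrite (intG f mf) (intG g mg) => fgH.
(* Young's inequality is applied to the product of [4 C g^p u] and [H / u] *)
have : I + I <= \int[mu]_x (young_ext Phi ((4 * C)%:E * (g x `^ p * (u x)%:E)) * (v x)%:E) + I.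
  have mgp : measurable_fun [set: X] (fun x => g x `^ p).
    exact: measurableT_comp (measurable_poweR _) mg.
  have mfp : measurable_fun [set: X] (fun x => f x `^ p).
    exact: measurableT_comp (measurable_poweR _) mf.
  pose E x := young_ext Phi ((4 * C)%:E * (g x `^ p * (u x)%:E)).
  have gu0 x : 0 <= (4 * C)%:E * (g x `^ p * (u x)%:E).
    by rewrite mule_ge0 ?mule_ge0 ?poweR_ge0// lee_fin mulr_ge0// ltW.
  have mE : measurable_fun [set: X] E.
    have mgu := measurable_funeM (4 * C)%:E (emeasurable_funM mgp mue).
    exact: (measurable_young_ext PhiD mgu gu0).
  have E0 x : 0 <= E x by exact: (young_ext_ge0 PhiD (gu0 x)).
  have mEv : measurable_fun [set: X] (fun x => E x * (v x)%:E).
    exact: emeasurable_funM mE mve.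
  have Ev0 x : 0 <= E x * (v x)%:E by rewrite mule_ge0.
  have gH0 x : 0 <= g x `^ p * (H x * (v x)%:E) by rewrite mule_ge0 ?poweR_ge0.
  have fH0 x : 0 <= f x `^ p * (H x * (v x)%:E) by rewrite mule_ge0 ?poweR_ge0.
  have mgH : measurable_fun [set: X] (fun x => g x `^ p * (H x * (v x)%:E)).
    exact: emeasurable_funM mgp mHv.
  have mfH : measurable_fun [set: X] (fun x => f x `^ p * (H x * (v x)%:E)).
    exact: emeasurable_funM mfp mHv.
  have C4 : 0 <= (4 * C)%:E by rewrite lee_fin mulr_ge0// ltW.
  apply: (@le_trans _ _ (\int[mu]_x
      ((4 * C)%:E * (g x `^ p * (H x * (v x)%:E))))).
    rewrite (ge0_integralZl mu measurableT mgH (fun x _ => gH0 x) C4).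
    have -> : (4 * C = 2 * (2 * C))%R by ring.
    rewrite EFinM -muleA EFinM.
    have -> : I + I = 2%:E * I by rewrite -[in LHS](mul1e I) -ge0_muleDl// -EFinD.
    apply: lee_wpmul2l => //; rewrite -muleA.
    apply: (@le_trans _ _ (2%:E * \int[mu]_x (f x `^ p * (H x * (v x)%:E)))); last first.
      by apply: lee_wpmul2l.
    rewrite -(ge0_integralZl mu measurableT mfH (fun x _ => fH0 x))//.
    apply: ge0_le_integral; first exact: measurableT.
    - by move=> x _; exact: Pav0.
    - exact: mPav.
    - exact: measurable_funeM.
    - move=> x _; rewrite -phih !EFinM -muleA [leRHS]muleCA.
      apply: lee_pmul.
      + by rewrite lee_fin powR_ge0.
      + by rewrite mule_ge0// he0.
      + rewrite -poweR_EFin; apply: gt0_ler_poweR => //; first exact: ltW.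
          by rewrite in_itv/= leey andbT lee_fin.
        by rewrite in_itv/= leey andbT.
      + by rewrite [leRHS]muleA; apply: lee_wpmul2r => //; exact: hH.
  rewrite -[X in _ <= _ + X]/I.
  apply: (@le_trans _ _ (\int[mu]_x (E x * (v x)%:E) +
      \int[mu]_x (young_compl Phi (H x * ((u x)^-1)%:E) * (v x)%:E))%E).
    rewrite -(ge0_integralD mu measurableT (fun x _ => Ev0 x) mEv (fun x _ => yHv0 x) myHv).
    apply: ge0_le_integral; first exact: measurableT.
    - by move=> x _; rewrite mule_ge0.
    - exact: measurable_funeM mgH.
    - exact: emeasurable_funD mEv myHv.
    - move=> x _; rewrite -ge0_muleDl// !muleA; apply: lee_wpmul2r => //.
      apply: le_trans (young_ext_inequality PhiD (gu0 x) (Hu0 x)).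
      rewrite -!muleA; apply: lee_wpmul2l => //.
      apply: lee_wpmul2l; first exact: poweR_ge0.
      rewrite muleCA -EFinM divff ?mule1//.
      by rewrite gt_eqF.
  exact: leeD.
by rewrite leeD2rE// fin_numE gt_eqF ?(lt_le_trans _ (ltW I0))//= lt_eqF.
Qed.

End ModularExtrapolation.

Section Truncation.
Context (R : realType) (n : nat).
Local Notation X := (euclidean R n).
Local Notation mu := (@lebesgue R n).

Variables (u v : X -> R) (f : X -> \bar R).
Hypotheses (mu_ : measurable_fun [set: X] u) (mv : measurable_fun [set: X] v).
Hypotheses (mf : measurable_fun [set: X] f) (f0 : forall x, 0 <= f x).

Definition trunc_dom (N : nat) : set X := centered_cube (0 : 'rV[R]_n.+1)%R N `\`
  ([set x | N%:R%:E < (EFin \o u) x] `|` [set x | N%:R%:E < (EFin \o v) x]).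

(** Cutting [f] at height [N] and off the set where [u], [v] or the position
    exceed [N] makes the modular of [f^p u] finite. *)
Definition trunc (N : nat) (x : X) : R :=
  (fine (mine (f x) N%:R%:E) * \1_(trunc_dom N) x)%R.

Lemma measurable_trunc_dom N : measurable (trunc_dom N).
Proof.
have mue : measurable_fun [set: X] (EFin \o u) by exact/measurable_EFinP.
have mve : measurable_fun [set: X] (EFin \o v) by exact/measurable_EFinP.
apply: measurableD; first exact: measurable_cube.
apply: measurableU.
- exact: (measurable_superlevel N%:R%:E mue).
- exact: (measurable_superlevel N%:R%:E mve).
Qed.

Lemma measurable_trunc N : measurable_fun [set: X] (trunc N).
Proof.
have mmin : measurable_fun [set: X] (fun x => mine (f x) N%:R%:E).
  exact: (measurable_mine mf (@measurable_cst _ _ _ _ _ N%:R%:E)).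
have mfin := measurableT_comp (@fine_measurable R _ measurableT) mmin.
have mind : measurable_fun [set: X] (\1_(trunc_dom N) : X -> R).
  by apply: measurable_indic; exact: measurable_trunc_dom.
exact: (measurable_funM mfin mind).
Qed.

Lemma trunc_domP N x : trunc_dom N x ->
  [/\ (u x <= N%:R)%R, (v x <= N%:R)%R & centered_cube (0 : 'rV[R]_n.+1)%R N x].
Proof.
move=> [xN /not_orP[/negP + /negP]]; rewrite /= -!leNgt !lee_fin.
by [].
Qed.

Lemma mine_fin N x : exists2 r : R, (0 <= r <= N%:R)%R & mine (f x) N%:R%:E = r%:E.
Proof.
have := f0 x; case: (f x) => [r| |]// r0.
  rewrite lee_fin in r0; exists (Num.min r N%:R); first by rewrite le_min r0 ge_min lexx orbT ler0n.
  by rewrite -EFin_min.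
by exists N%:R; rewrite ?ler0n ?lexx// min_r// leey.
Qed.

Lemma trunc_ge0 N x : (0 <= trunc N x)%R.
Proof. by rewrite mulr_ge0//; have [r /andP[r0 _] ->] := mine_fin N x. Qed.

Lemma trunc_le N x : (trunc N x <= N%:R)%R.
Proof.
rewrite /trunc indicE; have [r /andP[r0 rN] ->] := mine_fin N x.
by case: (_ \in _); rewrite ?mulr1// mulr0.
Qed.

Lemma trunc_le_fun N x : (trunc N x)%:E <= f x.
Proof.
rewrite /trunc indicE; case: (_ \in _); last by rewrite mulr0.
rewrite mulr1 fineK; first by rewrite ge_min lexx.
by have [r _ ->] := mine_fin N x.
Qed.

Lemma trunc_out N x : ~ trunc_dom N x -> trunc N x = 0%R.
Proof. by move=> nx; rewrite /trunc indicE memNset// mulr0. Qed.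

Lemma trunc_dom_le N M : (N <= M)%N -> trunc_dom N `<=` trunc_dom M.
Proof.
move=> NM x /trunc_domP[uN vN xN]; split; first exact: centered_cube_le NM _ xN.
have : (N%:R <= M%:R :> R)%R by rewrite ler_nat.
by move=> NM' [] /=; rewrite lte_fin ltNge (le_trans _ NM').
Qed.

Lemma trunc_homo N M x : (N <= M)%N -> (trunc N x <= trunc M x)%R.
Proof.
move=> NM; have [xN|/trunc_out ->] := pselect (trunc_dom N x); last exact: trunc_ge0.
rewrite /trunc !indicE !mem_set//; last exact: trunc_dom_le xN.
have [r r0 rE] := mine_fin N x; have [s s0 sE] := mine_fin M x.
rewrite rE sE !mulr1 /= -lee_fin -rE -sE; rewrite le_min !ge_min lexx/=.
by rewrite lee_fin ler_nat NM orbT.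
Qed.

Lemma trunc_dom_ex x : exists N, trunc_dom N x.
Proof.
have : (\bigcup_k centered_cube (0 : 'rV[R]_n.+1)%R k) x by rewrite bigcup_centered_cube.
move=> [k _ xk]; pose N := maxn k (maxn (Num.bound (u x)) (Num.bound (v x))).
have bd (r : R) : (r <= (Num.bound r)%:R)%R.
  have [r0|/ltW r0] := leP 0%R r; first by rewrite ltW// archi_boundP.
  exact: le_trans r0 (ler0n _ _).
exists N; split; first by apply: centered_cube_le xk; rewrite leq_maxl.
by case; rewrite /= lte_fin ltNge => /negP; apply; apply: le_trans (bd _) _;
  rewrite ler_nat /N !leq_max leqnn !orbT.
Qed.

(** Where [f] is finite the truncations are eventually constant, which makes
    the passage to the limit inside [Phi] immediate. *)
Lemma trunc_fin x (r : R) : f x = r%:E -> exists N, trunc N x = r.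
Proof.
move=> fr; have [k xk] := trunc_dom_ex x.
exists (maxn k (Num.bound r)); rewrite /trunc indicE mem_set; last first.
  by apply: trunc_dom_le xk; rewrite leq_maxl.
have r0 : (0 <= r)%R by rewrite -lee_fin -fr.
rewrite mulr1 fr min_l//= lee_fin; apply: le_trans (ltW (archi_boundP r0)) _.
by rewrite ler_nat leq_maxr.
Qed.

Lemma trunc_infty x (A : R) : f x = +oo -> exists N, (A <= trunc N x)%R.
Proof.
move=> fr; have [k xk] := trunc_dom_ex x.
exists (maxn k (Num.bound `|A|)); rewrite /trunc indicE mem_set; last first.
  by apply: trunc_dom_le xk; rewrite leq_maxl.
rewrite mulr1 fr min_r ?leey//=; apply: le_trans (ler_norm A) _.
apply: le_trans (ltW (archi_boundP (normr_ge0 A))) _.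
by rewrite ler_nat leq_maxr.
Qed.

(** Monotone convergence along the truncations of [f]. *)
Lemma modular_truncation (Phi : R -> R) (D p : R) (J : \bar R) :
  doubling_young Phi D -> (0 < p)%R ->
  (forall x, 0 < u x)%R -> (forall x, 0 < v x)%R ->
  (forall phi : X -> R, measurable_fun [set: X] phi -> (forall x, 0 <= phi x)%R ->
    (forall x, (phi x)%:E <= f x) ->
    \int[mu]_x (Phi (phi x `^ p * u x) * v x)%:E < +oo ->
    \int[mu]_x (Phi (phi x `^ p * u x) * v x)%:E <= J) ->
  \int[mu]_x (young_ext Phi (f x `^ p * (u x)%:E) * (v x)%:E) <= J.
Proof.
move=> PhiD p0 u0 v0 trJ; have [P0 Pgt0 _ _] := PhiD.
pose g N x := (Phi (trunc N x `^ p * u x) * v x)%:E.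
have arg0 N x : (0 <= trunc N x `^ p * u x)%R.
  by rewrite mulr_ge0 ?powR_ge0// ltW.
have g0 N x : 0 <= g N x.
  by rewrite lee_fin mulr_ge0 ?(ltW (v0 x))//; exact: (doubling_young_ge0 PhiD (arg0 N x)).
have marg N : measurable_fun [set: X] (fun x => (trunc N x `^ p * u x)%:E).
  apply/measurable_EFinP.
  exact: (measurable_funM (measurableT_comp (measurable_powR p) (measurable_trunc N)) mu_).
have mve : measurable_fun [set: X] (EFin \o v) by exact/measurable_EFinP.
have mg N : measurable_fun [set: X] (g N).
  have arg0e x : 0 <= (trunc N x `^ p * u x)%:E by rewrite lee_fin.
  exact: (emeasurable_funM (measurable_young_ext PhiD (marg N) arg0e) mve).
have ndg x : {homo g^~ x : N M / (N <= M)%N >-> N <= M}.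
  move=> N M NM; rewrite lee_fin ler_wpM2r ?(ltW (v0 x))//.
  apply: (doubling_young_le PhiD (arg0 N x)); rewrite ler_wpM2r ?(ltW (u0 x))//.
  apply: ge0_ler_powR; rewrite ?nnegrE ?trunc_ge0 ?(ltW p0)//.
  exact: trunc_homo.
have glim x : limn (g^~ x) = young_ext Phi (f x `^ p * (u x)%:E) * (v x)%:E.
  have cg : cvgn (g^~ x) by apply: ereal_nondecreasing_is_cvgn; exact: ndg.
  have gle N : g N x <= limn (g^~ x).
    by apply: lime_ge => //; exists N => // M /ndg; apply.
  apply/eqP; rewrite eq_le; apply/andP; split.
    apply: lime_le => //; apply: nearW => N; rewrite /g EFinM.
    apply: lee_wpmul2r; first by rewrite lee_fin ltW.
    have := @young_ext_le _ _ _ PhiD (trunc N x `^ p * u x)%:E (f x `^ p * (u x)%:E).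
    apply; rewrite ?lee_fin// EFinM; apply: lee_wpmul2r; first by rewrite lee_fin ltW.
    rewrite -poweR_EFin; apply: gt0_ler_poweR; rewrite ?(ltW p0)// ?in_itv/= ?leey ?andbT//.
      by rewrite lee_fin trunc_ge0.
    exact: trunc_le_fun.
  move fx : (f x) => y; have := f0 x; rewrite fx; case: y fx => [r| |]// fx r0.
    by have [N NE] := trunc_fin fx; apply: le_trans (gle N); rewrite /g NE.
  rewrite poweR_pos_y// gt0_mulye ?lte_fin//= gt0_mulye ?lte_fin// leye_eq.
  apply/eqP/eq_infty => A; have [t0 t0P] := doubling_young_unbounded PhiD (A / v x).
  have [N TN] := trunc_infty (Num.max 0%R (t0 / u x) `^ p^-1)%R fx.
  apply: le_trans (gle N); rewrite lee_fin -ler_pdivrMr//; apply: t0P.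
  rewrite -ler_pdivrMr//.
  apply: (@le_trans _ _ ((Num.max 0%R (t0 / u x) `^ p^-1) `^ p)%R).
    by rewrite -powRrM mulVf ?gt_eqF// powRr1 ?le_max ?lexx// orbT.
  by apply: ge0_ler_powR; rewrite ?nnegrE ?trunc_ge0 ?powR_ge0 ?(ltW p0).
have IgJ N : \int[mu]_x g N x <= J.
  apply: (trJ _ (measurable_trunc N) (trunc_ge0 N) (trunc_le_fun N)).
  pose M : R := (Phi (N%:R `^ p * N%:R) * N%:R)%R.
  have M0 : (0 <= M)%R.
    rewrite mulr_ge0//; apply: (doubling_young_ge0 PhiD).
    by rewrite mulr_ge0// powR_ge0.
  pose Q : set X := centered_cube (0 : 'rV[R]_n.+1)%R N.
  have mQ : measurable Q by exact: measurable_cube.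
  have mind : measurable_fun [set: X] (fun x => (\1_Q x)%:E : \bar R).
    by apply/measurable_EFinP; exact: measurable_indic.
  apply: (@le_lt_trans _ _ (\int[mu]_x (M%:E * (\1_Q x)%:E))); last first.
    have ind0 x : [set: X] x -> 0 <= (\1_Q x)%:E :> \bar R by rewrite lee_fin.
    rewrite (ge0_integralZl mu measurableT mind ind0); last by rewrite lee_fin.
    rewrite (integral_indic mu measurableT mQ) setIT.
    rewrite [X in _ * X](@lebesgue_cube R n); last by rewrite mulr_gt0.
    by rewrite -EFinM ltry.
  apply: ge0_le_integral; first exact: measurableT.
  - by move=> x _; exact: g0.
  - exact: mg.
  - exact: measurable_funeM.
  - move=> x _; rewrite -EFinM lee_fin indicE.
    have [xN|/trunc_out ->] := pselect (trunc_dom N x); last first.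
      by rewrite powR0 ?gt_eqF// mul0r P0 mul0r mulr_ge0.
    have [uN vN xQ] := trunc_domP xN; rewrite mem_set// mulr1.
    apply: ler_pM => //; [exact: (doubling_young_ge0 PhiD (arg0 N x))|exact: ltW|].
    apply: (doubling_young_le PhiD (arg0 N x)); apply: ler_pM; rewrite ?powR_ge0 ?(ltW (u0 x))//.
    by apply: ge0_ler_powR; rewrite ?nnegrE ?trunc_ge0 ?trunc_le ?(ltW p0).
under eq_integral do rewrite -glim.
rewrite (monotone_convergence mu measurableT mg (fun N x _ => g0 N x) (fun x _ => ndg x)).
apply: lime_le; last exact: nearW.
apply: ereal_nondecreasing_is_cvgn => N M NM.
apply: ge0_le_integral; first exact: measurableT.
- by move=> x _; exact: g0.
- exact: mg.
- exact: mg.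
- by move=> x _; exact: ndg.
Qed.

End Truncation.

(** * Changing the exponent *)

Section Extrapolation.
Context (R : realType) (n : nat).
Local Notation X := (euclidean R n).
Local Notation mu := (@lebesgue R n).
Local Notation pairs := (set ((X -> \bar R) * (X -> \bar R))).

Lemma modular_pair (Phi : R -> R) (D : R) (u v : X -> R) (p q K Kv C : R)
    (f g : X -> \bar R) :
  doubling_young Phi D ->
  measurable_fun [set: X] u -> (forall x, 0 < u x)%R ->
  (1 < q)%R -> muckenhoupt q Kv v -> (1 <= K)%R ->
  modular_maximal_bound Phi u v K ->
  measurable_fun [set: X] f -> (forall x, 0 <= f x) ->
  measurable_fun [set: X] g -> (forall x, 0 <= g x) ->
  (0 < p)%R -> (0 < C)%R ->
  (forall w, muckenhoupt q (2 * K * Kv) w ->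
    \int[mu]_x (f x `^ p * (w x)%:E) <= C%:E * \int[mu]_x (g x `^ p * (w x)%:E)) ->
  \int[mu]_x (young_ext Phi (f x `^ p * (u x)%:E) * (v x)%:E) <=
  \int[mu]_x (young_ext Phi ((4 * C)%:E * (g x `^ p * (u x)%:E)) * (v x)%:E).
Proof.
move=> PhiD mu_ u0 q1 Mv K1 MK mf f0 mg g0 p0 C0 fg; have [mv v0 _] := Mv.
apply: (modular_truncation mu_ mv mf f0 PhiD p0 u0 v0) => phi mphi phi0 phif Ioo.
exact: (modular_absorption PhiD mu_ u0 q1 Mv K1 MK mf f0 mg g0 p0 C0 fg mphi phi0 phif Ioo).
Qed.

(** Assumption (H) at the exponent [p], with norms raised to the power [p]
    and constants uniform on each class [A_q], [q > 1]. *)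
Definition muckenhoupt_extrapolates (p : R) (F : pairs) :=
  forall q K : R, (1 < q)%R -> exists2 C : R, (0 < C)%R &
    forall w, muckenhoupt q K w -> forall f g, F (f, g) ->
    \int[mu]_x (f x `^ p * (w x)%:E) <= C%:E * \int[mu]_x (g x `^ p * (w x)%:E).

Lemma modular_extrapolation (Phi : R -> R) (D : R) (u v : X -> R)
    (p q K Kv : R) (F : pairs) :
  doubling_young Phi D ->
  measurable_fun [set: X] u -> (forall x, 0 < u x)%R ->
  (1 < q)%R -> muckenhoupt q Kv v -> (1 <= K)%R ->
  modular_maximal_bound Phi u v K ->
  extrapolation_family F -> (0 < p)%R -> muckenhoupt_extrapolates p F ->
  exists2 C : R, (0 < C)%R & forall f g, F (f, g) ->
    \int[mu]_x (young_ext Phi (f x `^ p * (u x)%:E) * (v x)%:E) <=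
    C%:E * \int[mu]_x (young_ext Phi (g x `^ p * (u x)%:E) * (v x)%:E).
Proof.
move=> PhiD mu_ u0 q1 Mv K1 MK Ffam p0 ext; have [mv v0 _] := Mv.
have [C C0 CP] := ext q (2 * K * Kv)%R q1.
have C4 : (0 < 4 * C)%R by rewrite mulr_gt0.
have [C' C'0 C'P] := young_ext_scale PhiD C4.
exists C' => // f g Ffg; have [mf mg f0 g0] := Ffam _ _ Ffg.
have mve : measurable_fun [set: X] (EFin \o v) by exact/measurable_EFinP.
have mue : measurable_fun [set: X] (EFin \o u) by exact/measurable_EFinP.
have ve0 x : 0 <= (v x)%:E by rewrite lee_fin ltW.
have ue0 x : 0 <= (u x)%:E by rewrite lee_fin ltW.
apply: le_trans (modular_pair PhiD mu_ u0 q1 Mv K1 MK mf f0 mg g0 p0 C0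
  (fun w Mw => CP w Mw f g Ffg)) _.
have mgu := emeasurable_funM (measurableT_comp (measurable_poweR p) mg) mue.
have gu0 x : 0 <= g x `^ p * (u x)%:E by rewrite mule_ge0 ?poweR_ge0.
have Cgu0 x : 0 <= (4 * C)%:E * (g x `^ p * (u x)%:E).
  by rewrite mule_ge0// lee_fin ltW.
have mE := emeasurable_funM (measurable_young_ext PhiD mgu gu0) mve.
have mCE := emeasurable_funM
  (measurable_young_ext PhiD (measurable_funeM (4 * C)%:E mgu) Cgu0) mve.
have E0 x : [set: X] x -> 0 <= young_ext Phi (g x `^ p * (u x)%:E) * (v x)%:E.
  by move=> _; rewrite mule_ge0//; exact: (young_ext_ge0 PhiD (gu0 x)).
rewrite -(ge0_integralZl mu measurableT mE E0); last by rewrite lee_fin ltW.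
apply: ge0_le_integral; first exact: measurableT.
- by move=> x _; rewrite mule_ge0//; exact: (young_ext_ge0 PhiD (Cgu0 x)).
- exact: mCE.
- exact: (measurable_funeM _ mE).
- move=> x _; rewrite [leRHS]muleA; apply: lee_wpmul2r => //.
  exact: (C'P _ (gu0 x)).
Qed.

Definition square (s : R) : R := (s * s)%R.

Lemma doubling_young_square : doubling_young square 4.
Proof.
split; rewrite /square.
- by rewrite mulr0.
- by move=> s s0; rewrite mulr_gt0.
- by move=> s t s0 st; rewrite !mulfK ?gt_eqF// (lt_le_trans s0).
- by move=> t t0; rewrite le_eqVlt; apply/orP; left; apply/eqP; ring.
Qed.

Lemma young_ext_square (t : \bar R) : 0 <= t -> young_ext square t = t * t.
Proof. by case: t => [r| |]//= _; rewrite mulyy. Qed.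

Lemma young_compl_square (t : \bar R) : 0 <= t ->
  young_compl square t = (4^-1)%:E * (t * t).
Proof.
case: t => [r| |]// r0; last by rewrite young_compl_pinfty mulyy gt0_muley// lte_fin invr_gt0.
rewrite lee_fin in r0; rewrite -!EFinM; apply/eqP; rewrite eq_le; apply/andP; split.
  apply: ge_ereal_sup => _ [s _ <-]; rewrite -EFinM -EFinB lee_fin /square.
  by have := sqr_ge0 (s - r / 2)%R; rewrite expr2; lra.
move: r0; rewrite [(0 <= r)%R]le_eqVlt => /predU1P[<-|r0].
  rewrite !mulr0; apply: young_compl_ge0 => // e e0.
  exact: (doubling_young_small doubling_young_square).
apply: ereal_sup_ubound; exists (r / 2)%R; first by rewrite /= divr_gt0.
by rewrite -EFinM -EFinB /square; congr _%:E; field.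
Qed.

Lemma integral_young_compl_square (w : X -> R) (k : X -> \bar R) :
  measurable_fun [set: X] w -> (forall x, 0 < w x)%R ->
  measurable_fun [set: X] k -> (forall x, 0 <= k x) ->
  \int[mu]_x (young_compl square (k x * (1^-1)%:E) * (w x)%:E) =
  (4^-1)%:E * \int[mu]_x (k x * k x * (w x)%:E).
Proof.
move=> mw w0 mk k0.
have mwe : measurable_fun [set: X] (EFin \o w) by exact/measurable_EFinP.
have mkkw := emeasurable_funM (emeasurable_funM mk mk) mwe.
have kkw0 x : [set: X] x -> 0 <= k x * k x * (w x)%:E.
  by move=> _; rewrite !mule_ge0// lee_fin ltW.
rewrite -(ge0_integralZl mu measurableT mkkw kkw0); last first.
  by rewrite lee_fin invr_ge0.
by apply: eq_integral => x _; rewrite invr1 mule1 young_compl_square// -muleA.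
Qed.

(** For [Phi(s) = s^2], whose complementary function is [t^2 / 4], and
    [u = 1], assumption (M) is the [L^2(w)] bound for [M_w]. *)
Lemma square_maximal_bound (q Kw : R) (w : X -> R) :
  (1 < q)%R -> muckenhoupt q Kw w ->
  modular_maximal_bound square (fun=> 1%R) w
    (Num.max 1%R (32 * (Kw * (3 ^+ n.+1) `^ q)))%R.
Proof.
move=> q1 Mw g mg g0; have [mw w0 _] := Mw.
set D := (Kw * _)%R; have dw := muckenhoupt_doubling q1 Mw; rewrite -/D in dw.
have mwe : measurable_fun [set: X] (EFin \o w) by exact/measurable_EFinP.
have we0 x : 0 <= (EFin \o w) x by rewrite lee_fin ltW.
have mM := measurable_weighted_maximal (EFin \o w) g.
have M0 x : 0 <= weighted_maximal (EFin \o w) g x by exact: weighted_maximal_ge0.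
rewrite (integral_young_compl_square mw w0 mM M0).
rewrite (integral_young_compl_square mw w0 mg g0) muleCA; apply: lee_wpmul2l.
  by rewrite lee_fin invr_ge0.
have I0 : 0 <= \int[mu]_x (g x * g x * (w x)%:E).
  by apply: integral_ge0 => x _; rewrite !mule_ge0//; exact: we0.
have D0 : (0 <= D)%R.
  have [_ _ wQ /(_ 0%R 1%R ltr01)] := dw.
  have c1 : cubes (cube (0 : 'rV[R]_n.+1) 1%R) by exists 0%R, 1%R.
  have c3 : cubes (cube (0 - const_mx 1 : 'rV[R]_n.+1)%R (3 * 1%R)).
    by exists (0 - const_mx 1)%R, (3 * 1)%R; rewrite mulr_gt0.
  have /andP[W0 _] := wQ _ c1; have /andP[W30 _] := wQ _ c3.
  move=> /(lt_le_trans W30); rewrite pmule_lgt0// lte_fin => /ltW; exact.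
apply: le_trans (strong_type_maximal D0 dw mg g0) _.
by apply: lee_wpmul2r => //; rewrite lee_fin le_max lexx orbT.
Qed.

Lemma poweR_double (x : \bar R) (p : R) : (0 < p)%R -> 0 <= x ->
  x `^ p * x `^ p = x `^ (2 * p).
Proof.
move=> p0 x0; rewrite (_ : 2 * p = p + p)%R; last by ring.
by rewrite poweRD// add_neq0_poweRD_def// gt_eqF// addr_gt0.
Qed.

(** Modular extrapolation for [Phi(s) = s^2], [u = 1], [v = w]. *)
Lemma extrapolate_double (p : R) (F : pairs) : (0 < p)%R ->
  extrapolation_family F -> muckenhoupt_extrapolates p F ->
  muckenhoupt_extrapolates (2 * p) F.
Proof.
move=> p0 Ffam ext q K q1.
pose K0 : R := Num.max 1%R (32 * (K * (3 ^+ n.+1) `^ q))%R.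
have [C C0 CP] := ext q (2 * K0 * K)%R q1.
have C4 : (0 < 4 * C)%R by rewrite mulr_gt0.
have [C' C'0 C'P] := young_ext_scale doubling_young_square C4.
exists C' => // w Mw f g Ffg; have [mf mg f0 g0] := Ffam _ _ Ffg.
have [mw w0 _] := Mw.
have we0 x : 0 <= (w x)%:E by rewrite lee_fin ltW.
have mwe : measurable_fun [set: X] (EFin \o w) by exact/measurable_EFinP.
have m1 : measurable_fun [set: X] ((fun=> 1%R) : X -> R) by exact: measurable_cst.
have K01 : (1 <= K0)%R by rewrite le_max lexx.
have := modular_pair doubling_young_square m1 (fun=> ltr01) q1 Mw K01
  (square_maximal_bound q1 Mw) mf f0 mg g0 p0 C0 (fun w Mw' => CP w Mw' f g Ffg).
have sqf : \int[mu]_x (young_ext square (f x `^ p * 1%:E) * (w x)%:E) =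
    \int[mu]_x (f x `^ (2 * p) * (w x)%:E).
  apply: eq_integral => x _; rewrite mule1 young_ext_square ?poweR_ge0//.
  by rewrite poweR_double.
rewrite sqf => /le_trans; apply.
have mgp : measurable_fun [set: X] (fun x => g x `^ (2 * p)).
  exact: measurableT_comp (measurable_poweR _) mg.
have mgpw := emeasurable_funM mgp mwe.
have gpw0 x : [set: X] x -> 0 <= g x `^ (2 * p) * (w x)%:E.
  by move=> _; rewrite mule_ge0 ?poweR_ge0.
rewrite -(ge0_integralZl mu measurableT mgpw gpw0); last by rewrite lee_fin ltW.
have mg1 : measurable_fun [set: X] (fun x => (4 * C)%:E * (g x `^ p * 1%:E)).
  apply: measurable_funeM; under eq_fun do rewrite mule1.
  exact: measurableT_comp (measurable_poweR _) mg.
have g10 x : 0 <= (4 * C)%:E * (g x `^ p * 1%:E).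
  by rewrite mule1 mule_ge0 ?poweR_ge0// lee_fin ltW.
apply: ge0_le_integral; first exact: measurableT.
- move=> x _; rewrite mule_ge0//.
  exact: (young_ext_ge0 doubling_young_square (g10 x)).
- exact: (emeasurable_funM (measurable_young_ext doubling_young_square mg1 g10) mwe).
- exact: measurable_funeM mgpw.
- move=> x _; rewrite [leRHS]muleA; apply: lee_wpmul2r => //.
  apply: le_trans (C'P _ _) _; first by rewrite mule1 poweR_ge0.
  by rewrite mule1 young_ext_square ?poweR_ge0// poweR_double.
Qed.

End Extrapolation.

Section ExtrapolationDown.
Context (R : realType) (n : nat).
Local Notation X := (euclidean R n).
Local Notation mu := (@lebesgue R n).
Local Notation pairs := (set ((X -> \bar R) * (X -> \bar R))).

(** The power of [G] is chosen to cancel in the product of the two factors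
    to which Hoelder's inequality will be applied. *)
Lemma down_split (p r G w : R) (y : \bar R) : (0 < r)%R -> (r < p)%R ->
  (0 < G)%R -> (0 < w)%R -> 0 <= y ->
  y `^ r * w%:E =
  (y `^ p * (G `^ (- (2 * (p - r) / r)) * w)%:E) `^ (r / p) *
  (G * G * w)%:E `^ (1 - r / p).
Proof.
move=> r0 rp G0 w0; have p0 := lt_trans r0 rp.
have rp0 : (0 < r / p)%R by rewrite divr_gt0.
have Gw : (0 < G `^ (- (2 * (p - r) / r)) * w)%R by rewrite mulr_gt0// powR_gt0.
case: y => [y| |]// y0; last first.
  rewrite !poweR_pos_y// !gt0_mulye ?lte_fin// poweR_pos_y// gt0_mulye//.
  by rewrite poweR_EFin lte_fin powR_gt0// !mulr_gt0.
rewrite /= -!EFinM; congr EFin.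
rewrite lee_fin in y0.
rewrite [((y `^ p * _) `^ _)%R]powRM ?powR_ge0 ?(ltW Gw)// -powRrM (_ : p * (r / p) = r)%R; last first.
  by field; rewrite gt_eqF.
rewrite -[RHS]mulrA; congr (_ * _)%R.
have [a ->] := gt0_expR G0; have [b ->] := gt0_expR w0.
rewrite -!expRM -!expRD -!expRM -!expRD; congr expR; field.
by rewrite !gt_eqF.
Qed.

(** Writing [y^p = y^r y^(p-r)], the second factor is bounded by a power of
    [c G] and cancels the negative power of [G]. *)
Lemma down_majorant (p r c G : R) (y : \bar R) : (0 < r)%R -> (r < p)%R ->
  (0 < c)%R -> (0 < G)%R -> 0 <= y -> y `^ (r / 2) <= (c * G)%:E ->
  y `^ p * (G `^ (- (2 * (p - r) / r)))%:E <=
  (c `^ (2 * (p - r) / r))%:E * y `^ r.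
Proof.
move=> r0 rp c0 G0; have p0 := lt_trans r0 rp.
have r20 : (0 < r / 2)%R by rewrite divr_gt0.
case: y => [y| |]// y0; last by rewrite poweR_pos_y.
rewrite !poweR_EFin -!EFinM !lee_fin => yG; rewrite lee_fin in y0.
move: y0; rewrite [(0 <= y)%R]le_eqVlt => /predU1P[<-|y0].
  by rewrite !powR0 ?gt_eqF// mul0r mulr0.
move: yG; have [a ->] := gt0_expR y0; have [b ->] := gt0_expR G0.
have [d ->] := gt0_expR c0.
rewrite -!expRM -!expRD !ler_expR => h.
set s := (2 * (p - r) / r)%R.
have s0 : (0 < s)%R by rewrite /s divr_gt0// mulr_gt0// subr_gt0.
have -> : (a * p = a * (r / 2) * s + a * r)%R by rewrite /s; field; rewrite gt_eqF.
have : (a * (r / 2) * s <= (d + b) * s)%R by rewrite (ler_pM2r s0).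
by lra.
Qed.

(** Let [G] be the majorant of [h = g^(r/2)], which is square integrable with
    respect to [w], and [W = G^(-s) w] with [s = 2 (p - r) / r].  Then
    [int f^p W <= C int g^p W <= C 2^s int g^r w], and Hoelder's inequality
    between [f^p W] and [G^2 w] gives back [f^r w]. *)
Lemma extrapolate_down (p r : R) (F : pairs) : (0 < r)%R -> (r < p)%R ->
  extrapolation_family F -> muckenhoupt_extrapolates p F ->
  muckenhoupt_extrapolates r F.
Proof.
move=> r0 rp Ffam ext q K q1; have p0 := lt_trans r0 rp.
pose K0 : R := Num.max 1%R (32 * (K * (3 ^+ n.+1) `^ q))%R.
have K01 : (1 <= K0)%R by rewrite le_max lexx.
have K20 : (0 < 2 * K0)%R by rewrite mulr_gt0// (lt_le_trans ltr01).
pose s := (2 * (p - r) / r)%R.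
have s0 : (0 < s)%R by rewrite /s divr_gt0// mulr_gt0// subr_gt0.
have q'1 : (1 < (1 + s) * q)%R by nra.
have [C0 C00 C0P] := ext q K q1.
have [C1 C10 C1P] := ext _ ((2 * K0) `^ s * K `^ (1 + s))%R q'1.
have t01 : (0 < r / p < 1)%R by rewrite divr_gt0//= ltr_pdivrMr// mul1r.
have [t0 t1] := andP t01.
exists ((C1 * 2 `^ s) `^ (r / p))%R; first by rewrite powR_gt0// mulr_gt0// powR_gt0.
move=> w Mw f g Ffg; have [mf mg f0 g0] := Ffam _ _ Ffg.
have [mw w0 _] := Mw; have [_ _ wvol _] := muckenhoupt_doubling q1 Mw.
have we0 x : 0 <= (w x)%:E by rewrite lee_fin ltW.
have mwe : measurable_fun [set: X] (EFin \o w) by exact/measurable_EFinP.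
have mpow (k : X -> \bar R) (e : R) : measurable_fun [set: X] k ->
    measurable_fun [set: X] (fun x => k x `^ e).
  by move=> mk; exact: measurableT_comp (measurable_poweR _) mk.
have mpw (k : X -> \bar R) (e : R) : measurable_fun [set: X] k ->
    measurable_fun [set: X] (fun x => k x `^ e * (w x)%:E).
  by move=> mk; exact: (emeasurable_funM (mpow _ _ mk) mwe).
have pw0 (k : X -> \bar R) (e : R) x : 0 <= k x `^ e * (w x)%:E.
  by rewrite mule_ge0 ?poweR_ge0.
set J := \int[mu]_x (g x `^ r * (w x)%:E).
have J0 : 0 <= J by apply: integral_ge0 => x _; exact: pw0.
(* if [g] vanishes almost everywhere, so does [f], and there is no
   positive majorant to use *)
have [Jz|Jnz] := eqVneq J 0.
  have gz : ae_eq mu [set: X] (fun x => g x `^ r * (w x)%:E) (cst 0).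
    exact: (integral_eq0_ae measurableT (mpw _ _ mg) (fun x _ => pw0 g r x) Jz).
  have powz (k : X -> \bar R) (e e' : R) x : (0 < e')%R -> (0 < e)%R ->
      (forall y, 0 <= k y) -> k x `^ e * (w x)%:E = 0 -> k x `^ e' * (w x)%:E = 0.
    move=> e'0 e0 k0 /eqP; rewrite mule_eq0 eqe (gt_eqF (w0 x)) orbF => /eqP.
    by move=> /(poweR_eq0_eq0 (k0 x)) ->; rewrite poweR_EFin powR0 ?gt_eqF// mul0e.
  have gpz : \int[mu]_x (g x `^ p * (w x)%:E) = 0.
    apply: (ae_eq0_integral measurableT (mpw _ _ mg)).
    by apply: filterS gz => x /[apply] h; exact: (powz g r p x p0 r0 g0 h).
  have fpz : \int[mu]_x (f x `^ p * (w x)%:E) = 0.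
    apply/eqP; rewrite eq_le integral_ge0 ?andbT; last by move=> x _; exact: pw0.
    by apply: le_trans (C0P w Mw f g Ffg) _; rewrite gpz mule0.
  have fz : ae_eq mu [set: X] (fun x => f x `^ p * (w x)%:E) (cst 0).
    exact: (integral_eq0_ae measurableT (mpw _ _ mf) (fun x _ => pw0 f p x) fpz).
  rewrite Jz mule0 (ae_eq0_integral measurableT (mpw f r mf))//.
  by apply: filterS fz => x /[apply] h; exact: (powz f p r x r0 p0 f0 h).
have Jgt0 : 0 < J by rewrite lt0e Jnz.
have [Jy|Jny] := eqVneq J +oo.
  by rewrite Jy gt0_muley ?leey// lte_fin powR_gt0// mulr_gt0// powR_gt0.
have Joo : J < +oo by rewrite ltey.
pose h x := g x `^ (r / 2).
have mh : measurable_fun [set: X] h by exact: mpow.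
have h0 x : 0 <= h x by exact: poweR_ge0.
have hh x : h x * h x = g x `^ r.
  by rewrite /h poweR_double ?divr_gt0//; congr (_ `^ _); field.
have m1 : measurable_fun [set: X] ((fun=> 1%R) : X -> R) by exact: measurable_cst.
have [H [mH hH H0 HM HI]] := rubio_de_francia
  (doubling_young_small (doubling_young_square R))
  (fun s s0 => doubling_young_ge0 (doubling_young_square R) (ltW s0))
  m1 (fun=> ltr01) mw w0 wvol K01 (square_maximal_bound q1 Mw) mh h0.
have mHHw : measurable_fun [set: X] (fun x => H x * H x * (w x)%:E).
  exact: (emeasurable_funM (emeasurable_funM mH mH) mwe).
have HHw0 x : 0 <= H x * H x * (w x)%:E by rewrite !mule_ge0.
have HJ : \int[mu]_x (H x * H x * (w x)%:E) <= J.
  move: HI; rewrite (integral_young_compl_square mw w0 mH H0).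
  rewrite (integral_young_compl_square mw w0 mh h0).
  rewrite lee_pmul2l ?lte_fin ?invr_gt0//.
  have -> // : \int[mu]_x (h x * h x * (w x)%:E) = J.
  by apply: eq_integral => x _; rewrite hh.
have Hoo : {ae mu, forall x, H x < +oo}.
  have iH : mu.-integrable [set: X] (fun x => H x * H x * (w x)%:E).
    apply/integrableP; split=> //; under eq_integral do rewrite gee0_abs//.
    exact: le_lt_trans HJ Joo.
  apply: filterS (integrable_ae measurableT iH) => x /(_ Logic.I).
  rewrite ltey; apply: contraTN => /eqP ->.
  by rewrite mulyy gt0_mulye ?lte_fin.
have mHw : measurable_fun [set: X] (fun x => H x * (w x)%:E).
  exact: (emeasurable_funM mH mwe).
have Hw0 x : 0 <= H x * (w x)%:E by rewrite mule_ge0.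
have HwI : 0 < \int[mu]_x (H x * (w x)%:E).
  rewrite lt0e integral_ge0// andbT; apply/eqP => HI0.
  have Hz := integral_eq0_ae measurableT mHw (fun x _ => Hw0 x) HI0.
  move/eqP: Jnz; apply; apply: (ae_eq0_integral measurableT (mpw _ _ mg)).
  apply: filterS Hz => x /[apply] /eqP; rewrite mule_eq0 eqe (gt_eqF (w0 x)) orbF.
  move=> /eqP Hx; have := hH x; rewrite Hx mule0 => hx.
  have hx0 : h x = 0 by apply/eqP; rewrite eq_le hx h0.
  by rewrite -hh hx0 !mul0e.
have [G GA1 HG] := maximal_relative_A1 K20 mw w0 wvol mH H0 HM HwI Hoo.
have [mG G0 _] := GA1.
pose W x := (G x `^ (- s) * w x)%R.
have MW : muckenhoupt ((1 + s) * q) ((2 * K0) `^ s * K `^ (1 + s)) W.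
  exact: (relative_A1_powN q1 K20 s0 Mw GA1).
have [mW W0 _] := MW.
have mWe : measurable_fun [set: X] (EFin \o W) by exact/measurable_EFinP.
have mfW : measurable_fun [set: X] (fun x => f x `^ p * (W x)%:E).
  exact: (emeasurable_funM (mpow _ _ mf) mWe).
have mgW : measurable_fun [set: X] (fun x => g x `^ p * (W x)%:E).
  exact: (emeasurable_funM (mpow _ _ mg) mWe).
have mGGw : measurable_fun [set: X] (fun x => (G x * G x * w x)%:E).
  apply/measurable_EFinP.
  exact: (measurable_funM (measurable_funM mG mG) mw).
have gW : \int[mu]_x (g x `^ p * (W x)%:E) <= (2 `^ s)%:E * J.
  rewrite -(ge0_integralZl mu measurableT (mpw g r mg) (fun x _ => pw0 g r x)); last first.
    by rewrite lee_fin powR_ge0.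
  apply: (ae_ge0_le_integral measurableT).
  - by move=> x _; rewrite mule_ge0 ?poweR_ge0// lee_fin ltW.
  - exact: mgW.
  - by move=> x _; rewrite mule_ge0 ?pw0// lee_fin powR_ge0.
  - exact: (measurable_funeM _ (mpw g r mg)).
  - apply: filterS HG => x HGx _; rewrite /W EFinM !muleA; apply: lee_wpmul2r => //.
    apply: down_majorant => //.
    by have := hH x; rewrite HGx -EFinM.
have GJ : \int[mu]_x (G x * G x * w x)%:E <= J.
  apply: le_trans HJ; rewrite le_eqVlt; apply/orP; left; apply/eqP.
  apply: (@ae_eq_integral _ _ _ mu _ _ _ measurableT) => //.
  by apply: filterS HG => x -> _; rewrite !EFinM.
have fW : \int[mu]_x (f x `^ p * (W x)%:E) <= (C1 * 2 `^ s)%:E * J.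
  apply: le_trans (C1P W MW f g Ffg) _; rewrite EFinM -muleA.
  by apply: lee_wpmul2l => //; rewrite lee_fin ltW.
have -> : \int[mu]_x (f x `^ r * (w x)%:E) =
    \int[mu]_x ((f x `^ p * (W x)%:E) `^ (r / p) *
                (G x * G x * w x)%:E `^ (1 - r / p)).
  by apply: eq_integral => x _; exact: down_split.
have fW0 x : [set: X] x -> 0 <= f x `^ p * (W x)%:E.
  by move=> _; rewrite mule_ge0 ?poweR_ge0// lee_fin ltW.
have GGw0 x : [set: X] x -> 0 <= (G x * G x * w x)%:E.
  by move=> _; rewrite lee_fin !mulr_ge0// ltW.
apply: le_trans (@integral_holder _ _ _ mu _ _ _ _ measurableT mfW mGGw fW0 GGw0 t01) _.
have pow_le (e : R) (a b : \bar R) : (0 <= e)%R -> 0 <= a -> a <= b -> a `^ e <= b `^ e.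
  move=> e0 a0 ab; apply: gt0_ler_poweR => //; rewrite in_itv/= leey andbT//.
  exact: le_trans ab.
apply: (@le_trans _ _ (((C1 * 2 `^ s)%:E * J) `^ (r / p) * J `^ (1 - r / p))).
  apply: lee_pmul; rewrite ?poweR_ge0//.
    by apply: pow_le => //; [exact: ltW|exact: integral_ge0].
  by apply: pow_le => //; [rewrite subr_ge0 ltW|exact: integral_ge0].
rewrite poweRM//; last by rewrite lee_fin mulr_ge0 ?powR_ge0// ltW.
rewrite poweR_EFin -muleA; apply: lee_wpmul2l; first by rewrite lee_fin powR_ge0.
rewrite -poweRD; last by rewrite add_neq0_poweRD_def// addrC subrK oner_eq0.
by rewrite addrC subrK poweRe1.
Qed.

(** The predicate [J] covers finite and infinite subfamilies at once;
    repetitions are allowed. *)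
Definition vector_family (q : R) (F : pairs) : pairs :=
  [set ab | exists (J : pred nat) (f g : nat -> X -> \bar R),
    [/\ (forall j, J j -> F (f j, g j)),
      ab.1 = (fun x => (\sum_(j <oo | J j) f j x `^ q) `^ q^-1) &
      ab.2 = (fun x => (\sum_(j <oo | J j) g j x `^ q) `^ q^-1)]].

Lemma vector_family_extrapolation (q : R) (F : pairs) :
  extrapolation_family F -> extrapolation_family (vector_family q F).
Proof.
move=> Ffam _ _ [J [f [g [FJ /= -> ->]]]].
have mser (k : nat -> X -> \bar R) :
    (forall j, J j -> measurable_fun [set: X] (k j)) ->
    measurable_fun [set: X] (fun x => (\sum_(j <oo | J j) k j x `^ q) `^ q^-1).
  move=> mk; apply: measurableT_comp (measurable_poweR _) _.
  apply: ge0_emeasurable_sum => j; first by move=> x _ _; exact: poweR_ge0.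
  by move=> /mk; exact: measurableT_comp (measurable_poweR _).
split; [apply: mser|apply: mser| |].
- by move=> j /FJ /Ffam[].
- by move=> j /FJ /Ffam[].
- by move=> x; exact: poweR_ge0.
- by move=> x; exact: poweR_ge0.
Qed.

Lemma extrapolate_vector (q : R) (F : pairs) : (0 < q)%R ->
  extrapolation_family F -> muckenhoupt_extrapolates q F ->
  muckenhoupt_extrapolates q (vector_family q F).
Proof.
move=> q0 Ffam ext r K r1; have [C C0 CP] := ext r K r1; exists C => //.
move=> w Mw _ _ [J [f [g [FJ /= -> ->]]]]; have [mw w0 _] := Mw.
have we0 x : 0 <= (w x)%:E by rewrite lee_fin ltW.
have mwe : measurable_fun [set: X] (EFin \o w) by exact/measurable_EFinP.
have serE (k : nat -> X -> \bar R) :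
    (forall j, J j -> measurable_fun [set: X] (k j)) ->
    \int[mu]_x (((\sum_(j <oo | J j) k j x `^ q) `^ q^-1) `^ q * (w x)%:E) =
    \sum_(j <oo | J j) \int[mu]_x (k j x `^ q * (w x)%:E).
  move=> mk; pose t j x := if J j then k j x `^ q * (w x)%:E else 0.
  have t0 j x : 0 <= t j x.
    by rewrite /t; case: ifP => // _; rewrite mule_ge0 ?poweR_ge0.
  have mt j : measurable_fun [set: X] (t j).
    rewrite /t; case: (boolP (J j)) => [Jj|_]; last exact: measurable_cst.
    exact: (emeasurable_funM (measurableT_comp (measurable_poweR _) (mk j Jj)) mwe).
  transitivity (\int[mu]_x \sum_(j <oo) t j x).
    apply: eq_integral => x _; rewrite -poweRrM mulVf ?gt_eqF// poweRe1; last first.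
      by apply: nneseries_ge0 => j _ _; exact: poweR_ge0.
    rewrite eseries_mkcond -ge0_nneseriesZr//; last first.
      by move=> j; case: ifP => // _; exact: poweR_ge0.
    by apply: eq_eseriesr => j _; rewrite /t; case: ifP => // _; rewrite mul0e.
  rewrite (integral_nneseries mu measurableT mt (fun j x _ => t0 j x)).
  rewrite [RHS]eseries_mkcond; apply: eq_eseriesr => j _.
  by rewrite /t; case: ifP => // _; exact: integral0.
rewrite !serE; [|by move=> j /FJ /Ffam[]..].
rewrite -nneseriesZl; last first.
  by move=> j _; apply: integral_ge0 => x _; rewrite mule_ge0 ?poweR_ge0.
apply: lee_nneseries => j.
  by move=> _ _; apply: integral_ge0 => x _; rewrite mule_ge0 ?poweR_ge0.
by move=> Jj; exact: CP w Mw _ _ (FJ _ Jj).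
Qed.

(** Double the exponent until it exceeds [r], then descend to [r]. *)
Lemma extrapolate_all (p r : R) (F : pairs) : (0 < p)%R -> (0 < r)%R ->
  extrapolation_family F -> muckenhoupt_extrapolates p F ->
  muckenhoupt_extrapolates r F.
Proof.
move=> p0 r0 Ffam ext.
have up m : muckenhoupt_extrapolates (2 ^+ m * p) F.
  elim: m => [|m IH]; first by rewrite mul1r.
  by rewrite exprS -mulrA; apply: extrapolate_double => //; rewrite mulr_gt0// exprn_gt0.
apply: (extrapolate_down r0 _ Ffam (up (Num.bound (r / p)))).
rewrite -ltr_pdivrMr//; apply: (@lt_trans _ _ (Num.bound (r / p))%:R%R).
  by rewrite archi_boundP// divr_ge0// ltW.
by rewrite -natrX ltr_nat ltn_expl.
Qed.

End ExtrapolationDown.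

(** * From weights to positive representatives *)

Section Transfer.
Context (R : realType) (n : nat).
Local Notation X := (euclidean R n).
Local Notation mu := (@lebesgue R n).
Local Notation pairs := (set ((X -> \bar R) * (X -> \bar R))).

Lemma lebesgue_negligible_measurable (A : set X) : mu.-negligible A -> measurable A.
Proof. exact: measure_is_complete_caratheodory. Qed.

(** Lebesgue measure is complete. *)
Lemma measurable_fun_ae_eq (f g : X -> \bar R) : measurable_fun [set: X] g ->
  {ae mu, forall x, f x = g x} -> measurable_fun [set: X] f.
Proof.
move=> mg fg _ B mB; rewrite setTI.
pose N := [set x | f x <> g x].
have Nneg : mu.-negligible N by [].
have mN : measurable N by exact: lebesgue_negligible_measurable.
have -> : f @^-1` B = ((g @^-1` B) `\` N) `|` (f @^-1` B `&` N).
  apply/seteqP; split=> [x fB|x [[gB /contrapT fgx]|[]//]].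
    have [fgx|fgx] := pselect (f x = g x); last by right.
    by left; split; [rewrite /= -fgx|apply].
  by rewrite /= fgx.
apply: measurableU.
  by apply: measurableD => //; rewrite -[X in measurable X]setTI; exact: mg.
apply: lebesgue_negligible_measurable.
by apply: negligibleS Nneg; exact: subIsetr.
Qed.

(** Meant for compositions [f] with [Phi] whose values are uncontrolled on
    the null set where a weight is not positive and finite; completeness makes
    them measurable. *)
Lemma ae_eq_integral_complete (f g : X -> \bar R) : measurable_fun [set: X] g ->
  {ae mu, forall x, f x = g x} -> \int[mu]_x f x = \int[mu]_x g x.
Proof.
move=> mg fg; apply: (@ae_eq_integral _ _ _ mu _ _ _ measurableT) => //.
  exact: measurable_fun_ae_eq mg fg.
by apply: filterS fg.
Qed.

Lemma weighted_maximal_ae_eq (v g : X -> \bar R) (v' : X -> R) x :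
  measurable_fun [set: X] v -> measurable_fun [set: X] v' ->
  measurable_fun [set: X] g -> {ae mu, forall x, v x = (v' x)%:E} ->
  weighted_maximal v g x = weighted_maximal (EFin \o v') g x.
Proof.
move=> mv mv' mg vv'; congr ereal_sup.
have mve : measurable_fun [set: X] (EFin \o v') by exact/measurable_EFinP.
have mga : measurable_fun [set: X] (fun y => `|g y|).
  exact: measurableT_comp (@abse_measurable R _) mg.
apply: eq_imagel => _ [[a [l [l0 ->]]] _]; congr (_^-1 * _).
- apply: (@ae_eq_integral _ _ _ mu _ _ _ (measurable_cube a l)).
  + exact: measurable_funTS mv.
  + exact: measurable_funTS mve.
  + by apply: filterS vv'.
- apply: (@ae_eq_integral _ _ _ mu _ _ _ (measurable_cube a l)).
  + exact: measurable_funTS (emeasurable_funM mga mv).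
  + exact: measurable_funTS (emeasurable_funM mga mve).
  + by apply: filterS vv' => y ->.
Qed.

Lemma Ainfty_uniformly_extrapolates (p : R) (F : pairs) : (0 < p)%R ->
  extrapolation_family F ->
  Ainfty_uniformly (fun w C => forall f g, F (f, g) ->
    weighted_Lnorm p w f <= C%:E * weighted_Lnorm p w g) ->
  muckenhoupt_extrapolates p F.
Proof.
move=> p0 Ffam ext q K q1.
have K1 : (1 <= Num.max 1 K)%R by rewrite le_max lexx.
have [C C0 CP] := ext q (Num.max 1 K)%R (ltW q1) K1.
exists (C `^ p)%R; first by rewrite powR_gt0.
move=> w Mw f g Ffg; have [mf mg f0 g0] := Ffam _ _ Ffg.
have wK : Ap_char q (EFin \o w) <= (Num.max 1 K)%:E.
  apply: le_trans (muckenhoupt_Ap_char q1 Mw) _.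
  by rewrite lee_fin le_max lexx orbT.
have := CP _ (muckenhoupt_weight Mw) wK _ _ Ffg; rewrite /weighted_Lnorm.
have [_ w0 _] := Mw.
have absE (k : X -> \bar R) : (forall x, 0 <= k x) ->
    \int[mu]_x (`|k x| `^ p * (EFin \o w) x) = \int[mu]_x (k x `^ p * (w x)%:E).
  by move=> k0; apply: eq_integral => x _; rewrite gee0_abs.
rewrite (absE _ f0) (absE _ g0).
have int0 (k : X -> \bar R) : 0 <= \int[mu]_x (k x `^ p * (w x)%:E).
  by apply: integral_ge0 => x _; rewrite mule_ge0 ?poweR_ge0// lee_fin ltW.
have powK (y : \bar R) : 0 <= y -> (y `^ p^-1) `^ p = y.
  by move=> y0; rewrite -poweRrM mulVf ?gt_eqF// poweRe1.
move=> h; rewrite -[leLHS]powK// -[X in _ <= _ * X]powK// -poweR_EFin -poweRM ?poweR_ge0 ?lee_fin ?(ltW C0)//.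
apply: gt0_ler_poweR => //; first exact: ltW.
  by rewrite in_itv/= leey andbT poweR_ge0.
by rewrite in_itv/= leey andbT mule_ge0 ?poweR_ge0// lee_fin ltW.
Qed.

Lemma Ainfty_muckenhoupt (v : X -> \bar R) (v' : X -> R) : Ainfty v ->
  measurable_fun [set: X] v' -> (forall x, 0 < v' x)%R ->
  {ae mu, forall x, v x = (v' x)%:E} ->
  exists q K, (1 < q)%R /\ muckenhoupt q K v'.
Proof.
move=> [p p1 [[mv _] vp]] mv' v'0 vv'.
move: p1; rewrite le_eqVlt => /predU1P[p1|p1].
  have [K MK] : exists K, muckenhoupt 2 K v'.
    by apply: (A1_muckenhoupt mv mv' v'0 vv'); rewrite p1.
  by exists 2%R, K; split => //; rewrite ltr1n.
exists p, (fine (Ap_char p v)); split => //.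
apply: Ap_char_muckenhoupt => //; rewrite -(Ap_char_ae_eq p1 mv mv' vv').
by case: (Ap_char p v) vp => [r| |]// _; rewrite leNye.
Qed.

End Transfer.

Theorem theorem4p5 (R : realType) (n : nat)
    (F : set ((euclidean R n -> \bar R) * (euclidean R n -> \bar R)))
    (Phi : R -> R) (u v : euclidean R n -> \bar R) (p0 : R) :
  extrapolation_family F ->
  young_function Phi ->
  1 < lower_index Phi ->
  lower_index Phi <= upper_index Phi ->
  upper_index Phi < +oo ->
  weight u -> weight v -> Ainfty v ->
  (0 < p0)%R ->
  Ainfty_uniformly (fun w C => forall f g, F (f, g) ->
    weighted_Lnorm p0 w f <= C%:E * weighted_Lnorm p0 w g) ->
  (exists2 K0 : R, (0 < K0)%R &
    forall f : euclidean R n -> \bar R,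
    measurable_fun [set: euclidean R n] f ->
    \int[@lebesgue R n]_x
      (young_compl Phi (weighted_maximal v f x * (u x)^-1) * v x) <=
    K0%:E * \int[@lebesgue R n]_x
      (young_compl Phi (`|f x| * (u x)^-1) * v x)) ->
  (forall p : R, (0 < p)%R ->
    exists2 C : R, (0 < C)%R &
    forall f g, F (f, g) ->
    \int[@lebesgue R n]_x (young_ext Phi (f x `^ p * u x) * v x) <=
    C%:E * \int[@lebesgue R n]_x (young_ext Phi (g x `^ p * u x) * v x)) /\
  (forall q : R, (0 < q)%R ->
    exists2 C : R, (0 < C)%R &
    forall (J : pred nat) (f g : nat -> euclidean R n -> \bar R),
    (forall j, J j -> F (f j, g j)) ->
    \int[@lebesgue R n]_x
      (young_ext Phi ((\sum_(j <oo | J j) f j x `^ q) `^ q^-1 * u x) * v x) <=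
    C%:E * \int[@lebesgue R n]_x
      (young_ext Phi ((\sum_(j <oo | J j) g j x `^ q) `^ q^-1 * u x) * v x)).
Proof.
move=> Ffam PhiY i1 iI Ioo [mu_ u0] [mv v0] Av p00 ext [K0 K00 MK0].
have [D PhiD] := young_function_doubling PhiY i1 iI Ioo.
have [u' [mu' u'0 uu']] := positive_representative mu_ u0.
have [v' [mv' v'0 vv']] := positive_representative mv v0.
have [r [Kv [r1 Mv]]] := Ainfty_muckenhoupt Av mv' v'0 vv'.
have {}ext := Ainfty_uniformly_extrapolates p00 Ffam ext.
pose X := euclidean R n; pose mu := @lebesgue R n.
have mue : measurable_fun [set: X] (EFin \o u') by exact/measurable_EFinP.
have mve : measurable_fun [set: X] (EFin \o v') by exact/measurable_EFinP.
have ue0 x : 0 <= (u' x)%:E by rewrite lee_fin ltW.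
have ve0 x : 0 <= (v' x)%:E by rewrite lee_fin ltW.
have mui : measurable_fun [set: X] (fun x => ((u' x)^-1)%:E).
  apply/measurable_EFinP; apply: (measurable_invr_pos mu') => x.
  exact: ltW.
have complE (k : X -> \bar R) : measurable_fun [set: X] k ->
    \int[mu]_x (young_compl Phi (k x * (u x)^-1) * v x) =
    \int[mu]_x (young_compl Phi (k x * ((u' x)^-1)%:E) * (v' x)%:E).
  move=> mk; apply: ae_eq_integral_complete.
    apply: emeasurable_funM mve.
    apply: measurableT_comp (@measurable_young_compl R Phi) _.
    exact: (emeasurable_funM mk mui).
  by apply: filterS2 uu' vv' => x -> ->; rewrite inver gt_eqF.
have modE (k : X -> \bar R) : measurable_fun [set: X] k -> (forall x, 0 <= k x) ->
    \int[mu]_x (young_ext Phi (k x * u x) * v x) =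
    \int[mu]_x (young_ext Phi (k x * (u' x)%:E) * (v' x)%:E).
  move=> mk k0; apply: ae_eq_integral_complete.
    have ku0 x : 0 <= k x * (u' x)%:E by rewrite mule_ge0.
    exact: (emeasurable_funM (measurable_young_ext PhiD (emeasurable_funM mk mue) ku0) mve).
  by apply: filterS2 uu' vv' => x -> ->.
pose K : R := Num.max 1%R K0.
have K1 : (1 <= K)%R by rewrite le_max lexx.
have MK : modular_maximal_bound Phi u' v' K.
  move=> g mg g0.
  have wmE : weighted_maximal v g = weighted_maximal (EFin \o v') g.
    by apply/funext => x; exact: weighted_maximal_ae_eq.
  have mM := measurable_weighted_maximal (EFin \o v') g.
  have := MK0 g mg; rewrite wmE (complE _ mM).
  have -> : \int[lebesgue (n:=n)]_x (young_compl Phi (`|g x| * (u x)^-1) * v x) =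
      \int[mu]_x (young_compl Phi (g x * ((u' x)^-1)%:E) * (v' x)%:E).
    by rewrite -(complE _ mg); apply: eq_integral => x _; rewrite gee0_abs.
  move=> /le_trans; apply; apply: lee_wpmul2r; last by rewrite lee_fin le_max lexx orbT.
  apply: integral_ge0 => x _; rewrite mule_ge0//.
  apply: young_compl_ge0; first exact: (doubling_young_small PhiD).
  by rewrite mule_ge0// lee_fin invr_ge0 ltW.
split=> [p p_gt0|q q0].
- have [C C0 CP] := modular_extrapolation PhiD mu' u'0 r1 Mv K1 MK Ffam p_gt0
    (extrapolate_all p00 p_gt0 Ffam ext).
  exists C => // f g Ffg; have [mf mg f0 g0] := Ffam _ _ Ffg.
  have mpow (k : X -> \bar R) : measurable_fun [set: X] k ->
      measurable_fun [set: X] (fun x => k x `^ p).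
    by move=> mk; exact: measurableT_comp (measurable_poweR _) mk.
  rewrite (modE _ (mpow f mf) (fun x => poweR_ge0 _ _)).
  rewrite (modE _ (mpow g mg) (fun x => poweR_ge0 _ _)).
  exact: CP.
- have Vfam := @vector_family_extrapolation R n q F Ffam.
  have Vext := extrapolate_vector q0 Ffam (extrapolate_all p00 q0 Ffam ext).
  have [C C0 CP] := modular_extrapolation PhiD mu' u'0 r1 Mv K1 MK Vfam ltr01
    (extrapolate_all q0 ltr01 Vfam Vext).
  exists C => // J f g FJ.
  pose a (k : nat -> X -> \bar R) x := (\sum_(j <oo | J j) k j x `^ q) `^ q^-1.
  have Vfg : vector_family q F (a f, a g) by exists J, f, g.
  have [mf mg f0 g0] := Vfam _ _ Vfg.
  rewrite (modE _ mf f0) (modE _ mg g0).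
  have := CP _ _ Vfg.
  under eq_integral do rewrite poweRe1//.
  under [in X in _ <= X]eq_integral do rewrite poweRe1//.
  by [].
Qed.
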